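(* Let $H$ be a homology theory or a cohomology theory on closed pairs of metrizable spaces. Then $H$ satisfies the map excision axiom if and only if $H$ is fine shape invariant.
   Context: A closed pair of metrizable spaces is a pair $(X,A)$, where $X$ is metrizable and $A$ is closed in $X$. A (co)homology theory on closed pairs of metrizable spaces is a sequence of covariant (contravariant) functors $H_n$ (resp. $H^n$), $n\in\mathbb Z$, from closed pairs of metrizable spaces and continuous maps of pairs to abelian groups, with natural (co)boundary homomorphisms, satisfying the Eilenberg–Steenrod homotopy, exactness and excision axioms (the dimension axiom is not required). Map excision axiom: every closed map $f\colon(X,A)\to(Y,B)$ of closed pairs that restricts to a homeomorphism between $X\setminus A$ and $Y\setminus B$ induces for each $n$ an isomorphism $H_n(X,A)\simeq H_n(Y,B)$ (resp. $H^n(X,A)\simeq H^n(Y,B)$). Fine shape invariant: the restriction of $H$ to single spaces $(X,\emptyset)$, regarded as a covariant (contravariant) functor from the homotopy category of metrizable spaces to graded abelian groups, factors through the fine shape category, via the forgetful functor from the homotopy category of metrizable spaces to the fine shape category. Fine shape category. Maps are continuous, $I=[0,1]$. Absolute retracts (ARs) are those for metrizable spaces. A closed subset $X$ of an AR $M$ is a Z-set if there is a homotopy $h_t\colon M\to M$ with $h_0=\mathrm{id}$ and $h_t(M)\subset M\setminus X$ for $t>0$. Every metrizable space embeds as a Z-set in some AR. If $X\subset M$ and $Y\subset N$ are closed subsets of metrizable spaces, a map $f\colon M\setminus X\to N\setminus Y$ is $X$-$Y$-approaching if it sends every sequence having a cluster point in $X$ to a sequence having a cluster point in $Y$. An $X$-$Y$-approaching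 homotopy is a homotopy $(M\setminus X)\times I\to N\setminus Y$ that is an $(X\times I)$-$Y$-approaching map. If $X$, $Y$ are Z-sets in ARs $M$, $N$ and $\varphi\colon X\to Y$ is a map, $\varphi_{MN}\colon M\setminus X\to N\setminus Y$ denotes an $X$-$Y$-approaching map combining with $\varphi$ into a continuous map $M\to N$ (it exists and is unique up to $X$-$Y$-approaching homotopy). The objects of the fine shape category are metrizable spaces. $X$-$Y$-approaching maps $\Phi\colon M\setminus X\to N\setminus Y$ and $\Phi'\colon M'\setminus X\to N'\setminus Y$ (with $X$ a Z-set in ARs $M,M'$ and $Y$ a Z-set in ARs $N,N'$) represent the same fine shape morphism $X\to Y$ if $(\mathrm{id}_Y)_{NN'}\Phi$ and $\Phi'(\mathrm{id}_X)_{MM'}$ are $X$-$Y$-approaching homotopic; fine shape morphisms are the equivalence classes, and composition is induced by composition of representatives $M\setminus X\to N\setminus Y\to L\setminus Z$. The forgetful functor from the homotopy category of metrizable spaces is the identity on objects and sends $[\varphi]$ to the class of $\varphi_{MN}$. *)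

(* Defs.v *)
From HB Require Import structures.
From mathcomp Require Import all_boot all_order all_algebra.
From mathcomp Require Import all_classical all_reals topology.

Set Implicit Arguments.
Unset Strict Implicit.
Unset Printing Implicit Defensive.

Import Order.TTheory GRing.Theory Num.Theory.
Import numFieldTopology.Exports.
Local Open Scope classical_set_scope.
Local Open Scope ring_scope.

(* Subsets used as types, e.g. [~` A : Type], carry the subspace topology
   (coercion [set_type]). *)

Section maps.
Context {X Y : topologicalType}.

Definition homeomorphism (f : X -> Y) : Prop :=
  continuous f /\
  exists g : Y -> X, [/\ continuous g, cancel f g & cancel g f].

Definition closed_map (f : X -> Y) : Prop :=
  forall C : set X, closed C -> closed (f @` C).

Definition closed_embedding (f : X -> Y) : Prop :=
  [/\ continuous f, injective f & closed_map f].

Section restrict_map.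
Variables (A : set X) (B : set Y) (f : continuousType X Y).
Hypothesis fAB : forall x, A x -> B (f x).

Definition restrict_fun (a : A) : B :=
  exist _ (f (set_val a)) (mem_set (fAB (set_valP a))).

Lemma restrict_fun_continuous : continuous restrict_fun.
Proof.
apply: continuous_comp_initial => a.
apply: (@continuous_comp A X Y set_val f); first exact: initial_continuous.
exact: cts_fun.
Qed.

HB.instance Definition _ := isContinuous.Build _ _ restrict_fun
  restrict_fun_continuous.

Definition restrict_map : continuousType A B := restrict_fun.
End restrict_map.

End maps.

Section incl_map.
Context {X : topologicalType} (A : set X).

Lemma set_val_continuous : continuous (set_val : A -> X).
Proof. exact: initial_continuous. Qed.

HB.instance Definition _ :=
  isContinuous.Build A X (set_val : A -> X) set_val_continuous.

Definition incl_map : continuousType A X := (set_val : A -> X).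
End incl_map.

Definition idmap (X : topologicalType) : continuousType X X := @idfun X.

Definition compmap (X Y Z : topologicalType)
    (g : continuousType Y Z) (f : continuousType X Y) : continuousType X Z :=
  g \o f.

Definition exact_at (U V W : zmodType) (f : U -> V) (g : V -> W) : Prop :=
  forall v, g v = 0 <-> exists u, f u = v.

Section metric_sub.
Context {R : realType} {M : metricType R} (A : set M).

Let sub_mdist (x y : A) : R := mdist (set_val x) (set_val y).

Let sub_mdist_ge0 x y : 0 <= sub_mdist x y.
Proof. exact: mdist_ge0. Qed.

Let sub_mdist_positivity x y : sub_mdist x y = 0 -> x = y.
Proof. by move=> /mdist_positivity xy; apply: val_inj. Qed.

Let sub_ballE (x : A) d : ball x d = [set y | sub_mdist x y < d].
Proof. by rewrite -initial_ballE ballEmdist. Qed.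

HB.instance Definition _ := PseudoMetric_isMetric.Build R (set_type A)
  sub_mdist_ge0 sub_mdist_positivity sub_ballE.

End metric_sub.

Section theories.
Variable R : realType.

Definition unit_interval : topologicalType := `[0, 1]%classic : set R.

Lemma unit_interval_proof0 : `[0, 1]%classic (0 : R).
Proof. by rewrite /= in_itv /= lexx ler01. Qed.

Lemma unit_interval_proof1 : `[0, 1]%classic (1 : R).
Proof. by rewrite /= in_itv /= lexx ler01. Qed.

Definition I0 : unit_interval := exist _ 0 (mem_set unit_interval_proof0).
Definition I1 : unit_interval := exist _ 1 (mem_set unit_interval_proof1).

Definition metrizable (X : topologicalType) : Prop :=
  exists (M : metricType R) (f : X -> M), homeomorphism f.

Lemma metrizable_sub (X : topologicalType) (A : set X) :
  metrizable X -> metrizable (A : topologicalType).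
Proof.
move=> [M [f [cf [g [cg fK gK]]]]].
pose f' : continuousType X M := HB.pack f (isContinuous.Build _ _ f cf).
pose g' : continuousType M X := HB.pack g (isContinuous.Build _ _ g cg).
have fA x : A x -> (f @` A) (f' x) by exists x.
have gA y : (f @` A) y -> A (g' y) by move=> [x Ax <-] /=; rewrite fK.
exists (f @` A : metricType R), (restrict_map fA).
split; first exact: restrict_fun_continuous.
exists (restrict_map gA); split; first exact: restrict_fun_continuous.
  by move=> x; apply: val_inj; rewrite /= fK.
by move=> y; apply: val_inj; rewrite /= gK.
Qed.

Structure metrizable_space := MetrizableSpace {
  ms_space :> topologicalType;
  ms_metrizable : metrizable ms_space
}.

Definition sub_space (X : metrizable_space) (A : set X) : metrizable_space :=
  MetrizableSpace (metrizable_sub A (@ms_metrizable X)).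

Structure closed_pair := ClosedPair {
  cp_space :> metrizable_space;
  cp_sub : set cp_space;
  cp_closed : closed cp_sub
}.

Arguments cp_sub : clear implicits.

Structure pair_map (P Q : closed_pair) := PairMap {
  pair_fun :> continuousType P Q;
  pair_funP : forall x : P, cp_sub P x -> cp_sub Q (pair_fun x)
}.

Definition pair_id (P : closed_pair) : pair_map P P :=
  @PairMap P P (idmap P) (fun x Ax => Ax).

Definition pair_comp (P Q S : closed_pair) (g : pair_map Q S)
    (f : pair_map P Q) : pair_map P S :=
  @PairMap P S (compmap g f) (fun x Ax => pair_funP g (pair_funP f Ax)).

Definition single (X : metrizable_space) : closed_pair :=
  @ClosedPair X set0 closed0.

Definition single_map (X Y : metrizable_space) (f : continuousType X Y) :
    pair_map (single X) (single Y) :=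
  @PairMap (single X) (single Y) f (fun x x0 => x0).

(* A pair P = (X, A) gives rise to (A, set0) -> (X, set0) -> (X, A). *)
Definition sub_pair (P : closed_pair) : closed_pair :=
  single (sub_space (cp_sub P)).

Definition incl_sub (P : closed_pair) : pair_map (sub_pair P) (single P) :=
  single_map (incl_map (cp_sub P) :
    continuousType (sub_space (cp_sub P)) (cp_space P)).

Definition incl_pair (P : closed_pair) : pair_map (single P) P :=
  @PairMap (single P) P (idmap P) (fun x => False_ind _).

Definition restrict_pair (P Q : closed_pair) (f : pair_map P Q) :
    pair_map (sub_pair P) (sub_pair Q) :=
  single_map (restrict_map (@pair_funP P Q f) :
    continuousType (sub_space (cp_sub P)) (sub_space (cp_sub Q))).

Definition pair_homotopic (P Q : closed_pair) (f g : pair_map P Q) : Prop :=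
  exists h : continuousType (P * unit_interval)%type Q,
    [/\ forall x, h (x, I0) = f x,
        forall x, h (x, I1) = g x
      & forall x t, cp_sub P x -> cp_sub Q (h (x, t))].

(* (X \ U, A \ U), for P = (X, A) *)
Definition excised (P : closed_pair) (U : set P) : closed_pair :=
  @ClosedPair (sub_space (~` U)) (incl_map (~` U) @^-1` cp_sub P)
    (preimage_closed (fun x _ => @cts_fun _ _ (incl_map (~` U)) x) (@cp_closed P)).

Definition excision_map (P : closed_pair) (U : set P) :
    pair_map (excised U) P :=
  @PairMap (excised U) P (incl_map (~` U)) (fun x Ax => Ax).

(* The (co)boundary is indexed by the degree of the group of the subspace, so
   that no cast between degrees (n - 1) + 1 and n is needed. *)

Structure homology_theory := HomologyTheory {
  hgrp :> int -> closed_pair -> zmodType;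
  hmap : forall n P Q, pair_map P Q -> {additive hgrp n P -> hgrp n Q};
  hbd : forall n P, {additive hgrp (n + 1) P -> hgrp n (sub_pair P)};
  hmap_id : forall n P, hmap n (pair_id P) =1 id;
  hmap_comp : forall n P Q S (g : pair_map Q S) (f : pair_map P Q),
    hmap n (pair_comp g f) =1 hmap n g \o hmap n f;
  hbd_natural : forall n P Q (f : pair_map P Q),
    hbd n Q \o hmap (n + 1) f =1 hmap n (restrict_pair f) \o hbd n P;
  h_homotopy : forall n P Q (f g : pair_map P Q),
    pair_homotopic f g -> hmap n f =1 hmap n g;
  h_exact_sub : forall n P, exact_at (hbd n P) (hmap n (incl_sub P));
  h_exact_space : forall n P,
    exact_at (hmap n (incl_sub P)) (hmap n (incl_pair P));
  h_exact_pair : forall n P, exact_at (hmap (n + 1) (incl_pair P)) (hbd n P);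
  h_excision : forall n (P : closed_pair) (U : set P),
    open U -> closure U `<=` interior (cp_sub P) ->
    bijective (hmap n (excision_map U))
}.

Structure cohomology_theory := CohomologyTheory {
  cgrp :> int -> closed_pair -> zmodType;
  cmap : forall n P Q, pair_map P Q -> {additive cgrp n Q -> cgrp n P};
  cbd : forall n P, {additive cgrp n (sub_pair P) -> cgrp (n + 1) P};
  cmap_id : forall n P, cmap n (pair_id P) =1 id;
  cmap_comp : forall n P Q S (g : pair_map Q S) (f : pair_map P Q),
    cmap n (pair_comp g f) =1 cmap n f \o cmap n g;
  cbd_natural : forall n P Q (f : pair_map P Q),
    cbd n P \o cmap n (restrict_pair f) =1 cmap (n + 1) f \o cbd n Q;
  c_homotopy : forall n P Q (f g : pair_map P Q),
    pair_homotopic f g -> cmap n f =1 cmap n g;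
  c_exact_pair : forall n P, exact_at (cbd n P) (cmap (n + 1) (incl_pair P));
  c_exact_space : forall n P,
    exact_at (cmap n (incl_pair P)) (cmap n (incl_sub P));
  c_exact_sub : forall n P, exact_at (cmap n (incl_sub P)) (cbd n P);
  c_excision : forall n (P : closed_pair) (U : set P),
    open U -> closure U `<=` interior (cp_sub P) ->
    bijective (cmap n (excision_map U))
}.

Definition restricts_to_homeomorphism (P Q : closed_pair)
    (f : pair_map P Q) : Prop :=
  exists g : (~` cp_sub P : set P) -> (~` cp_sub Q : set Q),
    (forall x, set_val (g x) = f (set_val x)) /\ homeomorphism g.

Definition map_excision (H : homology_theory) : Prop :=
  forall (P Q : closed_pair) (f : pair_map P Q),
    closed_map f -> restricts_to_homeomorphism f ->
    forall n, bijective (hmap H n f).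

Definition comap_excision (H : cohomology_theory) : Prop :=
  forall (P Q : closed_pair) (f : pair_map P Q),
    closed_map f -> restricts_to_homeomorphism f ->
    forall n, bijective (cmap H n f).

(* In this sense the empty space is not an AR. *)
Definition absolute_retract (M : metrizable_space) : Prop :=
  forall (Z : metrizable_space) (e : M -> Z), closed_embedding e ->
    exists r : Z -> M, continuous r /\ cancel e r.

Definition Z_set (M : topologicalType) (A : set M) : Prop :=
  closed A /\
  exists h : M * unit_interval -> M,
    [/\ continuous h,
        forall x, h (x, I0) = x
      & forall x t, t != I0 -> ~ A (h (x, t))].

Definition approaching (M N : topologicalType) (A : set M) (B : set N)
    (f : (~` A) -> (~` B)) : Prop :=
  continuous f /\
  forall u : nat -> (~` A),
    (exists2 a, A a & cluster (set_val \o u @ \oo) a) ->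
    exists2 b, B b & cluster (set_val \o f \o u @ \oo) b.

Definition approaching_homotopic (M N : topologicalType) (A : set M)
    (B : set N) (f g : (~` A) -> (~` B)) : Prop :=
  exists h : (~` (A `*` [set: unit_interval])) -> (~` B),
    [/\ approaching h,
        forall x p, set_val p = (set_val x, I0) -> h p = f x
      & forall x p, set_val p = (set_val x, I1) -> h p = g x].

(* An embedding of X as a Z-set in an AR. *)
Structure Z_embedding (X : metrizable_space) := ZEmbedding {
  ze_space :> metrizable_space;
  ze_AR : absolute_retract ze_space;
  ze_map : X -> ze_space;
  ze_embedding : closed_embedding ze_map;
  ze_Z_set : Z_set (range ze_map)
}.

(* M \ X, where X is identified with its image in M *)
Definition rest (X : metrizable_space) (M : Z_embedding X) : topologicalType :=
  (~` range (@ze_map X M) : set M).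

Structure approaching_map (X Y : metrizable_space) (M : Z_embedding X)
    (N : Z_embedding Y) := ApproachingMap {
  am_fun :> rest M -> rest N;
  am_approaching : approaching am_fun
}.

Lemma approaching_id (X : metrizable_space) (M : Z_embedding X) :
  approaching (@idfun (rest M)).
Proof. by split=> //; move=> x. Qed.

Definition am_id (X : metrizable_space) (M : Z_embedding X) :
  approaching_map M M := ApproachingMap (approaching_id M).

Lemma approaching_comp (X Y Z : metrizable_space) (M : Z_embedding X)
    (N : Z_embedding Y) (L : Z_embedding Z)
    (g : approaching_map N L) (f : approaching_map M N) :
  approaching (g \o f : rest M -> rest L).
Proof.
case: f g => f [cf af] [g [cg ag]]; split=> [x|u uX] /=.
  by apply: continuous_comp; [exact: cf|exact: cg].
exact: (ag (f \o u) (af u uX)).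
Qed.

Definition am_comp (X Y Z : metrizable_space) (M : Z_embedding X)
    (N : Z_embedding Y) (L : Z_embedding Z)
    (g : approaching_map N L) (f : approaching_map M N) :
  approaching_map M L := ApproachingMap (approaching_comp g f).

(* [combines phi Phi]: Phi is a possible choice of phi_MN. *)
Definition combines (X Y : metrizable_space) (M : Z_embedding X)
    (N : Z_embedding Y) (phi : X -> Y) (Phi : approaching_map M N) : Prop :=
  exists f : M -> N,
    [/\ continuous f,
        forall x, f (ze_map M x) = ze_map N (phi x)
      & forall x, f (set_val x) = set_val (Phi x)].

Structure fs_rep (X Y : metrizable_space) := FSRep {
  rep_dom : Z_embedding X;
  rep_cod : Z_embedding Y;
  rep_map :> approaching_map rep_dom rep_cod
}.

(* i and j are (id_X)_MM' and (id_Y)_NN', which are unique up to approaching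
   homotopy. *)
Definition same_fs (X Y : metrizable_space) (r r' : fs_rep X Y) : Prop :=
  exists (i : approaching_map (rep_dom r) (rep_dom r'))
         (j : approaching_map (rep_cod r) (rep_cod r')),
    [/\ combines idfun i, combines idfun j
      & approaching_homotopic (am_comp j r) (am_comp r' i)].

(* Fine shape morphisms are classes of representatives.  They are plain
   predicates because [set] lives in too small a universe. *)
Structure fs_mor (X Y : metrizable_space) := FSMor {
  fs_class : fs_rep X Y -> Prop;
  fs_classP : exists r, fs_class = same_fs r
}.

Definition fs_mor_of (X Y : metrizable_space) (M : Z_embedding X)
    (N : Z_embedding Y) (Phi : approaching_map M N) : fs_mor X Y :=
  FSMor (ex_intro _ (FSRep Phi) erefl).

Definition fs_identity (X : metrizable_space) (a : fs_mor X X) : Prop :=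
  exists M : Z_embedding X, a = fs_mor_of (am_id M).

(* First a, then b.  Composition is given by its graph, as composing two
   arbitrary representatives requires a common Z-embedding of Y. *)
Definition fs_composite (X Y Z : metrizable_space) (a : fs_mor X Y)
    (b : fs_mor Y Z) (c : fs_mor X Z) : Prop :=
  exists (M : Z_embedding X) (N : Z_embedding Y) (L : Z_embedding Z)
         (Phi : approaching_map M N) (Psi : approaching_map N L),
    [/\ a = fs_mor_of Phi, b = fs_mor_of Psi
      & c = fs_mor_of (am_comp Psi Phi)].

(* The graph of the forgetful functor: [phi] is sent to the class of phi_MN. *)
Definition fs_forget (X Y : metrizable_space) (phi : continuousType X Y)
    (a : fs_mor X Y) : Prop :=
  exists (M : Z_embedding X) (N : Z_embedding Y) (Phi : approaching_map M N),
    combines phi Phi /\ a = fs_mor_of Phi.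

(* The forgetful functor is the identity on objects, so a functor through
   which H factors has the same groups as H. *)

Definition fine_shape_invariant (H : homology_theory) : Prop :=
  exists F : forall n (X Y : metrizable_space), fs_mor X Y ->
      {additive H n (single X) -> H n (single Y)},
    [/\ forall n X (a : fs_mor X X), fs_identity a -> F n X X a =1 id,
        forall n X Y Z (a : fs_mor X Y) (b : fs_mor Y Z) (c : fs_mor X Z),
          fs_composite a b c -> F n X Z c =1 F n Y Z b \o F n X Y a
      & forall n (X Y : metrizable_space) (phi : continuousType X Y)
            (a : fs_mor X Y),
          fs_forget phi a -> F n X Y a =1 hmap H n (single_map phi)].

Definition fine_shape_coinvariant (H : cohomology_theory) : Prop :=
  exists F : forall n (X Y : metrizable_space), fs_mor X Y ->
      {additive H n (single Y) -> H n (single X)},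
    [/\ forall n X (a : fs_mor X X), fs_identity a -> F n X X a =1 id,
        forall n X Y Z (a : fs_mor X Y) (b : fs_mor Y Z) (c : fs_mor X Z),
          fs_composite a b c -> F n X Z c =1 F n X Y a \o F n Y Z b
      & forall n (X Y : metrizable_space) (phi : continuousType X Y)
            (a : fs_mor X Y),
          fs_forget phi a -> F n X Y a =1 cmap H n (single_map phi)].

End theories.

Arguments cp_sub {R} c _.

(* Main.v *)
(* If H satisfies map excision, the closure W of the graph of an X-Y-approaching map
   M \ X -> N \ Y is a perfect relation over M, single-valued off X, and carries X to Y.
   The Z-set homotopy of M maps X x I to M, with only X x 0 landing in X. Pulling W back
   along it gives a pair that projects onto (X x I, X x 0) by a closed map, which is a
   homeomorphism off X x 0. As X x 0 -> X x I induces isomorphisms, so does, by map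
   excision, the inclusion of the part of the pullback over X x 0. The section over X x 1,
   the inverse of that inclusion, and the projection to Y compose to the induced
   homomorphism H(X) -> H(Y).

   Conversely, let f : (X, A) -> (Y, B) be as in the map excision axiom. Attach to X the
   cylinder of A with a contractible top, and likewise to Y; by excision and the five
   lemma it suffices that the induced map f^ : X^ -> Y^ is an isomorphism. The inverse of
   f on Y \ B, extended over the cube around Y and raised to the contractible top where the
   extension does not follow the inverse, is an approaching map: since f is closed, the
   inverse clusters in A near every point of B that it approaches. Its class is inverse
   to that of f^ in the fine shape category. *)
Require Import Defs.
From HB Require Import structures.
From mathcomp Require Import all_boot all_order all_algebra.
From mathcomp Require Import all_classical all_reals topology normedtype.
From mathcomp Require Import ring lra.

Set Implicit Arguments.
Unset Strict Implicit.
Unset Printing Implicit Defensive.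

Import Order.TTheory GRing.Theory Num.Theory.
Import numFieldNormedType.Exports.
Local Open Scope classical_set_scope.
Local Open Scope ring_scope.

(** * Metrizable spaces and sequences *)

Notation "u ~> x" := (u @ \oo --> x) (at level 70).

(** A fine shape morphism has no underlying map X -> Y; it is known only through the behaviour of
    representatives near X, where the closed graph W may have many values. The graph over (M, X)
    itself would not do, since X -> M usually induces no isomorphism; this is why W is pulled back
    to X x I, whose bottom is a homotopy equivalence.

    In the converse direction, sequences in Y \ B that tend to B do have clustering preimages. The
    obstacle is points of B that are not approached from Y \ B, over which f may have no preimage at
    all: an extension of the inverse is arbitrary near them, and the top is where it can be sent. A
    second obstacle is that f need not be injective on A, which makes the two composites behave
    differently.

    The attached space lives in [0,1]^X x I with the uniform metric on [0,1]^X. The complement of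
    the Z-set is then the convex set [0,1]^X x I x (0,1], so homotopies can be straight lines and
    only their clustering as time tends to 0 is in question.

    Both variances are treated at once by fixing the direction of homomorphisms abstractly, and
    point-set arguments run through sequences, all spaces being metrizable. *)

Lemma set_val_inj (T : Type) (A : set T) : injective (set_val : A -> T).
Proof. by move=> x y; rewrite !set_valE => /val_inj. Qed.

Lemma set_val_ex (T : Type) (A : set T) m : A m -> exists x : A, set_val x = m.
Proof. by move=> Am; exists (exist _ m (mem_set Am)). Qed.

Section distance.
Context {R : realType}.

(** A metric on [X] itself for the topology that [X] already carries. The homeomorphism in
    [metrizable] leads to another type; a compatible distance on [X] avoids transporting every
    sequence along it. *)
Definition is_dist (X : topologicalType) (d : X -> X -> R) : Prop :=
  [/\ forall x, d x x = 0, forall x y, d x y = 0 -> x = y,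
      forall x y, d x y = d y x, forall y x z, d x z <= d x y + d y z
    & forall x U, nbhs x U <-> exists2 e, 0 < e & forall y, d x y < e -> U y].

Lemma mdist_is_dist (M : metricType R) : is_dist (@mdist R M).
Proof.
split; [exact: mdistxx|exact: mdist_positivity|exact: metric_sym| |].
  by move=> y x z; exact: metric_triangle.
move=> x U; rewrite -metricType_numDomainType.filter_from_mdist_nbhs; split=> -[e e0 xU]; exists e => //.
Qed.

Lemma homeo_is_dist (X : topologicalType) (M : metricType R) (f : X -> M) :
  homeomorphism f -> is_dist (fun x y => mdist (f x) (f y)).
Proof.
have [dxx d0 ds dt dn] := mdist_is_dist M.
move=> [cf [g [cg fK gK]]]; split=> [x|x y /d0 /(can_inj fK)|x y|y x z|x U] //.
split=> [|[e e0 xU]].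
  rewrite -{1}(fK x) => /cg /dn[e e0 gU]; exists e => // y /gU /=.
  by rewrite fK.
have /cf : nbhs (f x) [set y | mdist (f x) y < e] by apply/dn; exists e.
by apply: (@filterS _ (nbhs x)) => y /xU.
Qed.

(** [M] is the same set with the topology generated by [d]. The two topologies have the same
    neighbourhoods, so the identity is a homeomorphism between them. *)
Lemma is_dist_metrizable (X : topologicalType) (d : X -> X -> R) :
  is_dist d -> metrizable R X.
Proof.
move=> [dxx d0 ds dt dn].
pose C : choiceType := X.
pose m := @isMetric.Build R C d dxx d0 ds dt.
pose M : metricType R := HB.pack (Choice.sort C) m.
have dnM (x : M) U : nbhs x U <-> exists2 e, 0 < e & forall y, d x y < e -> U y.
  exact: (let: And5 _ _ _ _ h := mdist_is_dist M in h).
exists M, (fun x : X => x : M); split.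
  by move=> x U /dnM ?; apply/dn.
by exists (fun x : M => x : X); split=> // x U /dn ?; apply/dnM.
Qed.

Lemma metrizable_distP (X : topologicalType) :
  metrizable R X <-> exists d : X -> X -> R, is_dist d.
Proof.
split=> [[M [f /homeo_is_dist]]|[d /is_dist_metrizable]] //.
by exists (fun x y => mdist (f x) (f y)).
Qed.

Lemma metrizable_prod (X Y : topologicalType) :
  metrizable R X -> metrizable R Y -> metrizable R (X * Y)%type.
Proof.
move=> /metrizable_distP[d [dxx d0 ds dt dn]] /metrizable_distP[d' [dxx' d0' ds' dt' dn']].
have dge0 x y : 0 <= d x y by have := dt y x x; rewrite dxx (ds y) -mulr2n pmulrn_lge0.
have dge0' x y : 0 <= d' x y.
  by have := dt' y x x; rewrite dxx' (ds' y) -mulr2n pmulrn_lge0.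
apply/metrizable_distP; exists (fun p q => d p.1 q.1 + d' p.2 q.2); split.
- by move=> x; rewrite dxx dxx' addr0.
- move=> [x y] [x' y'] /= /eqP; rewrite paddr_eq0 // => /andP[/eqP/d0 -> /eqP/d0' ->] //.
- by move=> x y; rewrite ds ds'.
- by move=> y x z; rewrite addrACA lerD.
- move=> [x y] U; split=> [[[A B] /= [/dn[e e0 eA] /dn'[e' e0' eB]] AB]|[e e0 eU]].
    exists (Num.min e e') => [|[x' y'] /= h]; first by rewrite lt_min e0 e0'.
    apply: AB; split=> /=; [apply: eA|apply: eB].
      apply: le_lt_trans (lt_le_trans h _); first by rewrite lerDl.
      by rewrite ge_min lexx.
    apply: le_lt_trans (lt_le_trans h _); first by rewrite lerDr.
    by rewrite ge_min lexx orbT.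
  exists ([set x' | d x x' < e / 2], [set y' | d' y y' < e / 2]) => /=.
    by split; [apply/dn|apply/dn']; exists (e / 2) => //; rewrite divr_gt0.
  by move=> [x' y'] /= [h h']; apply: eU => /=; rewrite (splitr e) ltrD.
Qed.

Lemma metrizable_unit_interval : metrizable R (unit_interval R).
Proof.
apply: (@metrizable_sub R (R : topologicalType)); exists R^o, (fun x : R => x : R^o).
by split; [move=> x; exact: cvg_id|exists (fun x => x); split=> // x; exact: cvg_id].
Qed.

Definition prod_space (X Y : metrizable_space R) : metrizable_space R :=
  MetrizableSpace (metrizable_prod (@ms_metrizable R X) (@ms_metrizable R Y)).

Definition interval_space : metrizable_space R :=
  MetrizableSpace metrizable_unit_interval.

Definition dist_of (X : topologicalType) (h : metrizable R X) : X -> X -> R :=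
  sval (cid ((metrizable_distP X).1 h)).

Definition dist (X : metrizable_space R) : X -> X -> R :=
  dist_of (@ms_metrizable R X).

Section dist_theory.
Variable X : metrizable_space R.
Implicit Types (x y z : X) (u : nat -> X).

Lemma dist_is_dist : is_dist (@dist X).
Proof. exact: (svalP (cid ((metrizable_distP X).1 (@ms_metrizable R X)))). Qed.

Lemma distxx x : dist x x = 0. Proof. by case: dist_is_dist. Qed.
Lemma dist0_eq x y : dist x y = 0 -> x = y.
Proof. by case: dist_is_dist => _ h _ _ _; exact: h. Qed.
Lemma dist_sym x y : dist x y = dist y x. Proof. by case: dist_is_dist. Qed.
Lemma dist_triangle y x z : dist x z <= dist x y + dist y z.
Proof. by case: dist_is_dist. Qed.
Lemma nbhs_dist x U : nbhs x U <-> exists2 e, 0 < e & forall y, dist x y < e -> U y.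
Proof. by case: dist_is_dist. Qed.
Lemma dist_ge0 x y : 0 <= dist x y.
Proof. by have := dist_triangle y x x; rewrite distxx (dist_sym y) -mulr2n pmulrn_lge0. Qed.

Lemma cvg_distP u x :
  u ~> x <-> forall e, 0 < e -> exists N, forall n, (N <= n)%N -> dist x (u n) < e.
Proof.
split=> [ux e e0|h U /nbhs_dist[e e0 eU]].
  have /ux [N _ hN] : nbhs x [set y | dist x y < e] by apply/nbhs_dist; exists e.
  by exists N => n; exact: hN.
have [N hN] := h e e0; exists N => // n /hN; exact: eU.
Qed.

Lemma cvg_inj u x y : u ~> x -> u ~> y -> x = y.
Proof.
move=> /cvg_distP ux /cvg_distP uy; apply: dist0_eq; apply/eqP.
rewrite eq_le dist_ge0 andbT; apply/ler_addgt0Pl => e e0; rewrite addr0.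
have e20 : 0 < e / 2 by rewrite divr_gt0.
have [N hN] := ux _ e20; have [N' hN'] := uy _ e20.
have := hN _ (leq_maxl N N'); have := hN' _ (leq_maxr N N').
have := dist_triangle (u (maxn N N')) x y; rewrite (dist_sym (u _) y); lra.
Qed.

Lemma ltr_invS (e : R) : 0 < e -> exists N, forall n, (N <= n)%N -> n.+1%:R^-1 < e.
Proof.
move=> e0; exists (Num.bound e^-1) => n hn.
rewrite invf_plt ?posrE //; apply: lt_le_trans (archi_boundP _) _.
  by rewrite invr_ge0 ltW.
by rewrite ler_nat ltnW.
Qed.

(** For each n an index beyond n is chosen whose term is within 1/(n+1) of the cluster point. Here
    and below a subsequence is given by any [k] that tends to infinity, not by a strictly increasing
    one. *)
Lemma cluster_subseq u x : cluster (u @ \oo) x ->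
  exists2 k : nat -> nat, k @ \oo --> \oo & u \o k ~> x.
Proof.
move=> ux.
have /choice[k hk] : forall n : nat, exists k, (n <= k)%N /\ dist x (u k) < n.+1%:R^-1.
  move=> n.
  have := ux [set u k | k in [set k | (n <= k)%N]] [set y | dist x y < n.+1%:R^-1].
  case=> [||_ [[k hk <-] xk]]; last by exists k.
    by exists n => // k; exists k.
  by apply/nbhs_dist; exists n.+1%:R^-1; rewrite ?invr_gt0.
exists k.
  move=> U [N _ hN]; exists N => // n Nn; apply: hN => /=.
  exact: leq_trans Nn (hk n).1.
apply/cvg_distP => e e0.
have [N hN] := ltr_invS e0; exists N => n /hN; exact: lt_trans (hk n).2.
Qed.

Lemma subseq_cluster (k : nat -> nat) u x :
  k @ \oo --> \oo -> u \o k ~> x -> cluster (u @ \oo) x.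
Proof.
move=> kn ux A B [N _ hA] /ux [N' _ hB].
have /kn [N2 _ hk] : \oo [set n | (N <= n)%N] by exists N.
exists (u (k (maxn N' N2))); split; first by apply: hA; apply: hk; exact: leq_maxr.
by apply: hB; exact: leq_maxl.
Qed.

Lemma cvg_distS (u v : nat -> X) (x : X) (k : nat -> nat) :
  (forall j, dist (u j) (v j) < j.+1%:R^-1) -> k @ \oo --> \oo ->
  u \o k ~> x -> v \o k ~> x.
Proof.
move=> uv kn /cvg_distP ux; apply/cvg_distP => e e0.
have e20 : 0 < e / 2 by rewrite divr_gt0.
have [N hN] := ux _ e20; have [N' hN'] := ltr_invS e20.
have /kn [N2 _ hk] : \oo [set n | (N' <= n)%N] by exists N'.
exists (maxn N N2) => n; rewrite geq_max => /andP[/hN h1 /hk/hN' h2].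
apply: le_lt_trans (dist_triangle (u (k n)) _ _) _.
by rewrite (splitr e) ltrD // (lt_trans (uv _)).
Qed.

Lemma closure_seq (C : set X) x : closure C x ->
  exists2 u, forall n, C (u n) & u ~> x.
Proof.
move=> clx.
have /choice[u hu] : forall n : nat, exists y, C y /\ dist x y < n.+1%:R^-1.
  move=> n; have [|y [Cy xy]] := clx [set y | dist x y < n.+1%:R^-1]; last by exists y.
  by apply/nbhs_dist; exists n.+1%:R^-1; rewrite ?invr_gt0.
exists u => [n|]; first exact: (hu n).1.
apply/cvg_distP => e e0.
have [N hN] := ltr_invS e0; exists N => n /hN; exact: lt_trans (hu n).2.
Qed.

Lemma seq_closed (C : set X) :
  (forall u x, (forall n, C (u n)) -> u ~> x -> C x) -> closed C.
Proof. by move=> h x /closure_seq[u Cu ux]; exact: h ux. Qed.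

Lemma closed_lim (C : set X) u x :
  closed C -> (forall n, C (u n)) -> u ~> x -> C x.
Proof.
move=> cC Cu ux; apply: cC => U /ux [N _ hN].
by exists (u N); split=> //; apply: hN => /=.
Qed.

Lemma seq_continuous_at (Y : topologicalType) (f : X -> Y) x :
  (forall u, u ~> x -> f \o u ~> f x) -> {for x, continuous f}.
Proof.
move=> h U fxU; apply: contrapT => nU.
have /closure_seq[u hu ux] : closure (~` (f @^-1` U)) x.
  move=> V xV; apply: contrapT => VU; apply: nU; apply: filterS xV => y Vy.
  by apply: contrapT => Uy; apply: VU; exists y.
have [N _ /(_ N (leqnn N))] := h u ux U fxU.
exact: hu.
Qed.

Lemma seq_continuous (Y : topologicalType) (f : X -> Y) :
  (forall u x, u ~> x -> f \o u ~> f x) -> continuous f.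
Proof. by move=> h x; apply: seq_continuous_at => u; exact: h. Qed.

End dist_theory.

Lemma cvg_subseq (T : topologicalType) (u : nat -> T) (x : T) (k : nat -> nat) :
  k @ \oo --> \oo -> u ~> x -> u \o k ~> x.
Proof. by move=> kn ux; apply: cvg_comp kn ux. Qed.

Lemma subseq_comp (k k' : nat -> nat) :
  k @ \oo --> \oo -> k' @ \oo --> \oo -> k \o k' @ \oo --> \oo.
Proof. by move=> kn kn'; apply: cvg_comp kn' kn. Qed.

Lemma cvg_cont (T U : topologicalType) (f : T -> U) (u : nat -> T) (x : T) :
  {for x, continuous f} -> u ~> x -> f \o u ~> f x.
Proof. by move=> cf ux; apply: cvg_comp ux cf. Qed.

Lemma cvg_pairP (T U : topologicalType) (u : nat -> T * U) (x : T * U) :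
  u ~> x <-> fst \o u ~> x.1 /\ snd \o u ~> x.2.
Proof.
split=> [ux|[ux1 ux2]].
  split.
    by apply: cvg_comp ux _; case: x => a b; exact: cvg_fst.
  by apply: cvg_comp ux _; case: x => a b; exact: cvg_snd.
have -> : u = (fun n => (fst (u n), snd (u n))) by apply/funext => n; case: (u n).
by case: x ux1 ux2 => a b; exact: cvg_pair.
Qed.

Lemma cvg_valP (T : topologicalType) (A : set T) (u : nat -> A) (x : A) :
  u ~> x <-> set_val \o u ~> set_val x.
Proof.
split=> [ux|ux].
  by apply: cvg_comp ux _; exact: initial_continuous.
move=> U /= [V [[W oW <-] /= Wx WU]].
have /ux [N _ hN] : nbhs (set_val x) W by apply: open_nbhs_nbhs.
by exists N => // n /hN Wn; apply: WU.
Qed.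

Lemma cvg_const (T : topologicalType) (x : T) : (fun _ : nat => x) ~> x.
Proof. exact: cvg_cst. Qed.

Lemma cvg_eq_near (T : topologicalType) (u v : nat -> T) (x : T) :
  (exists N, forall n, (N <= n)%N -> u n = v n) -> u ~> x -> v ~> x.
Proof.
move=> [N hN] ux U /ux [N' _ hN']; exists (maxn N N') => // n /=.
rewrite geq_max => /andP[h h'] /=; rewrite -hN //; exact: hN'.
Qed.

End distance.

Definition ctsmap (X Y : topologicalType) (f : X -> Y) (cf : continuous f) :
  continuousType X Y := mkcts cf.

(** * Arithmetic in the unit interval *)

Section interval.
Context {R : realType}.
Local Notation I := (unit_interval R).

Definition ival (t : I) : R := set_val t.

Lemma ival_itv (t : I) : 0 <= ival t <= 1.
Proof. by have := set_valP t; rewrite /= in_itv. Qed.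

Lemma clamp_itv (r : R) : `[0, 1]%classic (Num.max 0 (Num.min 1 r)).
Proof. by rewrite /= in_itv /= le_max lexx ge_max ler01 ge_min lexx. Qed.

(** Truncation allows points of the interval to be given by real formulas without carrying bounds;
    its continuity is that of max and min, and [clampIK] removes it where the bounds hold. *)
Definition clampI (r : R) : I := exist _ (Num.max 0 (Num.min 1 r)) (mem_set (clamp_itv r)).

Lemma clampIE r : ival (clampI r) = Num.max 0 (Num.min 1 r).
Proof. by []. Qed.

Lemma clampIK r : 0 <= r <= 1 -> ival (clampI r) = r.
Proof. by move=> /andP[r0 r1]; rewrite clampIE (min_idPr r1) (max_idPr r0). Qed.

Lemma ivalK t : clampI (ival t) = t.
Proof. by apply: val_inj; exact: clampIK (ival_itv t). Qed.

Lemma ival_inj : injective ival.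
Proof. by move=> s t st; rewrite -(ivalK s) st ivalK. Qed.

Lemma ival0 : ival (I0 R) = 0. Proof. by []. Qed.
Lemma ival1 : ival (I1 R) = 1. Proof. by []. Qed.

Lemma clampI0 : clampI 0 = I0 R.
Proof. by apply: ival_inj; rewrite clampIK ?lexx ?ler01. Qed.
Lemma clampI1 : clampI 1 = I1 R.
Proof. by apply: ival_inj; rewrite clampIK ?lexx ?ler01. Qed.

Lemma I1_neq0 : I1 R != I0 R.
Proof. by apply/eqP => /(congr1 ival); rewrite ival0 ival1 => /eqP; rewrite oner_eq0. Qed.

Lemma cvg_ival (u : nat -> I) (t : I) : u ~> t <-> ival \o u ~> ival t.
Proof. exact: cvg_valP. Qed.


Lemma cvgR (u : nat -> R) (r : R) :
  u ~> r <-> forall e, 0 < e -> exists N, forall n, (N <= n)%N -> `|r - u n| < e.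
Proof.
split=> [/cvgrPdist_lt h e /h [N _ hN]|h]; first by exists N.
by apply/cvgrPdist_lt => e /h [N hN]; exists N.
Qed.

Lemma cvg_maxr (u v : nat -> R) (a b : R) :
  u ~> a -> v ~> b -> (fun n => Num.max (u n) (v n)) ~> Num.max a b.
Proof.
move=> ua vb.
rewrite maxr_absE.
under eq_fun do rewrite maxr_absE.
apply: cvgM; last exact: cvg_cst.
by apply: cvgD; [exact: cvgD|apply: cvg_norm; exact: cvgB].
Qed.

Lemma cvg_minr (u v : nat -> R) (a b : R) :
  u ~> a -> v ~> b -> (fun n => Num.min (u n) (v n)) ~> Num.min a b.
Proof.
move=> ua vb.
rewrite minr_absE.
under eq_fun do rewrite minr_absE.
apply: cvgM; last exact: cvg_cst.
by apply: cvgB; [exact: cvgD|apply: cvg_norm; exact: cvgB].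
Qed.

Lemma cvg_clamp (u : nat -> R) (r : R) : u ~> r -> clampI \o u ~> clampI r.
Proof.
move=> ur; apply/cvg_ival; rewrite clampIE.
by apply: cvg_maxr; [exact: cvg_cst|apply: cvg_minr; [exact: cvg_cst|]].
Qed.

Definition mulI (s t : I) : I := clampI (ival s * ival t).

Lemma ival_mulI s t : ival (mulI s t) = ival s * ival t.
Proof.
have /andP[s0 s1] := ival_itv s; have /andP[t0 t1] := ival_itv t.
by rewrite clampIK // mulr_ge0 //= mulr_ile1.
Qed.

Lemma mulI0 s : mulI s (I0 R) = I0 R.
Proof. by apply: ival_inj; rewrite ival_mulI mulr0. Qed.
Lemma mul0I s : mulI (I0 R) s = I0 R.
Proof. by apply: ival_inj; rewrite ival_mulI mul0r. Qed.
Lemma mulI1 s : mulI s (I1 R) = s.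
Proof. by apply: ival_inj; rewrite ival_mulI mulr1. Qed.

Lemma cvg_mulI (u v : nat -> I) (s t : I) :
  u ~> s -> v ~> t -> (fun n => mulI (u n) (v n)) ~> mulI s t.
Proof.
move=> /cvg_ival us /cvg_ival vt.
exact: (@cvg_clamp (fun n => ival (u n) * ival (v n)) _ (cvgM us vt)).
Qed.

End interval.

(** If the terms left a neighbourhood of [x] infinitely often, the indices at which they do would
    form a subsequence without a further subsequence converging to [x]. In this form compactness and
    uniqueness of the limit yield convergence. *)
Lemma cvg_by_subseq (T : topologicalType) (v : nat -> T) (x : T) :
  (forall k : nat -> nat, k @ \oo --> \oo ->
    exists2 k' : nat -> nat, k' @ \oo --> \oo & v \o k \o k' ~> x) -> v ~> x.
Proof.
move=> h U xU; apply: contrapT => nU.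
have /choice[k hk] : forall N : nat, exists n, (N <= n)%N /\ ~ U (v n).
  move=> N; apply: contrapT => hN; apply: nU; exists N => // n /= Nn.
  by apply: contrapT => Un; apply: hN; exists n.
have kn : k @ \oo --> \oo.
  by move=> A [N _ hN]; exists N => // n Nn; apply: hN; exact: leq_trans Nn (hk n).1.
have [k' _ vx] := h k kn.
have [N _ hN] := vx U xU.
exact: (hk (k' N)).2 (hN N (leqnn N)).
Qed.

(** The image of the complement of an open neighbourhood of [x] is closed and, by injectivity,
    misses [e x]; the sequence in [U] therefore avoids it from some index on. *)
Lemma cvg_embedding (T U : topologicalType) (e : T -> U) (u : nat -> T) (x : T) :
  closed_embedding e -> e \o u ~> e x -> u ~> x.
Proof.
move=> [ce ie cle] eu V; rewrite nbhsE => -[O [oO Ox] OV].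
have : nbhs (e x) (~` (e @` (~` O))).
  apply: open_nbhs_nbhs; split.
    by apply: closed_openC; apply: cle; apply: open_closedC.
  by move=> [z nOz /ie zx]; apply: nOz; rewrite zx.
move=> /eu [N _ hN]; exists N => // n /hN /= h; apply: OV.
by apply: contrapT => nO; apply: h; exists (u n).
Qed.

(** * Theories in one degree *)

(* The values of the theory in one degree, in either variance: [hmor] is the type
   of homomorphisms in the direction of the maps of pairs. *)
Record hcat (R : realType) := HCat {
  hmor : closed_pair R -> closed_pair R -> Type;
  hid : forall P, hmor P P;
  hcomp : forall P Q S, hmor Q S -> hmor P Q -> hmor P S;
  hcompA : forall P Q S T (h : hmor S T) (g : hmor Q S) (f : hmor P Q),
    hcomp h (hcomp g f) = hcomp (hcomp h g) f;
  hcomp1 : forall P Q (f : hmor P Q), hcomp f (hid P) = f;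
  hcomp1l : forall P Q (f : hmor P Q), hcomp (hid Q) f = f;
  hm : forall P Q, pair_map P Q -> hmor P Q;
  hm_id : forall P, hm (pair_id P) = hid P;
  hm_comp : forall P Q S (g : pair_map Q S) (f : pair_map P Q),
    hm (pair_comp g f) = hcomp (hm g) (hm f);
  hm_homotopy : forall P Q (f g : pair_map P Q), pair_homotopic f g -> hm f = hm g
}.

Section hcat_theory.
Context {R : realType} (C : hcat R).
Implicit Types (P Q S : closed_pair R).

Local Notation "g \; f" := (hcomp g f).

Definition is_iso P Q (f : hmor C P Q) : Prop :=
  exists g : hmor C Q P, g \; f = hid C P /\ f \; g = hid C Q.

(** Maps of pairs that agree pointwise may differ in the proofs they bundle; the constant homotopy
    identifies the morphisms they induce. *)
Lemma hm_ext P Q (f g : pair_map P Q) : (forall x, f x = g x) -> hm C f = hm C g.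
Proof.
move=> fg; apply: hm_homotopy.
have cf : continuous (fun p : P * unit_interval R => f p.1).
  by move=> p; apply: continuous_comp; [exact: cvg_fst|exact: cts_fun].
exists (ctsmap cf); split.
- by [].
- by move=> x; exact: fg.
- by move=> x t; exact: pair_funP.
Qed.

Lemma iso_comp P Q S (g : hmor C Q S) (f : hmor C P Q) :
  is_iso g -> is_iso f -> is_iso (g \; f).
Proof.
move=> [g' [gg g'g]] [f' [ff f'f]]; exists (f' \; g'); split.
  by rewrite -hcompA (hcompA g') gg hcomp1l.
by rewrite -hcompA (hcompA f) f'f hcomp1l.
Qed.

Lemma iso_mono P Q S (g : hmor C Q S) (f f' : hmor C P Q) :
  is_iso g -> g \; f = g \; f' -> f = f'.
Proof. by move=> [g' [gg _]] /(congr1 (hcomp g')); rewrite !hcompA gg !hcomp1l. Qed.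

Lemma iso_epi P Q S (f : hmor C P Q) (g g' : hmor C Q S) :
  is_iso f -> g \; f = g' \; f -> g = g'.
Proof. by move=> [f' [_ ff]] /(congr1 (fun h => h \; f')); rewrite -!hcompA ff !hcomp1. Qed.

Lemma iso_comp_l P Q S (g : hmor C Q S) (f : hmor C P Q) :
  is_iso (g \; f) -> is_iso g -> is_iso f.
Proof.
move=> [h [hl hr]] ig; exists (h \; g); split; first by rewrite -hcompA.
by apply: (iso_mono ig); rewrite hcomp1 !hcompA hr hcomp1l.
Qed.

Lemma iso_comp_r P Q S (g : hmor C Q S) (f : hmor C P Q) :
  is_iso (g \; f) -> is_iso f -> is_iso g.
Proof.
move=> [h [hl hr]] ifi; exists (f \; h); split; last by rewrite hcompA.
by apply: (iso_epi ifi); rewrite hcomp1l -!hcompA hl hcomp1.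
Qed.

Lemma iso_pair_homotopy P Q (f : pair_map P Q) (g : pair_map Q P) :
  pair_homotopic (pair_comp g f) (pair_id P) ->
  pair_homotopic (pair_comp f g) (pair_id Q) -> is_iso (hm C f).
Proof.
by move=> gf fg; exists (hm C g); rewrite -!hm_comp (hm_homotopy _ gf) (hm_homotopy _ fg) !hm_id.
Qed.

Lemma iso_inverse P Q (f : pair_map P Q) (g : pair_map Q P) :
  cancel f g -> cancel g f -> is_iso (hm C f).
Proof.
move=> fg gf; exists (hm C g); rewrite -!hm_comp; split.
  by rewrite (@hm_ext _ _ _ (pair_id P)) ?hm_id //=.
by rewrite (@hm_ext _ _ _ (pair_id Q)) ?hm_id //=.
Qed.

Lemma single_homotopic (S T : metrizable_space R)
    (f g : pair_map (single S) (single T)) (h : S * unit_interval R -> T) :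
  continuous h -> (forall x, h (x, I0 R) = f x) -> (forall x, h (x, I1 R) = g x) ->
  pair_homotopic f g.
Proof. by move=> ch h0 h1; exists (ctsmap ch). Qed.

End hcat_theory.

(** * Morphisms induced by perfect relations *)

Section relations.
Context {R : realType}.
Implicit Types (M N P : metrizable_space R).

(* [W] is the graph of a possibly multivalued map of pairs (M, X) -> (N, Y),
   single-valued off X, whose projection to M is perfect. *)
Record admissible M N (X : set M) (Y : set N) (W : M -> N -> Prop) : Prop := {
  adm_ex : forall m, ~ X m -> exists n, W m n;
  adm_uniq : forall m n n', ~ X m -> W m n -> W m n' -> n = n';
  adm_sub : forall m n, W m n -> (X m <-> Y n);
  adm_seq : forall (u : nat -> M) (v : nat -> N) (m : M),
    (forall j, W (u j) (v j)) -> u ~> m ->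
    exists (k : nat -> nat) (n : N),
      [/\ k @ \oo --> \oo, v \o k ~> n & W m n]
}.

(** Every subsequence of [v] has a further one with a limit in the fibre over [m], and off [X] that
    fibre is the single point [n]. This is the continuity of the single-valued part. *)
Lemma adm_cvg M N (X : set M) (Y : set N) W (u : nat -> M) (v : nat -> N) m n :
  admissible X Y W -> ~ X m -> (forall j, W (u j) (v j)) -> u ~> m -> W m n ->
  v ~> n.
Proof.
move=> aW nX uv um mn; apply: cvg_by_subseq => k kn.
have [k' [n' [k'n vn mn']]] :=
  adm_seq aW (fun j => uv (k j)) (cvg_subseq kn um).
by exists k' => //; rewrite (adm_uniq aW nX mn mn').
Qed.

Lemma adm_pullback M N P (X : set M) (Y : set N) (P0 : set P) W (k : P -> M) :
  admissible X Y W -> continuous k -> (forall p, P0 p <-> X (k p)) ->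
  admissible P0 Y (fun p n => W (k p) n).
Proof.
move=> aW ck kX; split.
- by move=> p nP; apply: (adm_ex aW) => /kX.
- by move=> p n n' nP; apply: (adm_uniq aW) => /kX.
- by move=> p n /(adm_sub aW) h; split=> [/kX/h|/h/kX].
- move=> u v p uv up; apply: (adm_seq aW uv).
  by apply: cvg_cont up; exact: ck.
Qed.

Lemma adm_comp M N P (X : set M) (Y : set N) (Z : set P) W W' :
  admissible X Y W -> admissible Y Z W' ->
  admissible X Z (fun m l => exists n, W m n /\ W' n l).
Proof.
move=> aW aW'; split.
- move=> m nX; have [n mn] := adm_ex aW nX.
  have [|l nl] := adm_ex aW' (m := n); last by exists l, n.
  by move=> /(adm_sub aW mn).
- move=> m l l' nX [n [mn nl]] [n' [mn' nl']].
  move: nl'; rewrite -(adm_uniq aW nX mn mn') => nl'.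
  by apply: (adm_uniq aW' _ nl nl') => /(adm_sub aW mn).
- move=> m l [n [/(adm_sub aW) h /(adm_sub aW') h']].
  by split=> [/h/h'|/h'/h].
- move=> u w m uw um; have [v hv] := choice uw.
  have [k [n [kn vn mn]]] := adm_seq aW (fun j => (hv j).1) um.
  have [k' [l [kn' wl nl]]] := adm_seq aW' (fun j => (hv (k j)).2) vn.
  exists (k \o k'), l; split=> //; first exact: subseq_comp.
  by exists n.
Qed.

Definition relsp M N (W : M -> N -> Prop) : metrizable_space R :=
  sub_space ([set p | W p.1 p.2] : set (prod_space M N)).

Section relsp.
Context M N (W : M -> N -> Prop).

Definition rfst (d : relsp W) : M := (set_val d).1.
Definition rsnd (d : relsp W) : N := (set_val d).2.

Lemma relspP (d : relsp W) : W (rfst d) (rsnd d).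
Proof. exact: (set_valP d). Qed.

Definition rel_mk m n (w : W m n) : relsp W :=
  exist _ ((m, n) : prod_space M N) (mem_set (w : [set p | W p.1 p.2] (m, n))).

Lemma relsp_eq (d d' : relsp W) : rfst d = rfst d' -> rsnd d = rsnd d' -> d = d'.
Proof.
rewrite /rfst /rsnd => e1 e2; apply: set_val_inj.
by move: e1 e2; case: (set_val d) (set_val d') => [? ?] [? ?] /= -> ->.
Qed.

Lemma cvg_relsp (u : nat -> relsp W) (d : relsp W) :
  u ~> d <-> rfst \o u ~> rfst d /\ rsnd \o u ~> rsnd d.
Proof.
by apply: iff_trans; [exact: cvg_valP|exact: cvg_pairP].
Qed.

Lemma rfst_continuous : continuous rfst.
Proof. by apply: seq_continuous => u d /cvg_relsp[]. Qed.

Lemma rsnd_continuous : continuous rsnd.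
Proof. by apply: seq_continuous => u d /cvg_relsp[]. Qed.

Definition relpair (X : set M) (cX : closed X) : closed_pair R :=
  @ClosedPair R (relsp W) (rfst @^-1` X)
    (preimage_closed (fun d _ => @rfst_continuous d) cX).

Definition rel_proj (X : set M) (cX : closed X) :
    pair_map (relpair cX) (ClosedPair cX) :=
  @PairMap R (relpair cX) (ClosedPair cX) (ctsmap rfst_continuous) (fun d h => h).

Context (X : set M) (Y : set N) (cX : closed X) (aW : admissible X Y W).

(** Perfectness gives points of [D] over a convergent sequence a subsequence whose second
    coordinates converge too; the limit stays in [D]. *)
Lemma rel_proj_closed : closed_map (rel_proj cX).
Proof.
move=> D cD; apply: (@seq_closed R M) => u m Du um.
have /choice[d hd] n : exists d : relsp W, D d /\ rfst d = u n.
  by have [d Dd <-] := Du n; exists d.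
have [k [n [kn vn mn]]] := @adm_seq _ _ _ _ _ aW (rfst \o d) (rsnd \o d) m
  (fun j => relspP (d j)) (cvg_eq_near (ex_intro _ 0 (fun j _ => esym (hd j).2)) um).
exists (rel_mk mn) => //.
apply: (closed_lim (u := d \o k) cD (fun j => (hd _).1)).
apply/cvg_relsp; split=> //.
apply: cvg_eq_near (cvg_subseq kn um); exists 0%N => j _ /=.
by rewrite (hd _).2.
Qed.

(** Off [X] the fibres are points, so the projection has an inverse there, and [adm_cvg] is the
    continuity of this inverse. *)
Lemma rel_proj_homeo : restricts_to_homeomorphism (rel_proj cX).
Proof.
pose D0 : set (relsp W) := ~` (rfst @^-1` X).
pose g (d : D0) : (~` X : set M) :=
  exist _ (rfst (set_val d)) (mem_set (set_valP d)).
have /choice[n hn] : forall m : (~` X : set M), exists n, W (set_val m) n.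
  by move=> m; exact: (adm_ex aW (set_valP m)).
have gX (m : (~` X : set M)) : D0 (rel_mk (hn m)) by exact: (set_valP m).
pose g' (m : (~` X : set M)) : D0 := exist _ (rel_mk (hn m)) (mem_set (gX m)).
exists g; split=> //; split.
  apply: (@seq_continuous R (sub_space D0)) => u d /cvg_valP/cvg_relsp[ud _].
  by apply/cvg_valP.
exists g'; split.
- apply: (@seq_continuous R (sub_space (~` X))) => u m /cvg_valP um.
  apply/cvg_valP; apply/cvg_relsp; split=> //.
  exact: (adm_cvg aW (set_valP m) (fun j => hn (u j)) um (hn m)).
- move=> d; apply: set_val_inj; apply: relsp_eq => //.
  exact: (adm_uniq aW (set_valP (g d)) (hn (g d)) (relspP (set_val d))).
- by move=> m; apply: set_val_inj.
Qed.

(** A map into the complement of [X] has only one lift to the graph, so the choice made by [cid] is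
    forced; continuity is again [adm_cvg]. *)
Lemma section_proof (S : metrizable_space R) (a0 : S -> M) (nX : forall s, ~ X (a0 s)) :
  continuous a0 ->
  continuous (fun s => rel_mk (projT2 (cid (adm_ex aW (nX s))))).
Proof.
move=> ca; apply: seq_continuous => u s us; apply/cvg_relsp.
have aus := cvg_cont (ca s) us.
split; first exact: aus.
apply: (adm_cvg aW (nX s) _ aus); last exact: projT2.
by move=> j; exact: projT2.
Qed.

Definition section_map (S : metrizable_space R) (a0 : S -> M)
    (nX : forall s, ~ X (a0 s)) (ca : continuous a0) : continuousType S (relsp W) :=
  ctsmap (@section_proof S a0 nX ca).

Lemma relsp_uniq (d d' : relsp W) : ~ X (rfst d) -> rfst d = rfst d' -> d = d'.
Proof.
move=> nX dd'; apply: relsp_eq => //; apply: (adm_uniq aW nX); first exact: relspP.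
by rewrite dd'; exact: relspP.
Qed.

End relsp.

Section lift.
Context (S N Z : metrizable_space R) (e : Z -> N) (f : S -> N).
Hypothesis he : closed_embedding e.
Hypothesis fe : forall s, range e (f s).

Definition lift_fun (s : S) : Z := sval (cid2 (fe s)).

Lemma lift_funK s : e (lift_fun s) = f s.
Proof. exact: (s2valP' (cid2 (fe s))). Qed.

Lemma lift_continuous : continuous f -> continuous lift_fun.
Proof.
move=> cf; apply: seq_continuous => u s us; apply: (cvg_embedding he).
rewrite lift_funK (_ : e \o _ = f \o u); first exact: cvg_cont (cf s) us.
by apply/funext => j /=; rewrite lift_funK.
Qed.

End lift.

End relations.

Arguments rfst {R M N W} d.
Arguments rsnd {R M N W} d.

Local Notation "g \; f" := (hcomp g f).

(** * Homomorphisms induced by a relation and their naturality *)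

Section induced.
Context {R : realType} (C : hcat R).
Implicit Types (M N P Q S : metrizable_space R).

(** The form in which map excision enters. In terms of exact sequences: if the inclusion into [P]
    induces isomorphisms, the groups of the pair vanish, and the isomorphism induced by [f] carries
    this over to [D]. *)
Hypothesis excision_subspace :
  forall (D P : closed_pair R) (f : pair_map D P),
    closed_map f -> restricts_to_homeomorphism f ->
    is_iso (hm C (incl_sub P)) -> is_iso (hm C (incl_sub D)).

Local Notation incl_iso cA := (is_iso (hm C (incl_sub (ClosedPair cA)))).
Local Notation I0 := (I0 R).
Local Notation I1 := (I1 R).

Lemma relpair_iso P N (P0 : set P) (cP0 : closed P0) (Y : set N) W :
  admissible P0 Y W -> incl_iso cP0 -> is_iso (hm C (incl_sub (relpair W cP0))).
Proof.
move=> aW; apply: (excision_subspace (f := rel_proj W cP0)).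
  exact: rel_proj_closed aW.
exact: rel_proj_homeo aW.
Qed.

Section rel_to.
Context P N (Z : metrizable_space R) (P0 : set P) (cP0 : closed P0) (e : Z -> N).
Context (W : P -> N -> Prop) (he : closed_embedding e).
Context (aW : admissible P0 (range e) W).

Lemma rel_to_proof (d : sub_space (cp_sub (relpair W cP0))) :
  range e (rsnd (set_val d)).
Proof. exact: (adm_sub aW (relspP (set_val d))).1 (set_valP d). Qed.

Lemma rel_to_continuous : continuous (lift_fun rel_to_proof).
Proof.
apply: lift_continuous => // d.
apply: (@continuous_comp _ _ _ (set_val : sub_space (cp_sub (relpair W cP0)) -> relsp W)).
  exact: set_val_continuous.
exact: rsnd_continuous.
Qed.

Definition rel_to : continuousType (sub_space (cp_sub (relpair W cP0))) Z :=
  ctsmap rel_to_continuous.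

Lemma rel_toE d : e (rel_to d) = rsnd (set_val d).
Proof. exact: (lift_funK rel_to_proof). Qed.

(* [al] is induced by [a] and the projection of the graph [W] to N, once [incl_sub]
   is inverted. *)
Definition ind S (a : continuousType S (relsp W))
    (al : hmor C (single S) (single Z)) : Prop :=
  exists ga : hmor C (single S) (sub_pair (relpair W cP0)),
    hm C (incl_sub (relpair W cP0)) \; ga = hm C (single_map a) /\
    al = hm C (single_map rel_to) \; ga.

Hypothesis iP0 : incl_iso cP0.

Lemma ind_ex S (a : continuousType S (relsp W)) : exists al, ind a al.
Proof.
have [g [gi ig]] := relpair_iso aW iP0.
exists (hm C (single_map rel_to) \; (g \; hm C (single_map a))), (g \; hm C (single_map a)).
by rewrite hcompA ig hcomp1l.
Qed.

Lemma ind_homotopic S (a a' : continuousType S (relsp W)) al :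
  pair_homotopic (single_map a) (single_map a') -> ind a al -> ind a' al.
Proof.
move=> aa' [g [ga ->]]; exists g; split=> //.
by rewrite ga; exact: hm_homotopy aa'.
Qed.

End rel_to.

Section compare.
Context S S' P P' N (Z : metrizable_space R).
Context (P0 : set P) (cP0 : closed P0) (P0' : set P') (cP0' : closed P0').
Context (e : Z -> N) (he : closed_embedding e) (W : P -> N -> Prop) (W' : P' -> N -> Prop).
Context (aW : admissible P0 (range e) W) (aW' : admissible P0' (range e) W').
Context (a : continuousType S (relsp W)) (a' : continuousType S' (relsp W')).
Context (u : P -> P') (v : continuousType S S').
Hypothesis cu : continuous u.
Hypothesis uP0 : forall p, P0 p -> P0' (u p).
Hypothesis uW : forall p n, W p n -> W' (u p) n.
Hypothesis nP0 : forall s, ~ P0' (rfst (a' (v s))).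
Hypothesis uav : forall s, rfst (a' (v s)) = u (rfst (a s)).

Definition rel_map_fun (d : relsp W) : relsp W' := rel_mk (uW (relspP d)).

Lemma rel_map_continuous : continuous rel_map_fun.
Proof.
apply: seq_continuous => w d /cvg_relsp[wd wd'].
apply/cvg_relsp; split=> //.
exact: cvg_cont (@cu (rfst d)) wd.
Qed.

Definition rel_map : pair_map (relpair W cP0) (relpair W' cP0') :=
  @PairMap R (relpair W cP0) (relpair W' cP0') (ctsmap rel_map_continuous)
    (fun d => @uP0 (rfst d)).

(** [u] carries one relation into the other and [v] matches the sections. Lifts through the
    inclusion in the target are unique, because it induces isomorphisms, so the induced
    homomorphisms are natural. Independence of the relation, homotopy invariance and functoriality
    all come from choices of [u] and [v]. *)
Lemma ind_compare_proof (iP0 : incl_iso cP0) (iP0' : incl_iso cP0') al al' :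
  ind cP0 he aW a al -> ind cP0' he aW' a' al' ->
  al = al' \; hm C (single_map v).
Proof.
move=> [g [ga ->]] [g' [ga' ->]].
have nat : hm C (incl_sub (relpair W' cP0')) \; hm C (restrict_pair rel_map) =
    hm C (single_map (ctsmap rel_map_continuous)) \; hm C (incl_sub (relpair W cP0)).
  by rewrite -!hm_comp; exact: hm_ext.
(* It suffices to compare after the inclusion, which is an isomorphism. There the two sides are
   induced by equal maps: off [P0'] a point of the relation is determined by its first
   coordinate. *)
have gg : hm C (restrict_pair rel_map) \; g = g' \; hm C (single_map v).
  apply: (iso_mono (relpair_iso aW' iP0')).
  rewrite !hcompA nat ga' -hcompA ga -!hm_comp; apply: hm_ext => s /=.
  by symmetry; apply: (relsp_uniq aW') => //; rewrite uav.
rewrite -hcompA -gg hcompA -hm_comp; congr hcomp; apply: hm_ext => d /=.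
have [_ ie _] := he; apply: ie.
by rewrite !rel_toE.
Qed.

End compare.

Lemma ind_compare S S' P P' N (Z : metrizable_space R)
    (P0 : set P) (cP0 : closed P0) (P0' : set P') (cP0' : closed P0')
    (e : Z -> N) (he : closed_embedding e) (W : P -> N -> Prop) (W' : P' -> N -> Prop)
    (aW : admissible P0 (range e) W) (aW' : admissible P0' (range e) W')
    (a : continuousType S (relsp W)) (a' : continuousType S' (relsp W')) al al'
    (u : P -> P') (v : continuousType S S') :
  ind cP0 he aW a al -> ind cP0' he aW' a' al' -> incl_iso cP0 -> incl_iso cP0' ->
  continuous u -> (forall p, P0 p -> P0' (u p)) -> (forall p n, W p n -> W' (u p) n) ->
  (forall s, ~ P0' (rfst (a' (v s)))) -> (forall s, rfst (a' (v s)) = u (rfst (a s))) ->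
  al = al' \; hm C (single_map v).
Proof. by move=> h h' i i' cu uP uW nP uav; exact: (ind_compare_proof cu uP uW nP uav i i' h h'). Qed.

Lemma incl_iso_setT Q : incl_iso (closedT : closed [set: Q]).
Proof.
have cf : continuous (fun q : Q => exist _ q (mem_set (I : [set: Q] q)) : sub_space [set: Q]).
  by apply: seq_continuous => w q wq; apply/cvg_valP.
apply: (@iso_inverse _ _ _ _ _ (@single_map R Q (sub_space [set: Q]) (ctsmap cf))) => //.
by move=> x; exact: set_val_inj.
Qed.

(** For a single morphism [Q0] is all of [Q]; a proper subset occurs for composites, where [Q] is
    itself the total space of a relation. *)
Definition bot Q (Q0 : set Q) : set (prod_space Q (interval_space (R := R))) :=
  [set p | Q0 p.1 /\ p.2 = I0].

Lemma bot_closed Q (Q0 : set Q) : closed Q0 -> closed (bot Q0).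
Proof.
move=> cQ0; apply: seq_closed => w p wp /cvg_pairP[w1 w2]; split.
  by apply: (closed_lim (u := fst \o w) cQ0 _ w1) => n; exact: (wp n).1.
apply: (@cvg_inj R (@interval_space R) (snd \o w)) => //.
by apply: cvg_eq_near (@cvg_const _ (I0 : interval_space)); exists 0%N => n _; rewrite /= (wp n).2.
Qed.

(** [Q0] at time 0 is a copy of [Q0], and [Q] at time 0 is a deformation retract of the product, so
    the square of inclusions has isomorphisms on three sides. *)
Lemma bot_iso Q (Q0 : set Q) (cQ0 : closed Q0) :
  incl_iso cQ0 -> incl_iso (bot_closed cQ0).
Proof.
move=> iQ0.
have cj : continuous (fun q : Q => (q, I0) : prod_space Q interval_space).
  by apply: seq_continuous => w q wq; apply/cvg_pairP; split=> //; exact: cvg_const.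
have cf : continuous (fun p : prod_space Q (interval_space (R := R)) => p.1 : Q).
  by apply: seq_continuous => w p /cvg_pairP[].
have jb q : Q0 q -> bot Q0 (ctsmap cj q) by [].
have fb p : bot Q0 p -> Q0 (ctsmap cf p) by case.
pose j : pair_map (ClosedPair cQ0) (ClosedPair (bot_closed cQ0)) :=
  @PairMap R (ClosedPair cQ0) (ClosedPair (bot_closed cQ0)) (ctsmap cj) jb.
pose f : pair_map (ClosedPair (bot_closed cQ0)) (ClosedPair cQ0) :=
  @PairMap R (ClosedPair (bot_closed cQ0)) (ClosedPair cQ0) (ctsmap cf) fb.
have ij0 : is_iso (hm C (restrict_pair j)).
  apply: (@iso_inverse _ _ _ _ _ (restrict_pair f)).
    by move=> q; exact: set_val_inj.
  move=> p; apply: set_val_inj; change (((set_val p).1, I0) = set_val p).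
  have : bot Q0 (set_val p) := set_valP p.
  by move: (set_val p) => [x t] [_ /= ->].
have ij : is_iso (hm C (single_map (ctsmap cj : continuousType Q (prod_space Q interval_space)))).
  apply: (@iso_pair_homotopy _ _ _ _ _ (single_map (ctsmap cf : continuousType (prod_space Q interval_space) Q))).
    apply: (@single_homotopic _ _ _ _ _ fst) => // p; exact: cvg_fst.
  have ch : continuous (fun q : prod_space (prod_space Q interval_space) interval_space =>
      (q.1.1, mulI q.1.2 q.2) : prod_space Q (interval_space (R := R))).
    apply: seq_continuous => w q /cvg_pairP[/cvg_pairP[w1 w2] w3].
    by apply/cvg_pairP; split=> //; exact: cvg_mulI.
  apply: (@single_homotopic R (prod_space Q interval_space) (prod_space Q interval_space)
    _ _ (fun q => (q.1.1, mulI q.1.2 q.2))).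
  - exact: ch.
  - by move=> [q t] /=; rewrite mulI0.
  - by move=> [q t] /=; rewrite mulI1.
have nat : hm C (incl_sub (ClosedPair (bot_closed cQ0))) \; hm C (restrict_pair j) =
   hm C (single_map (ctsmap cj : continuousType Q (prod_space Q interval_space))) \;
   hm C (incl_sub (ClosedPair cQ0)).
  by rewrite -!hm_comp; exact: hm_ext.
apply: (iso_comp_r _ ij0); rewrite nat; exact: iso_comp.
Qed.

End induced.

(** * The homomorphism of an admissible relation: graphs, homotopies, composites *)

Section functor.
Context {R : realType} (C : hcat R).
Implicit Types (X Y Z S T : metrizable_space R).

Local Notation I0 := (I0 R).
Local Notation I1 := (I1 R).
Local Notation I := (interval_space (R := R)).

Hypothesis excision_subspace :
  forall (D P : closed_pair R) (f : pair_map D P),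
    closed_map f -> restricts_to_homeomorphism f ->
    is_iso (hm C (incl_sub P)) -> is_iso (hm C (incl_sub D)).

Local Notation ex := excision_subspace.
Local Notation botT Q := (bot [set: Q]).
Local Notation cbotT Q := (bot_closed (closedT : closed [set: Q])).
Local Notation ibotT Q := (bot_iso (incl_iso_setT C Q)).

Section Zhomotopy.
Context (X : metrizable_space R) (M : Z_embedding X).

Definition zhom : M * unit_interval R -> M := sval (cid (ze_Z_set M).2).

Lemma zhom_continuous : continuous zhom.
Proof. by rewrite /zhom; case: cid => h []. Qed.

Lemma zhom0 m : zhom (m, I0) = m.
Proof. by rewrite /zhom; case: cid => h []. Qed.

Lemma zhomN m t : t != I0 -> ~ range (ze_map M) (zhom (m, t)).
Proof. by rewrite /zhom; case: cid => h [/= _ _]; apply. Qed.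

Lemma zhom_range m t : range (ze_map M) (zhom (m, t)) <->
  range (ze_map M) m /\ t = I0.
Proof.
have [->|t0] := eqVneq t I0; first by rewrite zhom0; split=> [|[]].
by split=> [/(zhomN t0)//|[_ /eqP]]; rewrite (negPf t0).
Qed.

Lemma ze_closed : closed (range (ze_map M)).
Proof. by case: (ze_embedding M) => _ _; apply; exact: closedT. Qed.

Lemma ze_continuous : continuous (ze_map M).
Proof. by case: (ze_embedding M). Qed.

Lemma ze_inj : injective (ze_map M).
Proof. by case: (ze_embedding M). Qed.

(* The Z-set homotopy pushes X off itself, except at time 0. *)
Definition zpush (p : prod_space X I) : M := zhom (ze_map M p.1, p.2).

Lemma zpush_continuous : continuous zpush.
Proof.
apply: seq_continuous => w p /cvg_pairP[w1 w2].
have h : (fun j => (ze_map M (w j).1, (w j).2) : prod_space M I) ~> (ze_map M p.1, p.2).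
  by apply/cvg_pairP; split=> //; exact: cvg_cont (@ze_continuous p.1) w1.
exact: cvg_cont (@zhom_continuous _) h.
Qed.

Lemma zpush_bot p : botT X p <-> range (ze_map M) (zpush p).
Proof. by rewrite zhom_range; split=> [[_ ->]|[]]; split=> //; exists p.1. Qed.

End Zhomotopy.

Section top.
Context (Q : metrizable_space R).

Definition at_time (t : I) (q : Q) : prod_space Q I := (q, t).

Lemma at_time_continuous t : continuous (at_time t).
Proof.
apply: seq_continuous => w q wq; apply/cvg_pairP; split=> //; exact: cvg_const.
Qed.

Lemma at_timeN (Q0 : set Q) t q : t != I0 -> ~ bot Q0 (at_time t q).
Proof. by move=> /eqP t0 []. Qed.

End top.

Local Notation rangeZ M := (range (ze_map M)).

Section relF.
Context (X Y : metrizable_space R) (M : Z_embedding X) (N : Z_embedding Y).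
Context (W : M -> N -> Prop) (aW : admissible (rangeZ M) (rangeZ N) W).

Definition relW (p : prod_space X I) (n : N) : Prop := W (zpush M p) n.

Definition relW_adm : admissible (botT X) (rangeZ N) relW :=
  adm_pullback aW (@zpush_continuous X M) (@zpush_bot X M).

Definition relW_top : continuousType X (relsp relW) :=
  section_map relW_adm (fun x => at_timeN I1_neq0) (@at_time_continuous X I1).

Definition relF (al : hmor C (single X) (single Y)) : Prop :=
  ind (cbotT X) (ze_embedding N) relW_adm relW_top al.

Lemma relF_ex : exists al, relF al.
Proof. refine (ind_ex ex (ze_embedding N) relW_adm (ibotT X) relW_top). Qed.

End relF.

(** The smaller relation maps into the larger one over the identity. Hence any admissible relation
    containing the closure of a graph computes the same homomorphism as that closure. *)
Lemma relF_mono X Y (M : Z_embedding X) (N : Z_embedding Y) (W W' : M -> N -> Prop)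
    (aW : admissible (rangeZ M) (rangeZ N) W)
    (aW' : admissible (rangeZ M) (rangeZ N) W') al al' :
  (forall m n, W m n -> W' m n) -> relF aW al -> relF aW' al' -> al = al'.
Proof.
move=> WW' h h'.
have := ind_compare ex (u := id) (v := idmap X) h h' (ibotT X) (ibotT X) (fun p => cvg_id).
rewrite (_ : hm C (single_map (idmap X)) = hid C _) ?hcomp1 //.
  apply=> //.
    by move=> p n; exact: WW'.
  by move=> s; exact: at_timeN I1_neq0.
by rewrite -hm_id; exact: hm_ext.
Qed.

Lemma adm_graph X Y (M : Z_embedding X) (N : Z_embedding Y) (f : M -> N) :
  continuous f -> (forall m, rangeZ M m <-> rangeZ N (f m)) ->
  admissible (rangeZ M) (rangeZ N) (fun m n => n = f m).
Proof.
move=> cf fX; split.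
- by move=> m _; exists (f m).
- by move=> m n n' _ -> ->.
- by move=> m n ->.
- move=> u v m uv um; exists id, (f m); split=> //; rewrite (_ : v \o id = f \o u).
    exact: cvg_cont (cf m) um.
  by apply/funext => j; exact: uv.
Qed.

(** Over a graph there is a section at every time, not only at time 1. The section at time 1 is
    homotopic to that at time 0, which lies in the subspace and so is its own lift through the
    inclusion; its projection to Y is [phi]. *)
Lemma relF_graph X Y (M : Z_embedding X) (N : Z_embedding Y) (f : M -> N)
    (phi : continuousType X Y)
    (aW : admissible (rangeZ M) (rangeZ N) (fun m n => n = f m)) al :
  continuous f -> (forall x, f (ze_map M x) = ze_map N (phi x)) ->
  relF aW al -> al = hm C (single_map phi).
Proof.
move=> cf fphi [ga [iga ->]].
pose W := relW (fun (m : M) (n : N) => n = f m).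
pose j (p : prod_space X I) : relsp W := rel_mk (erefl (f (zpush M p)) : W p (f (zpush M p))).
have cj : continuous j.
  apply: seq_continuous => w p wp; apply/cvg_relsp; split=> //.
  by apply: (cvg_cont (cf (zpush M p))); exact: cvg_cont (@zpush_continuous X M p) wp.
pose Q := relpair W (cbotT X).
have a'P x : cp_sub Q (j (x, I0)) by [].
have ca' : continuous (fun x => exist _ (j (x, I0)) (mem_set (a'P x)) : sub_space (cp_sub Q)).
  apply: seq_continuous => w x wx; apply/cvg_valP.
  exact: (cvg_cont (@cj _) (cvg_cont (@at_time_continuous X I0 x) wx)).
pose a' : pair_map (single X) (sub_pair Q) := @single_map R X (sub_space (cp_sub Q)) (ctsmap ca').
have -> : ga = hm C a'.
  apply: (iso_mono (relpair_iso ex (relW_adm aW) (ibotT X))).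
  rewrite iga -hm_comp; apply/esym/hm_homotopy.
  apply: (@single_homotopic R X (relsp W) _ _ j) => // x.
  by apply: (relsp_uniq (relW_adm aW)) => //; exact: at_timeN I1_neq0.
rewrite -hm_comp; apply: hm_ext => x; apply: (@ze_inj Y N).
rewrite -fphi; transitivity (f (zpush M (x, I0))); last by rewrite /zpush zhom0.
exact: rel_toE.
Qed.

(** The relation is pulled back to X x I x I, with one time for the homotopy and one for the Z-set
    push. The sections at push time 1 are homotopic for all homotopy times, and the slices at
    homotopy times 0 and 1 receive the two given relations. *)
Lemma relF_homotopy X Y (M : Z_embedding X) (N : Z_embedding Y)
    (W W' : M -> N -> Prop) (aW : admissible (rangeZ M) (rangeZ N) W)
    (aW' : admissible (rangeZ M) (rangeZ N) W')
    (K : prod_space M I -> N -> Prop)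
    (aK : admissible (M := prod_space M I) (rangeZ M `*` [set: unit_interval R]) (rangeZ N) K) al al' :
  (forall m n, W m n -> K (m, I0) n) -> (forall m n, W' m n -> K (m, I1) n) ->
  relF aW al -> relF aW' al' -> al = al'.
Proof.
move=> WK WK' h h'.
pose Q := prod_space X I.
(* [q.1.2] is the time of the homotopy and [q.2] that of the push; only the latter decides
   membership in the distinguished subspace. *)
pose k (q : prod_space Q I) : prod_space M I := (zpush M (q.1.1, q.2), q.1.2).
have ck : continuous k.
  apply: seq_continuous => w q /cvg_pairP[/cvg_pairP[w1 w2] w3].
  apply/cvg_pairP; split=> //.
  have h0 : (fun j => ((w j).1.1, (w j).2) : prod_space X I) ~> (q.1.1, q.2).
    exact/cvg_pairP.
  exact: cvg_cont (@zpush_continuous X M _) h0.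
have kb q : botT Q q <-> (rangeZ M `*` [set: unit_interval R]) (k q).
  have E := zhom_range (ze_map M q.1.1) q.2.
  split=> [[_ q0]|[/E[_ q0] _]]; split=> //.
  by apply/E; split=> //; exists q.1.1.
have aR := adm_pullback aK ck kb.
pose S3 := section_map aR (fun s => at_timeN I1_neq0) (@at_time_continuous Q I1).
pose st t : continuousType X (relsp (fun q n => K (k q) n)) :=
  compmap S3 (ctsmap (@at_time_continuous X t)).
have [be hbe] := ind_ex ex (ze_embedding N) aR (ibotT Q) (st I0).
have hbe' : ind (cbotT Q) (ze_embedding N) aR (st I1) be.
  apply: ind_homotopic hbe.
  apply: (@single_homotopic R X _ _ _ S3) => //; exact: cts_fun.
have e t (V : M -> N -> Prop) (aV : admissible (rangeZ M) (rangeZ N) V) ga :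
    (forall m n, V m n -> K (m, t) n) -> relF aV ga ->
    ind (cbotT Q) (ze_embedding N) aR (st t) be -> ga = be.
  move=> VK hg hb.
  have := ind_compare ex (u := fun p : prod_space X I => ((p.1, t), p.2) : prod_space Q I)
    (v := idmap X) hg hb (ibotT X) (ibotT Q).
  rewrite (_ : hm C (single_map (idmap X)) = hid C _) ?hcomp1; last first.
    by rewrite -hm_id; exact: hm_ext.
  apply=> //.
  - apply: seq_continuous => w p /cvg_pairP[w1 w2]; apply/cvg_pairP; split=> //.
    by apply/cvg_pairP; split=> //; exact: cvg_const.
  - by move=> p n; exact: VK.
  - by move=> x; exact: at_timeN I1_neq0.
by rewrite (e _ _ _ _ WK h hbe) (e _ _ _ _ WK' h' hbe').
Qed.

(** The total space [D1] of the first relation becomes the base for the second. There the second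
    value can be taken at the point of N directly, which gives the composite relation, or after a
    push in N, which gives the second homomorphism on the part [D10] lying over Y; a homotopy of
    sections joins the two. *)
Lemma relF_comp X Y Z (M : Z_embedding X) (N : Z_embedding Y) (L : Z_embedding Z)
    (W1 : M -> N -> Prop) (W2 : N -> L -> Prop)
    (aW1 : admissible (rangeZ M) (rangeZ N) W1)
    (aW2 : admissible (rangeZ N) (rangeZ L) W2)
    (aW : admissible (rangeZ M) (rangeZ L) (fun m l => exists n, W1 m n /\ W2 n l))
    al1 al2 al :
  relF aW1 al1 -> relF aW2 al2 -> relF aW al -> al = al2 \; al1.
Proof.
move=> h1 h2 h.
have idE S T (b : hmor C (single S) (single T)) : b \; hm C (single_map (idmap S)) = b.
  rewrite (_ : hm C (single_map (idmap S)) = hid C _) ?hcomp1 //.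
  by rewrite -hm_id; exact: hm_ext.
pose D1 := relsp (relW W1).
pose a1 : continuousType X D1 := relW_top aW1.
pose D10 : set D1 := rfst @^-1` botT X.
pose P1 := relpair (relW W1) (cbotT X).
have cD10 : closed D10 := @cp_closed R P1.
have iD10 : is_iso (hm C (incl_sub (ClosedPair cD10))) := relpair_iso ex (relW_adm aW1) (ibotT X).
have D10P d : D10 d <-> rangeZ N (rsnd d) by exact: (adm_sub (relW_adm aW1) (relspP d)).
have nD10 x : ~ D10 (a1 x) by exact: at_timeN I1_neq0.
(* The composite relation read over [D1], without a push in N. *)
pose R123 (d : D1) (l : L) := W2 (rsnd d) l.
have a123 : admissible D10 (rangeZ L) R123 := adm_pullback aW2 (@rsnd_continuous R _ _ _) D10P.
(* The same with the point of N pushed for a second time parameter; at time 0 it restricts to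
   [R123]. *)
pose k3 (q : prod_space D1 I) : N := zhom (rsnd q.1, q.2).
have ck3 : continuous k3.
  apply: seq_continuous => w q /cvg_pairP[w1 w2].
  have h0 : (fun j => (rsnd (w j).1, (w j).2) : prod_space N I) ~> (rsnd q.1, q.2).
    by apply/cvg_pairP; split=> //; exact: cvg_cont (@rsnd_continuous _ _ _ _ q.1) w1.
  exact: cvg_cont (@zhom_continuous Y N _) h0.
have k3P q : bot D10 q <-> rangeZ N (k3 q).
  by rewrite zhom_range; split=> [[/D10P]|[/D10P]].
pose R3 (q : prod_space D1 I) (l : L) := W2 (k3 q) l.
have a3 : admissible (bot D10) (rangeZ L) R3 := adm_pullback aW2 ck3 k3P.
pose sJ := section_map a3 (fun s => at_timeN I1_neq0) (@at_time_continuous D1 I1).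
have [J hJ] := ind_ex ex (ze_embedding L) a3 (bot_iso iD10) sJ.
pose at1 (t : I) (x : X) : prod_space D1 I := (a1 x, t).
have nat1 (p : prod_space X I) : ~ bot D10 (a1 p.1, p.2) by case=> /nD10.
have cat1 : continuous (fun p : prod_space X I => (a1 p.1, p.2) : prod_space D1 I).
  apply: seq_continuous => w p /cvg_pairP[w1 w2]; apply/cvg_pairP; split=> //.
  exact: cvg_cont (@cts_fun _ _ a1 p.1) w1.
pose st := section_map a3 nat1 cat1.
pose s t : continuousType X (relsp R3) := compmap st (ctsmap (@at_time_continuous X t)).
have [al3 h3] := ind_ex ex (ze_embedding L) a3 (bot_iso iD10) (s I0).
have h3' : ind (bot_closed cD10) (ze_embedding L) a3 (s I1) al3.
  apply: ind_homotopic h3.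
  by apply: (@single_homotopic R X _ _ _ st) => //; exact: cts_fun.
have [al123 h123] := ind_ex ex (ze_embedding L) a123 iD10
  (section_map a123 nD10 (@cts_fun _ _ a1)).
have -> : al = al123.
  rewrite -(idE _ _ al); apply/esym.
  apply: (ind_compare ex (u := rfst) (v := idmap X) h123 h iD10 (ibotT X)) => //.
  - exact: rfst_continuous.
  - by move=> d l dl; exists (rsnd d); split=> //; exact: (relspP d).
have -> : al123 = al3.
  rewrite -(idE _ _ al3).
  apply: (ind_compare ex (u := fun d : D1 => (d, I0) : prod_space D1 I) (v := idmap X)
    h123 h3 iD10 (bot_iso iD10)) => //.
  - exact: at_time_continuous.
  - by move=> d l; rewrite /R3 /k3 /= zhom0.
  - by move=> x; exact: (nat1 (x, I0)).
have -> : al3 = J \; hm C (single_map a1).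
  apply: (ind_compare ex (u := id) (v := a1) h3' hJ (bot_iso iD10) (bot_iso iD10)) => //.
  - by move=> q; exact: cvg_id.
  - by move=> x; exact: at_timeN I1_neq0.
pose S0 := sub_space D10.
pose kT (q : prod_space S0 I) : prod_space D1 I := (set_val q.1, q.2).
have ckT : continuous kT.
  apply: seq_continuous => w q /cvg_pairP[w1 w2]; apply/cvg_pairP; split=> //.
  exact: cvg_cont (@set_val_continuous D1 D10 q.1) w1.
have kTP q : botT S0 q <-> bot D10 (kT q).
  by split=> [[_ q0]|[_ q0]]; split=> //; exact: (set_valP q.1).
have aT := adm_pullback a3 ckT kTP.
pose sT := section_map aT (fun s => at_timeN I1_neq0) (@at_time_continuous S0 I1).
have [alT hT] := ind_ex ex (ze_embedding L) aT (ibotT S0) sT.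
have [ga [iga ->]] := h1.
(* Over [D10] the point of N lies in the image of Y, so the push there is the one that defines the
   second homomorphism. [E1] and [E2] compute the same morphism from both sides. *)
have E1 : alT = J \; hm C (single_map (incl_map D10 : continuousType S0 D1)).
  apply: (ind_compare ex (u := kT) (v := (incl_map D10 : continuousType S0 D1)) hT hJ
    (ibotT S0) (bot_iso iD10)) => //.
  - by move=> q /kTP.
  - by move=> x; exact: at_timeN I1_neq0.
pose b1 := rel_to (cbotT X) (ze_embedding N) (relW_adm aW1).
have E2 : alT = al2 \; hm C (single_map (b1 : continuousType S0 Y)).
  apply: (ind_compare ex (u := fun q : prod_space S0 I => (b1 q.1, q.2) : prod_space Y I)
    (v := (b1 : continuousType S0 Y)) hT h2 (ibotT S0) (ibotT Y)) => //.
  - apply: seq_continuous => w q /cvg_pairP[w1 w2]; apply/cvg_pairP; split=> //.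
    exact: cvg_cont (@cts_fun _ _ b1 q.1) w1.
  - move=> q l; have E : ze_map N (b1 q.1) = rsnd (set_val q.1) by exact: rel_toE.
    by rewrite /relW /zpush [(_, _).1]/= E.
  - by move=> x; exact: at_timeN I1_neq0.
(* [ga] is the lift of [a1] through the inclusion of [D10], so [J] after that inclusion after [ga]
   is [J] after [a1]. *)
by rewrite hcompA -E2 E1 -hcompA; congr hcomp; rewrite -iga.
Qed.

End functor.

(** * From map excision to fine shape *)

Section graph_closure.
Context {R : realType} (M N : metrizable_space R) (A : set M) (B : set N).
Context (f : (~` A : set M) -> (~` B : set N)).

Definition agraph : set (prod_space M N) :=
  [set p | exists x, p = (set_val x, set_val (f x))].

(* The smallest closed relation that extends f; for an approaching f it is the graph
   of f together with its cluster values over A. *)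
Definition agrel (m : M) (n : N) : Prop := closure agraph (m, n).

Lemma agrel_graph x : agrel (set_val x) (set_val (f x)).
Proof. by apply: subset_closure; exists x. Qed.

Lemma agrel_seq m n : agrel m n -> exists x : nat -> (~` A : set M),
  set_val \o x ~> m /\ set_val \o f \o x ~> n.
Proof.
move=> /(@closure_seq R (prod_space M N))[u /choice[x ux] /cvg_pairP[um un]].
exists x; split.
  by apply: cvg_eq_near um; exists 0%N => j _ /=; rewrite ux.
by apply: cvg_eq_near un; exists 0%N => j _ /=; rewrite ux.
Qed.

(** A point of the closure is a limit of points of the graph, and perfectness of [W] puts such
    limits in [W]. *)
Lemma agrel_min W : admissible A B W ->
  (forall x, W (set_val x) (set_val (f x))) -> forall m n, agrel m n -> W m n.
Proof.
move=> aW fW m n /agrel_seq[x [xm xn]].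
have [k [n' [kn xn' mn']]] := adm_seq aW (fun j => fW (x j)) xm.
by rewrite (cvg_inj (cvg_subseq kn xn) xn').
Qed.

Hypothesis af : approaching f.

Lemma agrel_off x n : agrel (set_val x) n -> n = set_val (f x).
Proof.
move=> /agrel_seq[y [yx yn]].
have /cvg_valP yx' : y ~> x by apply/cvg_valP.
apply: (cvg_inj yn); have [cf _] := af.
have /cvg_valP h : f \o y ~> f x by apply: cvg_cont (cf x) _; apply/cvg_valP.
exact: h.
Qed.

Lemma approach_seq (x : nat -> (~` A : set M)) a : A a -> set_val \o x ~> a ->
  exists (k : nat -> nat) (b : N),
    [/\ k @ \oo --> \oo, B b & set_val \o f \o x \o k ~> b].
Proof.
move=> Aa xa; have [_ h] := af.
have [|b Bb /(@cluster_subseq R)[k kn xb]] := h x.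
  by exists a => //; apply: (@subseq_cluster R M id).
by exists k, b.
Qed.


(** Over [A] the cluster values exist and lie in [B] because [f] is approaching; off [A] continuity
    of [f] leaves one value. *)
Lemma agrel_adm : closed B -> admissible A B agrel.
Proof.
move=> cB; split.
- by move=> m /(@set_val_ex _ (~` A))[x <-]; exists (set_val (f x)); exact: agrel_graph.
- by move=> m n n' /(@set_val_ex _ (~` A))[x <-] /(@agrel_off x) -> /(@agrel_off x) ->.
- move=> m n mn; split=> [Am|Bn].
    have [x [xm xn]] := agrel_seq mn.
    have [k [b [kn Bb xb]]] := approach_seq Am xm.
    by rewrite (cvg_inj (cvg_subseq kn xn) xb).
  apply: contrapT => /(@set_val_ex _ (~` A))[x xm]; move: mn Bn; rewrite -xm => /(@agrel_off x) ->.
  exact: (set_valP (f x)).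
- move=> u v m uv um.
  (* Points of the closure are replaced by points of the graph within 1/(j+1) in both coordinates,
     which have the same limits. *)
  have /choice[x hx] j : exists x, dist (u j) (set_val x) < j.+1%:R^-1 /\
      dist (v j) (set_val (f x)) < j.+1%:R^-1.
    have [|p [[x ->]] [h1 h2]] :=
      uv j [set p | dist (u j) p.1 < j.+1%:R^-1 /\ dist (v j) p.2 < j.+1%:R^-1].
      exists ([set p | dist (u j) p < j.+1%:R^-1], [set p | dist (v j) p < j.+1%:R^-1]).
        by split; apply/nbhs_dist; exists j.+1%:R^-1; rewrite ?invr_gt0.
      by case.
    by exists x.
  have xm : set_val \o x ~> m by apply: (cvg_distS (k := id) (fun j => (hx j).1)).
  have lim k n : k @ \oo --> \oo -> set_val \o f \o x \o k ~> n ->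
      v \o k ~> n /\ agrel m n.
    move=> kn xn; split.
      apply: (@cvg_distS _ _ (set_val \o f \o x) _ _ _ _ kn xn) => j.
      by rewrite dist_sym; exact: (hx j).2.
    apply: (@closed_lim R (prod_space M N) (closure agraph)
      (fun j => (set_val (x (k j)), set_val (f (x (k j)))))).
    + exact: closed_closure.
    + by move=> j; exact: agrel_graph.
    + by apply/cvg_pairP; split=> //; exact: cvg_subseq kn xm.
  have [Am|/(@set_val_ex _ (~` A))[y ym]] := pselect (A m).
    have [k [b [kn Bb /(lim _ _ kn)[]]]] := approach_seq Am xm.
    by exists k, b.
  have [] := lim id (set_val (f y)); [by []| |by exists id, (set_val (f y))].
  have [cf _] := af; apply: (cvg_cont (@set_val_continuous _ _ (f y))).
  by apply: (cvg_cont (cf y)); apply/cvg_valP; rewrite ym.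
Qed.

End graph_closure.

Definition is_fs_functor (R : realType) (C : hcat R)
    (F : forall X Y : metrizable_space R, fs_mor X Y -> hmor C (single X) (single Y)) :=
  [/\ forall X (a : fs_mor X X), fs_identity a -> F X X a = hid C (single X),
      forall X Y Z (a : fs_mor X Y) (b : fs_mor Y Z) (c : fs_mor X Z),
        fs_composite a b c -> F X Z c = F Y Z b \; F X Y a
    & forall (X Y : metrizable_space R) (phi : continuousType X Y) (a : fs_mor X Y),
        fs_forget phi a -> F X Y a = hm C (single_map phi)].

Section fs_functor.
Context {R : realType} (C : hcat R).
Implicit Types (X Y Z : metrizable_space R).

Hypothesis excision_subspace :
  forall (D P : closed_pair R) (f : pair_map D P),
    closed_map f -> restricts_to_homeomorphism f ->
    is_iso (hm C (incl_sub P)) -> is_iso (hm C (incl_sub D)).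

Local Notation ex := excision_subspace.
Local Notation rangeZ M := (range (ze_map M)).

Definition am_adm X Y (M : Z_embedding X) (N : Z_embedding Y) (Phi : approaching_map M N) :
    admissible (rangeZ M) (rangeZ N) (agrel Phi) :=
  agrel_adm (am_approaching Phi) (@ze_closed _ _ N).

Definition amF X Y (M : Z_embedding X) (N : Z_embedding Y) (Phi : approaching_map M N)
    (al : hmor C (single X) (single Y)) : Prop := relF (am_adm Phi) al.

Lemma amF_ex X Y (M : Z_embedding X) (N : Z_embedding Y) (Phi : approaching_map M N) :
  exists al, amF Phi al.
Proof. exact: (relF_ex ex (am_adm Phi)). Qed.

(** The closure of the graph of the composite lies in the composite of the closures, possibly
    properly; both are admissible, so the difference does not affect the homomorphism. *)
Lemma amF_comp X Y Z (M : Z_embedding X) (N : Z_embedding Y) (L : Z_embedding Z)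
    (Phi : approaching_map M N) (Psi : approaching_map N L) al be ga :
  amF Phi al -> amF Psi be -> amF (am_comp Psi Phi) ga -> ga = be \; al.
Proof.
move=> h1 h2 h; have aW := adm_comp (am_adm Phi) (am_adm Psi).
have [ga' h'] := relF_ex ex aW.
rewrite -(relF_comp ex h1 h2 h'); apply: (relF_mono ex _ h h').
apply: (agrel_min aW) => x; exists (set_val (Phi x)).
split; first exact: agrel_graph.
refine (@agrel_graph R N L _ _ (am_fun Psi) (am_fun Phi x)).
Qed.

Lemma amF_combines X Y (M : Z_embedding X) (N : Z_embedding Y)
    (Phi : approaching_map M N) (phi : X -> Y) (cphi : continuousType X Y) al :
  (forall x, cphi x = phi x) -> combines phi Phi -> amF Phi al -> al = hm C (single_map cphi).
Proof.
move=> e [f [cf fx fPhi]] h.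
have fr m : rangeZ M m <-> rangeZ N (f m).
  split=> [[x _ <-]|]; first by exists (phi x).
  move=> fm; apply: contrapT => /(@set_val_ex _ (~` rangeZ M))[x xm].
  by move: fm; rewrite -xm fPhi; exact: (set_valP (Phi x)).
have aW := adm_graph cf fr.
have [al' h'] := relF_ex ex aW.
rewrite -(relF_graph ex (phi := cphi) cf _ h'); last by move=> x; rewrite fx e.
apply: (relF_mono ex _ h h'); apply: (agrel_min aW) => x; exact/esym/fPhi.
Qed.

(** The graph of the homotopy is closed up over M x I; its slices at times 0 and 1 are admissible
    and contain the closures of the two end graphs. *)
Lemma amF_homotopic X Y (M : Z_embedding X) (N : Z_embedding Y)
    (Phi Psi : approaching_map M N) al be :
  approaching_homotopic R Phi Psi -> amF Phi al -> amF Psi be -> al = be.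
Proof.
move=> [h [ah h0 h1]] hal hbe.
pose I := interval_space (R := R).
have aK := @agrel_adm R (prod_space M I) N _ _ h ah (@ze_closed _ _ N).
have aKt (t : unit_interval R) : admissible (rangeZ M) (rangeZ N)
    (fun m n => @agrel R (prod_space M I) N _ _ h (m, t) n).
  have bt m : rangeZ M m <-> (rangeZ M `*` [set: unit_interval R]) (at_time t m).
    by split=> [|[]].
  exact: (adm_pullback aK (@at_time_continuous R M t) bt).
have hx t (x : rest M) : exists p : (~` (rangeZ M `*` [set: unit_interval R]) : set (prod_space M I)),
      set_val p = (set_val x, t).
  apply: (@set_val_ex (prod_space M I) (~` (rangeZ M `*` [set: unit_interval R])) (set_val x, t)).
  by move=> [Mx _]; exact: (set_valP x).
apply: (relF_homotopy ex aK _ _ hal hbe) => m n.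
  apply: (agrel_min (aKt _)) => x; have [p px] := hx (I0 R) x.
  by rewrite -px -(h0 _ _ px); exact: agrel_graph.
apply: (agrel_min (aKt _)) => x; have [p px] := hx (I1 R) x.
by rewrite -px -(h1 _ _ px); exact: agrel_graph.
Qed.

Lemma amF_same X Y (r r' : fs_rep X Y) al al' :
  same_fs r r' -> amF r al -> amF r' al' -> al = al'.
Proof.
move=> [i [j [ci cj h]]] ha ha'.
have idE (T : metrizable_space R) : hm C (single_map (idmap T)) = hid C (single T).
  by rewrite -hm_id; exact: hm_ext.
have [ii hi] := amF_ex i; have [jj hj] := amF_ex j.
have [b1 hb1] := amF_ex (am_comp j r); have [b2 hb2] := amF_ex (am_comp r' i).
have := amF_homotopic h hb1 hb2.
rewrite (amF_comp ha hj hb1) (amF_comp hi ha' hb2).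
rewrite (amF_combines (cphi := idmap X) _ ci hi) // (amF_combines (cphi := idmap Y) _ cj hj) //.
by rewrite !idE hcomp1 hcomp1l.
Qed.

(** A representative and a homomorphism for it are chosen; by [amF_same] the value depends on the
    class only. *)
Definition fs_value X Y (a : fs_mor X Y) : hmor C (single X) (single Y) :=
  sval (cid (amF_ex (sval (cid (fs_classP a))))).

(** Turns an equality of classes, which are predicates, into a relation between representatives. The
    homotopy is constant in time. *)
Lemma same_fs_refl X Y (r : fs_rep X Y) : same_fs r r.
Proof.
exists (am_id _), (am_id _); split.
- by exists id; split=> // x; exact: cvg_id.
- by exists id; split=> // x; exact: cvg_id.
pose I := interval_space (R := R).
case: r => M N Phi /=.
have nM (p : (~` (rangeZ M `*` [set: unit_interval R]) : set (prod_space M I))) :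
    (~` rangeZ M) (set_val p).1.
  by move=> h; apply: (set_valP p).
pose pr p : rest M := exist _ (set_val p).1 (mem_set (nM p)).
have [cP aP] := am_approaching Phi.
exists (fun p => Phi (pr p)); split; last 2 first.
- by move=> x p px; congr (am_fun Phi _); apply: set_val_inj; change ((set_val p).1 = set_val x); rewrite px.
- by move=> x p px; congr (am_fun Phi _); apply: set_val_inj; change ((set_val p).1 = set_val x); rewrite px.
split.
  apply: (@seq_continuous R (sub_space (~` (rangeZ M `*` [set: unit_interval R]) : set (prod_space M I)))).
  move=> w p /cvg_valP/cvg_pairP[wp _].
  have h : pr \o w ~> pr p by apply/cvg_valP.
  exact: cvg_cont (cP (pr p)) h.
move=> u [[m t] [/= mX _]] /(@cluster_subseq R (prod_space M I))[k kn /cvg_pairP[um _]].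
apply: (aP (pr \o u)); exists m => //.
exact: (@subseq_cluster R M k).
Qed.

Lemma fs_valueE X Y (M : Z_embedding X) (N : Z_embedding Y) (Phi : approaching_map M N) :
  amF Phi (fs_value (fs_mor_of Phi)).
Proof.
have [al hal] := amF_ex Phi; suff -> : fs_value (fs_mor_of Phi) = al by [].
rewrite /fs_value; case: cid => r /= Er; case: cid => be /= hbe; symmetry.
apply: (amF_same (r := FSRep Phi) _ hal hbe).
by rewrite Er; exact: same_fs_refl.
Qed.

Theorem fs_functor_ex :
  exists F : forall X Y, fs_mor X Y -> hmor C (single X) (single Y), is_fs_functor F.
Proof.
exists fs_value; split.
- move=> X _ [M ->]; rewrite -(@hm_id _ C); have := fs_valueE (am_id M).
  move=> h; rewrite (@amF_combines _ _ _ _ _ id (idmap X) _ _ _ h) //; last first.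
    by exists id; split=> // x; exact: cvg_id.
- move=> X Y Z _ _ _ [M [N [L [Phi [Psi [-> -> ->]]]]]].
  exact: amF_comp (fs_valueE Phi) (fs_valueE Psi) (fs_valueE _).
- move=> X Y phi _ [M [N [Phi [cPhi ->]]]].
  exact: (amF_combines _ cPhi (fs_valueE Phi)).
Qed.

End fs_functor.

(** * Homology and cohomology theories *)

Section algebra.

Lemma additive_eq (U V : zmodType) (f g : {additive U -> V}) : f =1 g -> f = g.
Proof.
case: f => [f [[cf]]]; case: g => [g [[cg]]] /= /funext fg.
by subst g; rewrite (Prop_irrelevance cf cg).
Qed.

Lemma additive_inverse (U V : zmodType) (f : {additive U -> V}) :
  bijective f -> exists g : {additive V -> U}, cancel f g /\ cancel g f.
Proof.
case=> g fg gf; pose m := GRing.isZmodMorphism.Build V U g (can2_zmod_morphism fg gf).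
pose G : {additive V -> U} := HB.pack g m.
by exists G.
Qed.

Lemma inj_surj_bijective (U V : Type) (f : U -> V) :
  injective f -> (forall v, exists u, f u = v) -> bijective f.
Proof.
move=> fi /choice[g fg]; exists g => // u; apply: fi; exact: fg.
Qed.

Section five.
Context (U1 U2 U3 U4 U5 V1 V2 V3 V4 V5 : zmodType).
Context (u1 : {additive U1 -> U2}) (u2 : {additive U2 -> U3}) (u3 : {additive U3 -> U4})
        (u4 : {additive U4 -> U5}).
Context (v1 : {additive V1 -> V2}) (v2 : {additive V2 -> V3}) (v3 : {additive V3 -> V4})
        (v4 : {additive V4 -> V5}).
Context (f1 : {additive U1 -> V1}) (f2 : {additive U2 -> V2}) (f3 : {additive U3 -> V3})
        (f4 : {additive U4 -> V4}) (f5 : {additive U5 -> V5}).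
Hypothesis eu2 : exact_at u1 u2.
Hypothesis eu3 : exact_at u2 u3.
Hypothesis eu4 : exact_at u3 u4.
Hypothesis ev2 : exact_at v1 v2.
Hypothesis ev3 : exact_at v2 v3.
Hypothesis ev4 : exact_at v3 v4.
Hypothesis c1 : forall x, f2 (u1 x) = v1 (f1 x).
Hypothesis c2 : forall x, f3 (u2 x) = v2 (f2 x).
Hypothesis c3 : forall x, f4 (u3 x) = v3 (f3 x).
Hypothesis c4 : forall x, f5 (u4 x) = v4 (f4 x).

Lemma five_lemma : bijective f1 -> bijective f2 -> bijective f4 -> bijective f5 ->
  bijective f3.
Proof.
move=> [g1 f1K g1K] [g2 f2K g2K] [g4 f4K g4K] [g5 f5K g5K]; apply: inj_surj_bijective.
  suff inj0 x : f3 x = 0 -> x = 0.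
    by move=> x y xy; apply/eqP; rewrite -subr_eq0; apply/eqP/inj0; rewrite raddfB xy subrr.
  move=> fx; have : u3 x = 0 by apply: (can_inj f4K); rewrite c3 fx !raddf0.
  move=> /eu3[y yx]; have /ev2[z zy] : v2 (f2 y) = 0 by rewrite -c2 yx.
  have : u1 (g1 z) = y by apply: (can_inj f2K); rewrite c1 g1K.
  by move=> zy'; rewrite -yx; apply/eu2; exists (g1 z).
move=> y.
have /eu4[x xy] : u4 (g4 (v3 y)) = 0.
  by apply: (can_inj f5K); rewrite c4 g4K raddf0; apply/ev4; exists y.
have /ev3[z zy] : v3 (y - f3 x) = 0 by rewrite raddfB -c3 xy g4K subrr.
exists (x + u2 (g2 z)); by rewrite raddfD c2 g2K zy addrC subrK.
Qed.
End five.

End algebra.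

Lemma pair_homotopic_eq (R : realType) (P Q : closed_pair R) (f g : pair_map P Q) :
  (forall x, f x = g x) -> pair_homotopic f g.
Proof.
move=> fg.
have cf : continuous (fun p : P * unit_interval R => f p.1).
  by move=> p; apply: continuous_comp; [exact: cvg_fst|exact: cts_fun].
exists (ctsmap cf); split.
- by [].
- by move=> x; exact: fg.
- by move=> x t; exact: pair_funP.
Qed.

Definition single_of (R : realType) (P Q : closed_pair R) (f : pair_map P Q) :
  pair_map (single P) (single Q) := single_map f.

(** What the exactness and excision axioms contribute, in a form independent of variance and free of
    boundary homomorphisms. *)
Record hcat_axioms (R : realType) (C : hcat R) : Prop := {
  hcat_five : forall P Q (f : pair_map P Q),
    is_iso (hm C (restrict_pair f)) -> is_iso (hm C (single_of f)) -> is_iso (hm C f);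
  hcat_excision : forall (P : closed_pair R) (U : set P),
    open U -> closure U `<=` interior (cp_sub P) -> is_iso (hm C (excision_map U));
  hcat_sub : forall D P (f : pair_map D P),
    is_iso (hm C f) -> is_iso (hm C (incl_sub P)) -> is_iso (hm C (incl_sub D))
}.

Definition hcat_map_excision (R : realType) (C : hcat R) : Prop :=
  forall P Q (f : pair_map P Q),
    closed_map f -> restricts_to_homeomorphism f -> is_iso (hm C f).

Section homology.
Context {R : realType} (H : homology_theory R).

(** A morphism consists of homomorphisms in all degrees together, because the five lemma and the
    vanishing argument need isomorphisms in adjacent degrees. *)
Definition hcat_homology : hcat R.
Proof.
refine (@HCat R (fun P Q => forall n, {additive H n P -> H n Q})
  (fun P n => idfun) (fun P Q S g f n => (g n \o f n)) _ _ _
  (fun P Q f n => hmap H n f) _ _ _).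
- by move=> *; apply: functional_extensionality_dep => n; apply: additive_eq.
- by move=> *; apply: functional_extensionality_dep => n; apply: additive_eq.
- by move=> *; apply: functional_extensionality_dep => n; apply: additive_eq.
- move=> P; apply: functional_extensionality_dep => n; apply: additive_eq; exact: hmap_id.
- move=> P Q S g f; apply: functional_extensionality_dep => n; apply: additive_eq; exact: hmap_comp.
- move=> P Q f g fg; apply: functional_extensionality_dep => n; apply: additive_eq.
  exact: h_homotopy.
Defined.

Lemma hcat_homology_isoP P Q (f : hmor hcat_homology P Q) :
  is_iso f <-> forall n, bijective (f n).
Proof.
split=> [[g [gf fg]] n|h].
  exists (g n) => x.
    exact: (congr1 (fun k : forall n, {additive H n P -> H n P} => k n x) gf).
  exact: (congr1 (fun k : forall n, {additive H n Q -> H n Q} => k n x) fg).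
pose g n : {additive H n Q -> H n P} := sval (cid (additive_inverse (h n))).
have gP n : cancel (f n) (g n) /\ cancel (g n) (f n) := svalP (cid (additive_inverse (h n))).
exists g; split; apply: functional_extensionality_dep => n; apply: additive_eq => x.
  exact: (gP n).1.
exact: (gP n).2.
Qed.

Lemma homology_incl_subP P : is_iso (hm hcat_homology (incl_sub P)) <->
  forall n (x : H n P), x = 0.
Proof.
split=> [/hcat_homology_isoP /= ib n|z].
  (* The boundary is indexed by the degree of the subspace, so n must appear as (n - 1) + 1 before
     exactness applies. *)
  rewrite -(subrK 1 n) => x.
  have [g gi ig] := ib (n - 1).
  have /h_exact_pair[y <-] : hbd H (n - 1) P x = 0.
    by apply: (can_inj gi); rewrite raddf0; apply/h_exact_sub; exists x.
  have [g' gi' ig'] := ib (n - 1 + 1).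
  by rewrite -(ig' y); apply/h_exact_space; exists (g' y).
apply/hcat_homology_isoP => n /=; apply: inj_surj_bijective.
  suff inj0 x : hmap H n (incl_sub P) x = 0 -> x = 0.
    by move=> x y xy; apply/eqP; rewrite -subr_eq0; apply/eqP/inj0; rewrite raddfB xy subrr.
  by move=> /h_exact_sub[y <-]; rewrite (z _ y) raddf0.
by move=> y; apply/h_exact_space; exact: z.
Qed.

Lemma hcat_homology_axioms : hcat_axioms hcat_homology.
Proof.
split.
- move=> P Q f /hcat_homology_isoP /= i1 /hcat_homology_isoP /= i2.
  apply/hcat_homology_isoP => n /=; rewrite -(subrK 1 n).
  have sq1 k x : hmap H k (single_of f) (hmap H k (incl_sub P) x) =
      hmap H k (incl_sub Q) (hmap H k (restrict_pair f) x).
    have := @h_homotopy _ H k _ _ _ _ (@pair_homotopic_eq _ _ _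
      (pair_comp (single_of f) (incl_sub P)) (pair_comp (incl_sub Q) (restrict_pair f))
      (fun=> erefl)) x.
    by rewrite !hmap_comp.
  have sq2 k x : hmap H k f (hmap H k (incl_pair P) x) =
      hmap H k (incl_pair Q) (hmap H k (single_of f) x).
    have := @h_homotopy _ H k _ _ _ _ (@pair_homotopic_eq _ _ _
      (pair_comp f (incl_pair P)) (pair_comp (incl_pair Q) (single_of f))
      (fun=> erefl)) x.
    by rewrite !hmap_comp.
  (* The window of the long exact sequence is subspace and space in degree n, the pair, then
     subspace and space in degree n - 1. *)
  apply: (five_lemma (@h_exact_space R H (n - 1 + 1) P) (@h_exact_pair R H (n - 1) P)
    (@h_exact_sub R H (n - 1) P) (@h_exact_space R H (n - 1 + 1) Q) (@h_exact_pair R H (n - 1) Q)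
    (@h_exact_sub R H (n - 1) Q) (sq1 _) (sq2 _) _ (sq1 _)
    (i1 _) (i2 _) (i1 _) (i2 _)) => x.
  exact: esym (@hbd_natural R H (n - 1) _ _ f x).
- move=> P U oU cU; apply/hcat_homology_isoP => n; exact: h_excision.
- move=> D P f /hcat_homology_isoP /= fb /homology_incl_subP z.
  apply/homology_incl_subP => n x; have [g fg _] := fb n.
  by apply: (can_inj fg); rewrite (z n (hmap H n f x)) raddf0.
Qed.

Lemma homology_map_excisionP : map_excision H <-> hcat_map_excision hcat_homology.
Proof.
split=> h P Q f cf hf.
  by apply/hcat_homology_isoP => n; exact: h.
by move=> n; have /hcat_homology_isoP := h P Q f cf hf; apply.
Qed.

Lemma homology_fine_shapeP : fine_shape_invariant H <->
  exists F : forall X Y, fs_mor X Y -> hmor hcat_homology (single X) (single Y),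
    is_fs_functor F.
Proof.
split=> [[F [F1 F2 F3]]|[F [F1 F2 F3]]].
  exists (fun X Y a n => F n X Y a); split.
  - by move=> X a /F1 h; apply: functional_extensionality_dep => n; apply: additive_eq; exact: h.
  - move=> X Y Z a b c /F2 h; apply: functional_extensionality_dep => n; apply: additive_eq.
    exact: h.
  - by move=> X Y phi a /F3 h; apply: functional_extensionality_dep => n; apply: additive_eq; exact: h.
exists (fun n X Y a => F X Y a n); split.
- by move=> n X a /F1 ->.
- by move=> n X Y Z a b c /F2 ->.
- by move=> n X Y phi a /F3 ->.
Qed.

End homology.

Section cohomology.
Context {R : realType} (H : cohomology_theory R).

(** A morphism from [P] to [Q] goes from the groups of [Q] to those of [P] and composition is
    reversed, so arrows still follow the maps of pairs. *)
Definition hcat_cohomology : hcat R.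
Proof.
refine (@HCat R (fun P Q => forall n, {additive H n Q -> H n P})
  (fun P n => idfun) (fun P Q S g f n => (f n \o g n)) _ _ _
  (fun P Q f n => cmap H n f) _ _ _).
- by move=> *; apply: functional_extensionality_dep => n; apply: additive_eq.
- by move=> *; apply: functional_extensionality_dep => n; apply: additive_eq.
- by move=> *; apply: functional_extensionality_dep => n; apply: additive_eq.
- move=> P; apply: functional_extensionality_dep => n; apply: additive_eq; exact: cmap_id.
- move=> P Q S g f; apply: functional_extensionality_dep => n; apply: additive_eq; exact: cmap_comp.
- move=> P Q f g fg; apply: functional_extensionality_dep => n; apply: additive_eq.
  exact: c_homotopy.
Defined.

Lemma hcat_cohomology_isoP P Q (f : hmor hcat_cohomology P Q) :
  is_iso f <-> forall n, bijective (f n).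
Proof.
split=> [[g [gf fg]] n|h].
  exists (g n) => x.
    exact: (congr1 (fun k : forall n, {additive H n Q -> H n Q} => k n x) fg).
  exact: (congr1 (fun k : forall n, {additive H n P -> H n P} => k n x) gf).
pose g n : {additive H n P -> H n Q} := sval (cid (additive_inverse (h n))).
have gP n : cancel (f n) (g n) /\ cancel (g n) (f n) := svalP (cid (additive_inverse (h n))).
exists g; split; apply: functional_extensionality_dep => n; apply: additive_eq => x.
  exact: (gP n).2.
exact: (gP n).1.
Qed.

Lemma cohomology_incl_subP P : is_iso (hm hcat_cohomology (incl_sub P)) <->
  forall n (x : H n P), x = 0.
Proof.
split=> [/hcat_cohomology_isoP /= ib n|z].
  rewrite -(subrK 1 n) => x.
  have [g gi ig] := ib (n - 1 + 1).
  have /c_exact_pair[y <-] : cmap H (n - 1 + 1) (incl_pair P) x = 0.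
    by apply: (can_inj gi); rewrite raddf0; apply/c_exact_space; exists x.
  have [g' gi' ig'] := ib (n - 1).
  by rewrite -(ig' y); apply/c_exact_sub; exists (g' y).
apply/hcat_cohomology_isoP => n /=; apply: inj_surj_bijective.
  suff inj0 x : cmap H n (incl_sub P) x = 0 -> x = 0.
    by move=> x y xy; apply/eqP; rewrite -subr_eq0; apply/eqP/inj0; rewrite raddfB xy subrr.
  by move=> /c_exact_space[y <-]; rewrite (z _ y) raddf0.
by move=> y; apply/c_exact_sub; exact: z.
Qed.

Lemma hcat_cohomology_axioms : hcat_axioms hcat_cohomology.
Proof.
split.
- move=> P Q f /hcat_cohomology_isoP /= i1 /hcat_cohomology_isoP /= i2.
  apply/hcat_cohomology_isoP => n /=; rewrite -(subrK 1 n).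
  have sq1 k x : cmap H k (restrict_pair f) (cmap H k (incl_sub Q) x) =
      cmap H k (incl_sub P) (cmap H k (single_of f) x).
    have := @c_homotopy _ H k _ _ _ _ (@pair_homotopic_eq _ _ _
      (pair_comp (incl_sub Q) (restrict_pair f)) (pair_comp (single_of f) (incl_sub P))
      (fun=> erefl)) x.
    by rewrite !cmap_comp.
  have sq2 k x : cmap H k (single_of f) (cmap H k (incl_pair Q) x) =
      cmap H k (incl_pair P) (cmap H k f x).
    have := @c_homotopy _ H k _ _ _ _ (@pair_homotopic_eq _ _ _
      (pair_comp (incl_pair Q) (single_of f)) (pair_comp f (incl_pair P))
      (fun=> erefl)) x.
    by rewrite !cmap_comp.
  apply: (five_lemma (@c_exact_sub R H (n - 1) Q) (@c_exact_pair R H (n - 1) Q)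
    (@c_exact_space R H (n - 1 + 1) Q) (@c_exact_sub R H (n - 1) P) (@c_exact_pair R H (n - 1) P)
    (@c_exact_space R H (n - 1 + 1) P) (sq1 _) _ (sq2 _) (sq1 _)
    (i2 _) (i1 _) (i2 _) (i1 _)) => x.
  exact: esym (@cbd_natural R H (n - 1) _ _ f x).
- move=> P U oU cU; apply/hcat_cohomology_isoP => n; exact: c_excision.
- move=> D P f /hcat_cohomology_isoP /= fb /cohomology_incl_subP z.
  apply/cohomology_incl_subP => n x; have [g _ fg] := fb n.
  by rewrite -(fg x) (z n (g x)) raddf0.
Qed.

Lemma cohomology_map_excisionP : comap_excision H <-> hcat_map_excision hcat_cohomology.
Proof.
split=> h P Q f cf hf.
  by apply/hcat_cohomology_isoP => n; exact: h.
by move=> n; have /hcat_cohomology_isoP := h P Q f cf hf; apply.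
Qed.

Lemma cohomology_fine_shapeP : fine_shape_coinvariant H <->
  exists F : forall X Y, fs_mor X Y -> hmor hcat_cohomology (single X) (single Y),
    is_fs_functor F.
Proof.
split=> [[F [F1 F2 F3]]|[F [F1 F2 F3]]].
  exists (fun X Y a n => F n X Y a); split.
  - by move=> X a /F1 h; apply: functional_extensionality_dep => n; apply: additive_eq; exact: h.
  - move=> X Y Z a b c /F2 h; apply: functional_extensionality_dep => n; apply: additive_eq.
    exact: h.
  - by move=> X Y phi a /F3 h; apply: functional_extensionality_dep => n; apply: additive_eq; exact: h.
exists (fun n X Y a => F X Y a n); split.
- by move=> n X a /F1 ->.
- by move=> n X Y Z a b c /F2 ->.
- by move=> n X Y phi a /F3 ->.
Qed.

End cohomology.

(** * Approaching homotopies along sequences *)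

Lemma subseq_dichotomy (P : nat -> Prop) : exists2 k : nat -> nat,
  k @ \oo --> \oo & (forall n, P (k n)) \/ (forall n, ~ P (k n)).
Proof.
have [h|h] := pselect (forall N, exists n, (N <= n)%N /\ P n).
  have /choice[k hk] := h; exists k; last by left=> n; exact: (hk n).2.
  by move=> U [N _ hN]; exists N => // n Nn; apply: hN; exact: leq_trans Nn (hk n).1.
have /existsNP[N hN] := h.
exists (fun n => (N + n)%N).
  by move=> U [N' _ hN']; exists N' => // n Nn; apply: hN' => /=; exact: leq_trans Nn (leq_addl _ _).
by right=> n Pn; apply: hN; exists (N + n)%N; rewrite leq_addr.
Qed.

Section seq_approaching.
Context {R : realType} (M N : metrizable_space R) (A : set M) (B : set N).
Local Notation mA := (~` A : set M).
Local Notation mB := (~` B : set N).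
Local Notation I := (unit_interval R).

Lemma approachingP (f : mA -> mB) :
  (forall (x : nat -> mA) (a : mA), set_val \o x ~> set_val a ->
     set_val \o f \o x ~> set_val (f a)) ->
  (forall (x : nat -> mA) a, A a -> set_val \o x ~> a ->
     exists (k : nat -> nat) (b : N),
       [/\ k @ \oo --> \oo, B b & set_val \o f \o x \o k ~> b]) ->
  approaching f.
Proof.
move=> cf af; split.
  apply: (@seq_continuous R (sub_space mA)) => x a /cvg_valP xa.
  by apply/cvg_valP; exact: cf.
move=> x [a Aa /(@cluster_subseq R M)[k kn xa]].
have [k' [b [kn' Bb fb]]] := af (x \o k) a Aa xa.
exists b => //; apply: (@subseq_cluster R N (k \o k')) => //.
exact: subseq_comp.
Qed.

(* [G] is an approaching homotopy from [f] to [g], with the time parameter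
   separated from the point of the complement. *)
Definition seq_homotopy (f g : mA -> mB) (G : mA -> I -> mB) : Prop :=
  [/\ forall (x : nat -> mA) (t : nat -> I) a (s : I), set_val \o x ~> set_val a -> t ~> s ->
        (fun n => set_val (G (x n) (t n))) ~> set_val (G a s),
      forall (x : nat -> mA) (t : nat -> I) a (s : I), A a -> set_val \o x ~> a -> t ~> s ->
        exists (k : nat -> nat) (b : N),
          [/\ k @ \oo --> \oo, B b & (fun n => set_val (G (x (k n)) (t (k n)))) ~> b],
      forall x, G x (I0 R) = f x & forall x, G x (I1 R) = g x].

Lemma seq_homotopyP (f g : mA -> mB) :
  approaching_homotopic R f g <-> exists G, seq_homotopy f g G.
Proof.
pose I' := interval_space (R := R).
pose D : set (prod_space M I') := ~` (A `*` [set: I]).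
have DP (p : D) : (~` A) (set_val p).1 by move=> h; apply: (set_valP p).
have PD (x : mA) t : D (set_val x, t) by move=> [h _]; exact: (set_valP x).
pose pr (p : D) : mA := exist _ (set_val p).1 (mem_set (DP p)).
pose mk (x : mA) (t : I) : D := exist _ ((set_val x, t) : prod_space M I') (mem_set (PD x t)).
have mkP p : p = mk (pr p) (set_val p).2.
  by apply: set_val_inj; change (set_val p = ((set_val p).1, (set_val p).2)); case: (set_val p).
split=> [[h [[ch ah] h0 h1]]|[G [cG aG G0 G1]]].
  exists (fun x t => h (mk x t)); split.
  - move=> x t a s xa ts.
    have /cvg_valP mt : set_val \o (fun n => mk (x n) (t n)) ~> set_val (mk a s).
      by apply/(@cvg_pairP M I).
    by have /cvg_valP := cvg_cont (ch (mk a s)) mt.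
  - move=> x t a s Aa xa ts.
    have [|b Bb /(@cluster_subseq R N)[k kn hb]] := ah (fun n => mk (x n) (t n)).
      exists (a, s) => //; apply: (@subseq_cluster R (prod_space M I') id) => //.
      by apply/(@cvg_pairP M I).
    by exists k, b.
  - by move=> x; exact: h0.
  - by move=> x; exact: h1.
exists (fun p => G (pr p) (set_val p).2); split.
- split.
    apply: (@seq_continuous R (sub_space D)) => w p /cvg_valP/(@cvg_pairP M I)[wp1 wp2].
    by apply/cvg_valP; apply: (cG (pr \o w) _ (pr p)).
  move=> u [[a s] /= [Aa _]] /(@cluster_subseq R (prod_space M I'))[k kn /(@cvg_pairP M I)[ua us]].
  have [k' [b [kn' Bb hb]]] := aG (pr \o u \o k) _ a s Aa ua us.
  by exists b => //; apply: (@subseq_cluster R N (k \o k')) => //; exact: subseq_comp.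
- move=> x p px; rewrite px G0; congr f; apply: set_val_inj.
  by change ((set_val p).1 = set_val x); rewrite px.
- move=> x p px; rewrite px G1; congr g; apply: set_val_inj.
  by change ((set_val p).1 = set_val x); rewrite px.
Qed.

Lemma seq_homotopy_sym f g G : seq_homotopy f g G ->
  seq_homotopy g f (fun x t => G x (clampI (1 - ival t))).
Proof.
have cr (t : nat -> I) (s : I) : t ~> s -> (fun n => clampI (1 - ival (t n))) ~> clampI (1 - ival s).
  by move=> /cvg_ival ts; apply: (@cvg_clamp R (fun n => 1 - ival (t n))); apply: cvgB => //; exact: cvg_cst.
move=> [cG aG G0 G1]; split.
- by move=> x t a s xa ts; apply: cG => //; exact: cr.
- by move=> x t a s Aa xa ts; apply: (aG x _ a _ Aa xa (cr _ _ ts)).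
- by move=> x; rewrite ival0 subr0 clampI1.
- by move=> x; rewrite ival1 subrr clampI0.
Qed.

(** Along a subsequence all times lie in the same half. A limit at 1/2 reached from above is settled
    by the common value [g] of the two pieces. *)
Lemma seq_homotopy_trans f g h G G' : seq_homotopy f g G -> seq_homotopy g h G' ->
  seq_homotopy f h (fun x t => if 2 * ival t <= 1 then G x (clampI (2 * ival t))
                               else G' x (clampI (2 * ival t - 1))).
Proof.
have c1 (t : nat -> I) (s : I) : t ~> s -> (fun n => clampI (2 * ival (t n))) ~> clampI (2 * ival s).
  by move=> /cvg_ival ts; apply: (@cvg_clamp R (fun n => 2 * ival (t n))); apply: cvgM => //; exact: cvg_cst.
have c2 (t : nat -> I) (s : I) : t ~> s ->
    (fun n => clampI (2 * ival (t n) - 1)) ~> clampI (2 * ival s - 1).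
  move=> /cvg_ival ts; apply: (@cvg_clamp R (fun n => 2 * ival (t n) - 1)).
  by apply: cvgB; [apply: cvgM => //|]; exact: cvg_cst.
have lim_le (t : nat -> I) (s : I) : t ~> s -> (forall n, 2 * ival (t n) <= 1) -> 2 * ival s <= 1.
  move=> /cvg_ival/cvgR ts ht; rewrite leNgt; apply/negP => s1.
  have [|n hn] := ts ((2 * ival s - 1) / 2); first lra.
  by have := hn n (leqnn n); have := ht n; rewrite ltr_norml /= => ? /andP[]; lra.
have lim_ge (t : nat -> I) (s : I) : t ~> s -> (forall n, ~ 2 * ival (t n) <= 1) -> 1 <= 2 * ival s.
  move=> /cvg_ival/cvgR ts ht; rewrite leNgt; apply/negP => s1.
  have [|n hn] := ts ((1 - 2 * ival s) / 2); first lra.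
  have := hn n (leqnn n); have /negP := ht n; rewrite -ltNge ltr_norml /= => ? /andP[]; lra.
move=> [cG aG G0 G1] [cG' aG' G'0 G'1]; split.
- move=> x t a s xa ts; apply: cvg_by_subseq => k kn.
  have [k' kn' [ht|ht]] := subseq_dichotomy (fun n => 2 * ival (t (k n)) <= 1).
    exists k' => //; have tss : t \o (k \o k') ~> s by apply: cvg_subseq => //; exact: subseq_comp.
    rewrite (lim_le _ _ tss) //.
    have -> : (fun n => set_val (if 2 * ival (t n) <= 1 then G (x n) (clampI (2 * ival (t n)))
        else G' (x n) (clampI (2 * ival (t n) - 1)))) \o k \o k' =
        (fun n => set_val (G (x (k (k' n))) (clampI (2 * ival (t (k (k' n))))))).
      by apply/funext => n /=; rewrite ht.
    apply: (cG (x \o (k \o k')) (fun n => clampI (2 * ival (t (k (k' n)))))).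
      by apply: (@cvg_subseq _ _ _ (k \o k')) xa; exact: subseq_comp.
    exact: (c1 _ _ tss).
  exists k' => //; have tss : t \o (k \o k') ~> s by apply: cvg_subseq => //; exact: subseq_comp.
  have s1 := lim_ge _ _ tss ht.
  have -> : (fun n => set_val (if 2 * ival (t n) <= 1 then G (x n) (clampI (2 * ival (t n)))
        else G' (x n) (clampI (2 * ival (t n) - 1)))) \o k \o k' =
        (fun n => set_val (G' (x (k (k' n))) (clampI (2 * ival (t (k (k' n))) - 1)))).
    by apply/funext => n /=; rewrite ifN //; apply/negP/ht.
  have -> : (if 2 * ival s <= 1 then G a (clampI (2 * ival s))
      else G' a (clampI (2 * ival s - 1))) = G' a (clampI (2 * ival s - 1)).
    case: ifP => // s1'; have -> : 2 * ival s = 1 by apply/eqP; rewrite eq_le s1 s1'.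
    by rewrite subrr clampI0 clampI1 G1 G'0.
  apply: (cG' (x \o (k \o k')) (fun n => clampI (2 * ival (t (k (k' n))) - 1))).
    by apply: (@cvg_subseq _ _ _ (k \o k')) xa; exact: subseq_comp.
  exact: (c2 _ _ tss).
- move=> x t a s Aa xa ts.
  have [k kn [ht|ht]] := subseq_dichotomy (fun n => 2 * ival (t n) <= 1).
    have [k' [b [kn' Bb hb]]] := aG (x \o k) _ a _ Aa (cvg_subseq kn xa) (c1 _ _ (cvg_subseq kn ts)).
    exists (k \o k'), b; split=> //; first exact: subseq_comp.
    by apply: cvg_eq_near hb; exists 0%N => n _ /=; rewrite ht.
  have [k' [b [kn' Bb hb]]] := aG' (x \o k) _ a _ Aa (cvg_subseq kn xa) (c2 _ _ (cvg_subseq kn ts)).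
  exists (k \o k'), b; split=> //; first exact: subseq_comp.
  by apply: cvg_eq_near hb; exists 0%N => n _ /=; rewrite ifN //; apply/negP/ht.
- by move=> x; rewrite ival0 mulr0 ler01 clampI0 G0.
- move=> x; rewrite ival1 mulr1 ifN; last by rewrite -ltNge ltr1n.
  by rewrite (_ : 2 - 1 = 1 :> R) ?clampI1 ?G'1 //; lra.
Qed.

Lemma approaching_homotopic_sym (f g : mA -> mB) :
  approaching_homotopic R f g -> approaching_homotopic R g f.
Proof. by move=> /seq_homotopyP[G /seq_homotopy_sym ?]; apply/seq_homotopyP; eexists; eassumption. Qed.

Lemma approaching_homotopic_trans (f g h : mA -> mB) : approaching_homotopic R f g ->
  approaching_homotopic R g h -> approaching_homotopic R f h.
Proof.
move=> /seq_homotopyP[G hG] /seq_homotopyP[G' hG']; apply/seq_homotopyP.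
by eexists; exact: seq_homotopy_trans hG hG'.
Qed.

End seq_approaching.

Lemma approaching_homotopic_post (R : realType) (M N L : metrizable_space R)
    (A : set M) (B : set N) (D : set L) (f g : (~` A : set M) -> (~` B : set N))
    (j : (~` B : set N) -> (~` D : set L)) :
  approaching j -> approaching_homotopic R f g -> approaching_homotopic R (j \o f) (j \o g).
Proof.
move=> aj [h [ah h0 h1]]; exists (j \o h); split.
- have [cj sj] := aj; have [ch sh] := ah; split.
    by move=> x; apply: continuous_comp; [exact: ch|exact: cj].
  by move=> u /sh; exact: (sj (h \o u)).
- by move=> x p px /=; rewrite (h0 x).
- by move=> x p px /=; rewrite (h1 x).
Qed.

(** Classes are predicates, so it suffices to carry the witnesses of [same_fs] from one map to the
    other; composing the homotopy with [j] does this. *)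
Lemma fs_mor_of_homotopic (R : realType) (X Y : metrizable_space R)
    (M : Z_embedding X) (N : Z_embedding Y) (Phi Psi : approaching_map M N) :
  approaching_homotopic R Phi Psi -> fs_mor_of Phi = fs_mor_of Psi.
Proof.
move=> h.
have half (Phi' Psi' : approaching_map M N) r : approaching_homotopic R Phi' Psi' ->
    same_fs (FSRep Phi') r -> same_fs (FSRep Psi') r.
  move=> h' [i [j [/= ci cj ij]]]; exists i, j; split=> //.
  apply: approaching_homotopic_trans ij.
  apply: approaching_homotopic_sym.
  exact: (approaching_homotopic_post (am_approaching j) h').
have E : same_fs (FSRep Phi) = same_fs (FSRep Psi).
  apply: functional_extensionality_dep => r; apply: propext; split; apply: half => //.
  exact: approaching_homotopic_sym.
rewrite /fs_mor_of; move: (ex_intro _ _ _) (ex_intro _ _ _).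
by rewrite E => p p'; rewrite (Prop_irrelevance p p').
Qed.

(** * Extension of maps into cubes *)

Section csup.
Context {R : realType} (T : Type) (C : set T).
Implicit Types (phi psi : T -> R).

(* The element 0 makes the supremum 0 over an empty [C]. *)
Definition csup phi : R := sup [set r | r = 0 \/ exists2 c, C c & r = phi c].

Lemma csup_ub phi c : (forall c, C c -> phi c <= 1) -> C c -> phi c <= csup phi.
Proof.
move=> phi1 Cc; apply: ub_le_sup; last by right; exists c.
by exists 1 => r [->//|[c' /phi1 ? ->]].
Qed.

Lemma csup_ge0 phi : (forall c, C c -> phi c <= 1) -> 0 <= csup phi.
Proof.
move=> phi1; apply: ub_le_sup; last by left.
by exists 1 => r [->//|[c' /phi1 ? ->]].
Qed.

Lemma csup_le phi r : 0 <= r -> (forall c, C c -> phi c <= r) -> csup phi <= r.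
Proof.
move=> r0 phir; apply: ge_sup; first by exists 0; left.
by move=> s [->//|[c' /phir ? ->]].
Qed.

Lemma csup_diff_le phi psi e : (forall c, C c -> psi c <= 1) -> 0 <= e ->
  (forall c, C c -> phi c <= psi c + e) -> csup phi <= csup psi + e.
Proof.
move=> psi1 e0 h; apply: csup_le; first by rewrite addr_ge0 // csup_ge0.
by move=> c Cc; apply: le_trans (h c Cc) _; rewrite lerD2r csup_ub.
Qed.

Lemma csup_diff phi psi e : (forall c, C c -> phi c <= 1) ->
  (forall c, C c -> psi c <= 1) -> 0 <= e ->
  (forall c, C c -> `|phi c - psi c| <= e) -> `|csup phi - csup psi| <= e.
Proof.
move=> phi1 psi1 e0 h.
have h1 : csup phi <= csup psi + e.
  by apply: csup_diff_le => // c /h; rewrite ler_norml => /andP[]; lra.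
have h2 : csup psi <= csup phi + e.
  by apply: csup_diff_le => // c /h; rewrite ler_norml => /andP[]; lra.
by rewrite ler_norml; lra.
Qed.

(* The infimum of [phi] over [C], truncated at 1. *)
Definition tinf phi : R := 1 - csup (fun c => 1 - Num.min 1 (phi c)).

Let one_sub_min phi c : 0 <= phi c -> 0 <= 1 - Num.min 1 (phi c) <= 1.
Proof. by move=> p0; rewrite subr_ge0 ge_min lexx /= gerBl le_min ler01. Qed.

Lemma tinf_ge0 phi : (forall c, 0 <= phi c) -> 0 <= tinf phi.
Proof.
move=> p0; rewrite subr_ge0; apply: csup_le => // c _.
by have /andP[] := one_sub_min (p0 c).
Qed.

Lemma tinf_le1 phi : (forall c, 0 <= phi c) -> tinf phi <= 1.
Proof.
move=> p0; rewrite gerBl; apply: csup_ge0 => c _.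
by have /andP[] := one_sub_min (p0 c).
Qed.

Lemma tinf_le phi c : (forall c, 0 <= phi c) -> C c -> tinf phi <= phi c.
Proof.
move=> p0 Cc; have : 1 - Num.min 1 (phi c) <= csup (fun c => 1 - Num.min 1 (phi c)).
  by apply: csup_ub => // c' _; have /andP[] := one_sub_min (p0 c').
have : Num.min 1 (phi c) <= phi c by rewrite ge_min lexx orbT.
rewrite /tinf; lra.
Qed.

Lemma tinf_lt phi r : (forall c, 0 <= phi c) -> tinf phi < r -> r <= 1 ->
  exists2 c, C c & phi c < r.
Proof.
move=> p0 h r1; apply: contrapT => nh.
move: h; rewrite ltNge => /negP; apply.
have : csup (fun c => 1 - Num.min 1 (phi c)) <= 1 - r; last by rewrite /tinf; lra.
apply: csup_le; first by lra.
move=> c Cc; have rc : r <= phi c by rewrite leNgt; apply/negP => pr; apply: nh; exists c.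
have : r <= Num.min 1 (phi c) by rewrite le_min r1 rc.
lra.
Qed.

Lemma tinf_diff phi psi e : (forall c, 0 <= phi c) -> (forall c, 0 <= psi c) ->
  0 <= e -> (forall c, C c -> `|phi c - psi c| <= e) -> `|tinf phi - tinf psi| <= e.
Proof.
move=> p0 q0 e0 h.
have := @csup_diff (fun c => 1 - Num.min 1 (phi c)) (fun c => 1 - Num.min 1 (psi c)) e.
rewrite /tinf.
have -> a b : 1 - a - (1 - b) = - (a - b) :> R by lra.
rewrite normrN; apply => //.
- by move=> c _; have /andP[] := one_sub_min (p0 c).
- by move=> c _; have /andP[] := one_sub_min (q0 c).
- move=> c /h; rewrite !ler_norml.
  by case: (lerP 1 (phi c)); case: (lerP 1 (psi c)); lra.
Qed.

End csup.

Section cube.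
Context {R : realType}.
Local Notation I := (unit_interval R).

(** The cube over an arbitrary index set, given the uniform metric below. It is the convex ambient
    space: [iota_] embeds a metrizable space in the cube indexed by its own points. *)
Record ucube (T : Type) := UCube {
  ucube_val :> T -> R;
  ucubeP : forall x, 0 <= ucube_val x <= 1
}.

HB.instance Definition _ (T : Type) := gen_eqMixin (ucube T).
HB.instance Definition _ (T : Type) := gen_choiceMixin (ucube T).

Section ucube_metric.
Variable T : Type.
Implicit Types f g h : ucube T.

Lemma ucube_eq f g : (forall x, f x = g x) -> f = g.
Proof.
case: f g => [f pf] [g pg] /= fg; have {}fg : f = g by exact/funext.
by subst g; rewrite (Prop_irrelevance pf pg).
Qed.

Lemma ucube_dist f g x : `|f x - g x| <= 1.
Proof. by have := ucubeP f x; have := ucubeP g x; rewrite ler_norml; lra. Qed.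

Definition udist f g : R := csup setT (fun x => `|f x - g x|).

Lemma udist_ub f g x : `|f x - g x| <= udist f g.
Proof. by apply: (@csup_ub R T setT (fun x => `|f x - g x|)) => // c _; exact: ucube_dist. Qed.

Lemma udist_le f g r : 0 <= r -> (forall x, `|f x - g x| <= r) -> udist f g <= r.
Proof. by move=> r0 h; apply: csup_le. Qed.

Lemma udist_ge0 f g : 0 <= udist f g.
Proof. by apply: csup_ge0 => c _; exact: ucube_dist. Qed.

Lemma udistxx f : udist f f = 0.
Proof.
by apply/eqP; rewrite eq_le udist_ge0 andbT; apply: udist_le => // x; rewrite subrr normr0.
Qed.

Lemma udist_eq f g : udist f g = 0 -> f = g.
Proof.
move=> fg; apply: ucube_eq => x; apply/eqP; rewrite -subr_eq0 -normr_le0 -fg.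
exact: udist_ub.
Qed.

Lemma udist_sym f g : udist f g = udist g f.
Proof. by congr csup; apply/funext => x; rewrite distrC. Qed.

Lemma udist_triangle g f h : udist f h <= udist f g + udist g h.
Proof.
apply: udist_le => [|x]; first by rewrite addr_ge0 ?udist_ge0.
by apply: le_trans (ler_distD (g x) _ _) _; apply: lerD; exact: udist_ub.
Qed.

End ucube_metric.

HB.instance Definition _ (T : Type) := isMetric.Build R (ucube T)
  (@udistxx T) (@udist_eq T) (@udist_sym T) (@udist_triangle T).

Lemma ucube_metrizable (T : Type) : metrizable R (ucube T).
Proof.
by apply/metrizable_distP; exists (@mdist R (ucube T)); exact: mdist_is_dist.
Qed.

Definition cube (T : Type) : metrizable_space R := MetrizableSpace (ucube_metrizable T).

Lemma cvg_cube T (u : nat -> cube T) (f : cube T) :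
  u ~> f <-> forall e, 0 < e -> exists N, forall n, (N <= n)%N -> forall x, `|f x - u n x| <= e.
Proof.
split=> [uf e e0|h].
  have /uf [N _ hN] : nbhs f [set g | udist f g < e].
    have [_ _ _ _ /(_ f [set g | udist f g < e]) hn] := @mdist_is_dist R (ucube T).
    by apply/hn; exists e.
  by exists N => n /hN /ltW ? x; apply: le_trans (udist_ub _ _ _) _.
have [_ _ _ _ hn] := @mdist_is_dist R (ucube T).
move=> U /hn[e e0 eU]; have [N hN] := h (e / 2) (divr_gt0 e0 (ltr0Sn _ _)).
exists N => // n /hN fu; apply: eU.
by apply: (@le_lt_trans _ _ (e / 2)); [apply: udist_le => //|]; lra.
Qed.

Lemma uscale_proof T (c : I) (f : cube T) x : 0 <= ival c * f x <= 1.
Proof.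
have /andP[f0 f1] := ucubeP f x; have /andP[c0 c1] := ival_itv c.
by rewrite mulr_ge0 //= mulr_ile1.
Qed.

Definition uscale T (c : I) (f : cube T) : cube T := UCube (uscale_proof c f).

Lemma uscale1 T (f : cube T) : uscale (I1 R) f = f.
Proof. by apply: ucube_eq => x /=; rewrite mul1r. Qed.

Lemma ulerp_proof T (c : I) (f g : cube T) x :
  0 <= (1 - ival c) * f x + ival c * g x <= 1.
Proof.
have /andP[f0 f1] := ucubeP f x; have /andP[g0 g1] := ucubeP g x.
have /andP[c0 c1] := ival_itv c.
by apply/andP; split; nra.
Qed.

Definition ulerp T (c : I) (f g : cube T) : cube T := UCube (ulerp_proof c f g).

Lemma ulerp0 T (f g : cube T) : ulerp (I0 R) f g = f.
Proof. by apply: ucube_eq => x /=; rewrite ival0 subr0 mul1r mul0r addr0. Qed.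

Lemma ulerp1 T (f g : cube T) : ulerp (I1 R) f g = g.
Proof. by apply: ucube_eq => x /=; rewrite ival1 subrr mul0r mul1r add0r. Qed.

Lemma ulerpp T c (f : cube T) : ulerp c f f = f.
Proof. by apply: ucube_eq => x /=; ring. Qed.

Lemma cvg_ulerp T (c : nat -> I) (f g : nat -> cube T) (c0 : I) (f0 g0 : cube T) :
  c ~> c0 -> f ~> f0 -> g ~> g0 -> (fun n => ulerp (c n) (f n) (g n)) ~> ulerp c0 f0 g0.
Proof.
move=> /cvg_ival/cvgR cc /cvg_cube cf /cvg_cube cg; apply/cvg_cube => e e0.
(* The difference is split into three terms, from changing [f], [g] and [c] in turn; a quarter of
   [e] for each leaves room. *)
have e3 : 0 < e / 4 by lra.
have [N1 h1] := cc _ e3; have [N2 h2] := cf _ e3; have [N3 h3] := cg _ e3.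
exists (maxn N1 (maxn N2 N3)) => n; rewrite !geq_max => /and3P[/h1 {}h1 /h2 {}h2 /h3 {}h3] x.
have {}h2 := h2 x; have {}h3 := h3 x; rewrite /= in h1 h2 h3 *.
have /andP[a0 a1] := ucubeP f0 x; have /andP[b0 b1] := ucubeP g0 x.
have /andP[d0 d1] := ival_itv (c n).
set C0 := ival c0 in h1 *; set Cn := ival (c n) in h1 d0 d1 *.
set F0 := f0 x in h2 a0 a1 *; set Fn := f n x in h2 *.
set G0 := g0 x in h3 b0 b1 *; set Gn := g n x in h3 *.
have -> : (1 - C0) * F0 + C0 * G0 - ((1 - Cn) * Fn + Cn * Gn) =
  (1 - Cn) * (F0 - Fn) + Cn * (G0 - Gn) + (C0 - Cn) * (G0 - F0) by ring.
have k1 : `|(1 - Cn) * (F0 - Fn)| <= e / 4.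
  by rewrite normrM ger0_norm ?subr_ge0 //; have := normr_ge0 (F0 - Fn); nra.
have k2 : `|Cn * (G0 - Gn)| <= e / 4.
  by rewrite normrM ger0_norm //; have := normr_ge0 (G0 - Gn); nra.
have k3 : `|(C0 - Cn) * (G0 - F0)| <= e / 4.
  have : `|G0 - F0| <= 1 by rewrite ler_norml; lra.
  by rewrite normrM; have := normr_ge0 (G0 - F0); have := normr_ge0 (C0 - Cn); nra.
apply: le_trans (ler_normD _ _) _; have := ler_normD ((1 - Cn) * (F0 - Fn)) (Cn * (G0 - Gn)).
lra.
Qed.

Definition uzero T : cube T := @UCube T (fun=> 0) (fun=> andb_true_intro (conj (lexx 0) ler01)).

Lemma uscaleE T c (f : cube T) : uscale c f = ulerp c (uzero T) f.
Proof. by apply: ucube_eq => x /=; rewrite mulr0 add0r. Qed.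

Lemma cvg_uscale T (c : nat -> I) (f : nat -> cube T) (c0 : I) (f0 : cube T) :
  c ~> c0 -> f ~> f0 -> (fun n => uscale (c n) (f n)) ~> uscale c0 f0.
Proof.
move=> cc cf; rewrite uscaleE; under eq_fun do rewrite uscaleE.
by apply: cvg_ulerp => //; exact: cvg_const.
Qed.

(** The values of [f] are bounded by 1, so the factor alone forces convergence even if [f] diverges.
    This lets the cube coordinate be forgotten at the end of the contraction of the top. *)
Lemma cvg_uscale0 T (c : nat -> I) (f : nat -> cube T) :
  c ~> I0 R -> (fun n => uscale (c n) (f n)) ~> uzero T.
Proof.
move=> /cvg_ival/cvgR cc; apply/cvg_cube => e /cc [N hN]; exists N => n /hN /= + x.
have /andP[f0 f1] := ucubeP (f n) x; have /andP[c0 c1] := ival_itv (c n).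
rewrite ival0 !sub0r !normrN !ger0_norm ?mulr_ge0 // => h; nra.
Qed.

End cube.

Section extension.
Context {R : realType} (S : metrizable_space R) (C : set S) (T : Type).
Context (f : S -> cube (R := R) T).

Definition delta (z : S) : R := tinf C (dist z).

Lemma delta_ge0 z : 0 <= delta z.
Proof. by apply: tinf_ge0 => c; exact: dist_ge0. Qed.

Lemma delta_le z c : C c -> delta z <= dist z c.
Proof. by move=> Cc; apply: tinf_le => // c'; exact: dist_ge0. Qed.

Lemma delta_lip z z' : `|delta z - delta z'| <= dist z z'.
Proof.
apply: tinf_diff => [c|c||c _]; [exact: dist_ge0|exact: dist_ge0|exact: dist_ge0|].
have := dist_triangle z' z c; have := dist_triangle z z' c; rewrite (dist_sym z' z).
by rewrite ler_norml; lra.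
Qed.

Lemma delta_gt0 z : ~ closure C z -> 0 < delta z.
Proof.
move=> nz; rewrite ltNge; apply/negP => d0; apply: nz => U /nbhs_dist[e e0 eU].
(* [delta] is truncated at 1, so only bounds up to 1 yield a nearby point of [C]. *)
have [|||c Cc zc] := @tinf_lt R S C (dist z) (Num.min e 1).
- by move=> c; exact: dist_ge0.
- by apply: le_lt_trans d0 _; rewrite lt_min e0 ltr01.
- by rewrite ge_min lexx orbT.
- by exists c; split=> //; apply: eU; apply: lt_le_trans zc _; rewrite ge_min lexx.
Qed.

Lemma weight_itv z c : C c -> 0 <= delta z / dist z c <= 1.
Proof.
move=> Cc; have d0 := delta_ge0 z; have dc := delta_le z Cc.
rewrite divr_ge0 ?dist_ge0 //=.
have [->|dn0] := eqVneq (dist z c) 0; first by rewrite invr0 mulr0 ler01.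
by rewrite ler_pdivrMr ?mul1r // lt_neqAle eq_sym dn0 dist_ge0.
Qed.

Lemma weighted_itv z c x : C c -> 0 <= f c x * (delta z / dist z c) <= 1.
Proof.
move=> /(weight_itv z) /andP[w0 w1]; have /andP[f0 f1] := ucubeP (f c) x.
by rewrite mulr_ge0 //= mulr_ile1.
Qed.

(* At z outside C the value [f c] is weighted by d(z, C) / d(z, c), which is close
   to 1 only for c almost nearest to z; taking suprema coordinatewise replaces the
   partition of unity of Dugundji's theorem. *)
Definition ext_sup (z : S) (x : T) : R := csup C (fun c => f c x * (delta z / dist z c)).

Lemma ext_sup_itv z x : 0 <= ext_sup z x <= 1.
Proof.
apply/andP; split; first by apply: csup_ge0 => c /(weighted_itv z x) /andP[].
by apply: csup_le => // c /(weighted_itv z x) /andP[].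
Qed.

Definition ext (z : S) : cube (R := R) T :=
  if pselect (C z) then f z else UCube (ext_sup_itv z).

Lemma extE z : C z -> ext z = f z.
Proof. by rewrite /ext; case: pselect. Qed.

Lemma delta_notin z : 0 < delta z -> ~ C z.
Proof. by move=> d0 /(delta_le z); rewrite distxx leNgt d0. Qed.

Lemma ext_supE z x : 0 < delta z -> ext z x = ext_sup z x.
Proof. by move=> /delta_notin; rewrite /ext; case: pselect. Qed.

(** With a common denominator the numerator is a'(d - d') + d'(a' - a), where d' is at most a' and
    both differences are at most the distance of z and z'. The bound does not depend on [c], so it
    passes to the supremum. *)
Lemma weight_diff z z' c : 0 < delta z -> 0 < delta z' -> C c ->
  `|delta z / dist z c - delta z' / dist z' c| <= 2 * dist z z' / delta z.
Proof.
move=> d0 d0' Cc; have dc := delta_le z Cc; have dc' := delta_le z' Cc.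
have a0 : 0 < dist z c by apply: lt_le_trans dc.
have a0' : 0 < dist z' c by apply: lt_le_trans dc'.
have l1 := delta_lip z z'.
have l2 : `|dist z' c - dist z c| <= dist z z'.
  have := dist_triangle z' z c; have := dist_triangle z z' c; rewrite (dist_sym z' z).
  by rewrite ler_norml; lra.
have r0 := dist_ge0 z z'.
set d := delta z in d0 dc l1 *; set d' := delta z' in d0' dc' l1 *.
set a := dist z c in dc a0 l2 *; set a' := dist z' c in dc' a0' l2 *.
set r := dist z z' in l1 l2 r0 *.
have -> : d / a - d' / a' = (a' * (d - d') + d' * (a' - a)) / (a * a').
  by field; rewrite !gt_eqF.
have aa : 0 <= (a * a')^-1 by rewrite invr_ge0 mulr_ge0 // ltW.
rewrite normrM (ger0_norm aa).
have n1 : `|a' * (d - d') + d' * (a' - a)| <= a' * (2 * r).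
  apply: le_trans (ler_normD _ _) _; rewrite !normrM (gtr0_norm a0') (gtr0_norm d0').
  by have := normr_ge0 (a' - a); nra.
apply: (@le_trans _ _ (a' * (2 * r) / (a * a'))).
  by rewrite ler_pM2r // invr_gt0 mulr_gt0.
have -> : a' * (2 * r) / (a * a') = 2 * r / a by field; rewrite !gt_eqF.
apply: ler_pM => //; first by rewrite mulr_ge0.
  by rewrite invr_ge0 ltW.
by rewrite lef_pV2 ?posrE.
Qed.

Lemma ext_cvg_off (u : nat -> S) z : 0 < delta z -> u ~> z -> ext \o u ~> ext z.
Proof.
move=> d0 /cvg_distP uz; apply/cvg_cube => e e0.
(* The first bound keeps [delta (u n)] positive, the second makes the estimate of [weight_diff] at
   most [e]. *)
have h0 : 0 < Num.min (delta z) (e * delta z / 2).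
  by rewrite lt_min d0 /= divr_gt0 // mulr_gt0.
have [N hN] := uz _ h0; exists N => n /hN; rewrite lt_min => /andP[h1 h2] x /=.
have d0' : 0 < delta (u n).
  by have := delta_lip z (u n); rewrite ler_norml; lra.
rewrite !ext_supE //; apply: csup_diff => [c Cc|c Cc||c Cc].
- by have /andP[] := weighted_itv z x Cc.
- by have /andP[] := weighted_itv (u n) x Cc.
- exact: ltW.
- rewrite -mulrBr normrM.
  have /andP[f0 f1] := ucubeP (f c) x; rewrite ger0_norm //.
  have := weight_diff d0 d0' Cc.
  have : 2 * dist z (u n) / delta z <= e by rewrite ler_pdivrMr //; lra.
  have := normr_ge0 (delta z / dist z c - delta (u n) / dist (u n) c).
  by nra.
Qed.

Lemma seq_modulus (c0 : S) :
  (forall w, (forall n, C (w n)) -> w ~> c0 -> f \o w ~> f c0) ->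
  forall e, 0 < e -> exists2 r, 0 < r &
    forall c, C c -> dist c0 c < r -> forall x, `|f c0 x - f c x| <= e.
Proof.
move=> cf e e0; apply: contrapT => nr.
have /choice[w hw] n : exists c, [/\ C c, dist c0 c < n.+1%:R^-1 &
    ~ forall x, `|f c0 x - f c x| <= e].
  apply: contrapT => nc; apply: nr; exists n.+1%:R^-1; first by rewrite invr_gt0.
  by move=> c Cc cc; apply: contrapT => h; apply: nc; exists c.
have wc : w ~> c0.
  apply/cvg_distP => r r0; have [N hN] := ltr_invS r0; exists N => n /hN.
  by apply: lt_trans; case: (hw n).
have /cvg_cube/(_ e e0)[N /(_ N (leqnn N)) h] := cf w (fun n => let: And3 h _ _ := hw n in h) wc.
by case: (hw N).
Qed.

(** Centres far from [c0] get small weight, while an almost nearest centre is close to [c0] and gets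
    weight close to 1. [C] need not be closed: the terms must avoid the points of its closure
    outside it, where the formula gives no control. *)
Lemma ext_cvg_on (u : nat -> S) c0 : C c0 ->
  (forall w, (forall n, C (w n)) -> w ~> c0 -> f \o w ~> f c0) ->
  (forall n, C (u n) \/ 0 < delta (u n)) -> u ~> c0 -> ext \o u ~> ext c0.
Proof.
(* The lower estimate loses [e] from the value and [e] from the weight, whence half of [e']. *)
move=> Cc0 cf uC /cvg_distP uc; rewrite (extE Cc0); apply/cvg_cube => e' e0'.
pose e := Num.min (e' / 2) 1.
have e0 : 0 < e by rewrite lt_min divr_gt0 //=.
have e1 : e <= 1 by rewrite ge_min lexx orbT.
have ee' : 2 * e <= e' by have : e <= e' / 2 by [rewrite ge_min lexx]; lra.
have [r r0 hr] := seq_modulus cf e0.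
(* With r/3, far centres stay r/2 away from [z] and an almost nearest one is within r of [c0]; with
   e r/2, the weight of a far centre is at most [e]; the bound 1 keeps [delta z] below its
   truncation. *)
pose eta := Num.min (Num.min (r / 3) (e * r / 2)) 1.
have eta0 : 0 < eta by rewrite !lt_min !divr_gt0 ?mulr_gt0 //=.
have eta1 : eta <= 1 by rewrite ge_min lexx orbT.
have eta2 : eta <= r / 3 by rewrite !ge_min lexx.
have eta3 : eta <= e * r / 2 by rewrite !ge_min lexx orbT.
have [N hN] := uc _ eta0; exists N => n /hN {hN}; move: (uC n) => /=.
move: (u n) => z uCz cz x.
have [Cz|nCz] := pselect (C z).
  by rewrite (extE Cz); apply: le_trans (hr z Cz _ x) _; lra.
have d0 : 0 < delta z by case: uCz.
rewrite (ext_supE _ d0).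
have dz : delta z <= dist c0 z by rewrite dist_sym; exact: delta_le.
have /andP[p0 p1] := ucubeP (f c0) x.
have up : ext_sup z x <= f c0 x + e.
  apply: csup_le; first by rewrite addr_ge0 // ltW.
  move=> c Cc; have /andP[w0 w1] := weight_itv z Cc; have /andP[q0 q1] := ucubeP (f c) x.
  have [cr|cr] := ltP (dist c0 c) r.
    have := hr c Cc cr x; rewrite ler_norml => /andP[h1 h2].
    have : f c x * (delta z / dist z c) <= f c x by rewrite ler_piMr.
    lra.
  have zc : r / 2 <= dist z c by have := dist_triangle z c0 c; lra.
  have we : delta z / dist z c <= e.
    rewrite ler_pdivrMr; last by apply: lt_le_trans zc; lra.
    nra.
  have : f c x * (delta z / dist z c) <= delta z / dist z c by rewrite ler_piMl.
  lra.
(* A centre at distance less than (1 + e) times [delta z] has weight at least 1 - e. *)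
have lo : f c0 x - 2 * e <= ext_sup z x.
  have [||| c Cc zc] := @tinf_lt R S C (dist z) (Num.min 1 (delta z * (1 + e))).
  - by move=> c; exact: dist_ge0.
  - rewrite lt_min -/(delta z); apply/andP; split; [lra|nra].
  - by rewrite ge_min lexx.
  have zc' : dist z c < delta z * (1 + e).
    by apply: lt_le_trans zc _; rewrite ge_min lexx orbT.
  have a0 : 0 < dist z c by apply: lt_le_trans (delta_le z Cc).
  have cr : dist c0 c < r by have := dist_triangle z c0 c; nra.
  have := hr c Cc cr x; rewrite ler_norml => /andP[h1 h2].
  have /andP[q0 q1] := ucubeP (f c) x.
  have w1 : 1 - e <= delta z / dist z c by rewrite ler_pdivlMr //; nra.
  have : f c x * (delta z / dist z c) <= ext_sup z x.
    by apply: (@csup_ub _ _ _ (fun c => f c x * (delta z / dist z c))) => // c' /(weighted_itv z x) /andP[].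
  nra.
by rewrite ler_norml; lra.
Qed.

End extension.

Section real_sequences.
Context {R : realType}.

Lemma real_metrizable : metrizable R R.
Proof.
exists R^o, (fun x : R => x : R^o).
by split; [move=> x; exact: cvg_id|exists (fun x => x); split=> // x; exact: cvg_id].
Qed.

Lemma bounded_subseq (u : nat -> R) (a b : R) : (forall n, a <= u n <= b) ->
  exists (k : nat -> nat) (r : R), [/\ k @ \oo --> \oo, u \o k ~> r & a <= r <= b].
Proof.
move=> uab.
have [|r [rab ur]] := @segment_compact R a b (u @ \oo) _.
  by exists 0%N => // n _ /=; rewrite in_itv /= uab.
have [k kn ku] := @cluster_subseq R (MetrizableSpace real_metrizable) u r ur.
by exists k, r; split=> //; move: rab; rewrite /= in_itv.
Qed.

Lemma cvg_tail (T : topologicalType) (u : nat -> T) (x : T) N :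
  (fun n => u (n + N)%N) ~> x -> u ~> x.
Proof.
move=> h U /h[N' _ hN']; exists (N' + N)%N => // n /= Nn.
rewrite -(subnK (leq_trans (leq_addl _ _) Nn)); apply: hN' => /=.
by rewrite leq_subRL ?(leq_trans (leq_addl _ _) Nn) // addnC.
Qed.

Lemma shift_subseq N : (fun n => n + N)%N @ \oo --> \oo.
Proof. by move=> U [N' _ hN']; exists N' => // n /= h; apply: hN'; exact: leq_trans h (leq_addr _ _). Qed.

Lemma cvg_squeeze0 (u v : nat -> R) : (forall n, 0 <= u n <= v n) -> v ~> (0 : R) -> u ~> (0 : R).
Proof.
move=> uv /cvgR v0; apply/cvgR => e /v0[N hN]; exists N => n /hN.
by have := uv n; rewrite !sub0r !normrN => /andP[u0 uv']; rewrite !ger0_norm //; lra.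
Qed.

End real_sequences.

Section dist_cvg.
Context {R : realType} (X : metrizable_space R).

Lemma cvg_dist0 (u v : nat -> X) (x : X) :
  u ~> x -> (fun n => dist (u n) (v n)) ~> (0 : R) -> v ~> x.
Proof.
move=> /cvg_distP ux /cvgR uv; apply/cvg_distP => e e0.
have e20 : 0 < e / 2 by rewrite divr_gt0.
have [N hN] := ux _ e20; have [N' hN'] := uv _ e20.
exists (maxn N N') => n; rewrite geq_max => /andP[/hN h1 /hN'].
rewrite sub0r normrN ger0_norm ?dist_ge0 // => h2.
by apply: le_lt_trans (dist_triangle (u n) _ _) _; rewrite (splitr e) ltrD.
Qed.

Lemma dist_cvg (u v : nat -> X) (x y : X) :
  u ~> x -> v ~> y -> (fun n => dist (u n) (v n)) ~> dist x y.
Proof.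
move=> /cvg_distP ux /cvg_distP vy; apply/cvgR => e e0.
have e20 : 0 < e / 2 by rewrite divr_gt0.
have [N hN] := ux _ e20; have [N' hN'] := vy _ e20.
exists (maxn N N') => n; rewrite geq_max => /andP[/hN h1 /hN' h2].
have := dist_triangle (u n) x y; have := dist_triangle (v n) (u n) y.
have := dist_triangle x (u n) (v n); have := dist_triangle y x (v n).
rewrite (dist_sym (u n) x) (dist_sym (v n) y) ltr_norml; lra.
Qed.

End dist_cvg.

(** * The space with a contractible top *)

Section iota.
Context {R : realType} (X : metrizable_space R).

Lemma iota_proof (x x' : X) : 0 <= Num.min 1 (dist x x') <= 1.
Proof. by rewrite le_min ler01 dist_ge0 ge_min lexx. Qed.

(** The Kuratowski embedding with truncated distance. Its image need not be closed in the cube. *)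
Definition iota_ (x : X) : cube (R := R) X := UCube (iota_proof x).

Lemma cvg_iota (u : nat -> X) x : iota_ \o u ~> iota_ x <-> u ~> x.
Proof.
split=> [/cvg_cube h|/cvg_distP h].
  apply/cvg_distP => e e0.
  (* The coordinate at [u n] of the difference is the truncated distance from [x] to [u n]; a bound
     below 1 shows that the truncation is inactive. *)
  have m0 : 0 < Num.min (e / 2) (1 / 2) by rewrite lt_min !divr_gt0.
  have [N hN] := h _ m0; exists N => n /hN /(_ (u n)) /=.
  rewrite distxx (min_idPr ler01) subr0 ger0_norm ?le_min ?ler01 ?dist_ge0 //.
  have : Num.min (e / 2) (1 / 2) <= e / 2 by rewrite ge_min lexx.
  have : Num.min (e / 2) (1 / 2) <= 1 / 2 by rewrite ge_min lexx orbT.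
  by case: (lerP 1 (dist x (u n))); lra.
apply/cvg_cube => e /h[N hN]; exists N => n /hN {}hN y /=.
have := dist_triangle (u n) x y; have := dist_triangle x (u n) y; rewrite (dist_sym (u n) x).
by rewrite ler_norml; case: (lerP 1 (dist x y)); case: (lerP 1 (dist (u n) y)); lra.
Qed.

Lemma iota_inj : injective iota_.
Proof.
move=> x y xy; suff h : (fun _ : nat => x) ~> y by exact: (@cvg_inj R X (fun _ => x) x y (@cvg_const X x) h).
by apply/cvg_iota; rewrite -xy; exact: cvg_const.
Qed.

(* [phi] transported along the embedding, with junk value [d] off its range. *)
Definition on_iota (E : Type) (phi : X -> E) (d : E) (e : cube (R := R) X) : E :=
  if pselect (exists x, iota_ x = e) is left h then phi (sval (cid h)) else d.

Lemma on_iotaE E (phi : X -> E) d x : on_iota phi d (iota_ x) = phi x.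
Proof.
rewrite /on_iota; case: pselect => [h|[]]; last by exists x.
by case: cid => y /= /iota_inj ->.
Qed.

End iota.

Arguments iota_ {R X} x.

Section hat.
Context {R : realType} (X : metrizable_space R) (A : set X) (cA : closed A).
Local Notation I := (interval_space (R := R)).
Local Notation I0 := (I0 R).
Local Notation I1 := (I1 R).
Local Notation iota := (@iota_ R X).
Local Notation E := (cube (R := R) X).

Definition hatK : metrizable_space R := prod_space E I.

(* X with a copy of the contractible space [E * 1] attached by the cylinder of
   A; it plays the role of X with a cone over A attached. *)
Definition hset : set hatK :=
  [set k | range iota k.1 /\ k.2 = I0 \/ (iota @` A) k.1 \/ k.2 = I1].

(** Constrained to the hat at time 0 only; at positive times the whole of cube x I is present, so
    the complement of the hat is a product. *)
Definition nset : set (prod_space hatK I) := [set p | hset p.1 \/ p.2 <> I0].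

Definition hat : metrizable_space R := sub_space hset.
Definition hatN : metrizable_space R := sub_space nset.

Lemma hat_in_proof (k : hat) : nset (set_val k, I0).
Proof. left; exact: (set_valP k). Qed.

Definition hat_in (k : hat) : hatN :=
  exist _ ((set_val k, I0) : prod_space hatK I) (mem_set (hat_in_proof k)).

Lemma hat_inE k : set_val (hat_in k) = (set_val k, I0). Proof. by []. Qed.

Lemma hat_in_range (p : hatN) : range hat_in p <-> (set_val p).2 = I0.
Proof.
split=> [[k _ <-] //|p0].
have hp : hset (set_val p).1 by case: (set_valP p).
have [k kE] := set_val_ex hp; exists k => //; apply: set_val_inj.
by rewrite hat_inE kE -p0; case: (set_val p).
Qed.

Lemma hatN_cvg (u : nat -> hatN) (p : hatN) :
  u ~> p <-> [/\ (fun n => (set_val (u n)).1.1) ~> (set_val p).1.1,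
    (fun n => (set_val (u n)).1.2) ~> (set_val p).1.2 & (fun n => (set_val (u n)).2) ~> (set_val p).2].
Proof.
apply: (iff_trans (@cvg_valP _ nset u p)); apply: (iff_trans (@cvg_pairP hatK I _ _)).
split=> [[/(@cvg_pairP E I)[h1 h2] h3]|[h1 h2 h3]] //.
by split=> //; apply/(@cvg_pairP E I).
Qed.

Lemma hat_in_embedding : closed_embedding hat_in.
Proof.
split.
- apply: seq_continuous => u k uk; apply/cvg_valP.
  by apply/(@cvg_pairP hatK I); split; [apply/cvg_valP|exact: cvg_const].
- by move=> k k' /(congr1 set_val); rewrite !hat_inE => -[kk]; exact: set_val_inj.
- move=> C cC; apply: seq_closed => u p uC up.
  have /choice[w hw] n : exists k, C k /\ hat_in k = u n by have [k] := uC n; exists k.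
  have p0 : (set_val p).2 = I0.
    apply: (@cvg_inj R I (fun n => (set_val (u n)).2)); first by move/hatN_cvg: up => [].
    by apply: cvg_eq_near (@cvg_const I I0); exists 0%N => n _; rewrite -(hw n).2.
  have /hat_in_range[k _ kp] := p0; exists k => //.
  apply: (closed_lim cC (fun n => (hw n).1)); apply/cvg_valP.
  move/cvg_valP/(@cvg_pairP hatK I): up => [up _]; rewrite -kp hat_inE in up.
  by apply: cvg_eq_near up; exists 0%N => n _ /=; rewrite -(hw n).2.
Qed.

(** The homotopy raises the time coordinate to its maximum with t; at positive time the other
    coordinates are free. *)
Lemma hat_Z_set : Z_set R (range hat_in).
Proof.
split; first by have [_ _] := hat_in_embedding; apply; exact: closedT.
have hP (p : hatN * unit_interval R) :
    nset ((set_val p.1).1, clampI (Num.max (ival (set_val p.1).2) (ival p.2))).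
  have [h|h] := set_valP p.1; [by left|right=> /= h0; apply: h].
  have := congr1 ival h0; have /andP[a0 a1] := ival_itv (set_val p.1).2.
  have /andP[b0 b1] := ival_itv p.2.
  rewrite clampIK ?ge_max ?le_max ?a0 ?a1 ?b1 // ival0 => m0.
  apply: ival_inj; apply/eqP; rewrite ival0 eq_le a0 andbT -m0.
  by rewrite le_max lexx.
exists (fun p => exist _ (((set_val p.1).1, clampI (Num.max (ival (set_val p.1).2) (ival p.2)))
   : prod_space hatK I) (mem_set (hP p))); split.
- apply: (@seq_continuous R (prod_space hatN I)) => u p /(@cvg_pairP hatN I)[up1 up2].
  apply/cvg_valP; apply/(@cvg_pairP hatK I).
  move/cvg_valP/(@cvg_pairP hatK I): up1 => [h1 h2]; split=> //.
  apply: (@cvg_clamp R (fun n => Num.max (ival (set_val (u n).1).2) (ival (u n).2))).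
  by apply: cvg_maxr; apply/cvg_ival.
- move=> p; apply: set_val_inj.
  change (((set_val p).1, clampI (Num.max (ival (set_val p).2) (ival I0))) = set_val p).
  have /andP[a0 _] := ival_itv (set_val p).2.
  by rewrite ival0 (max_idPl a0) ivalK; case: (set_val p).
- move=> p t t0 /hat_in_range h; move/eqP: t0; apply.
  have := congr1 ival (h : clampI (Num.max (ival (set_val p).2) (ival t)) = I0).
  have /andP[a0 a1] := ival_itv (set_val p).2; have /andP[b0 b1] := ival_itv t.
  rewrite clampIK ?ge_max ?le_max ?a0 ?a1 ?b1 // ival0 => m0.
  apply: ival_inj; apply/eqP; rewrite ival0 eq_le b0 andbT -m0.
  by rewrite le_max lexx orbT.
Qed.

End hat.

Section hat_retract.
Context {R : realType}.
Local Notation I := (interval_space (R := R)).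
Local Notation I0 := (I0 R).
Local Notation I1 := (I1 R).

Lemma ext_continuous (S : metrizable_space R) (C : set S) T (f : S -> cube (R := R) T) :
  closed C ->
  (forall (w : nat -> S) c, C c -> (forall n, C (w n)) -> w ~> c -> f \o w ~> f c) ->
  continuous (ext C f).
Proof.
move=> cC cf; have dC z : C z \/ 0 < delta C z.
  have [Cz|nCz] := pselect (C z); [by left|right; apply: delta_gt0].
  by rewrite -(closure_id C).1.
apply: seq_continuous => u z uz; have [Cz|d0] := dC z; last exact: ext_cvg_off.
by apply: ext_cvg_on => // w wC wz; exact: cf.
Qed.

Lemma ucst_proof (t : I) (x : unit) : 0 <= ival t <= 1.
Proof. exact: ival_itv. Qed.

(** A number of [0,1] as a point of a cube with one index, so that [ext] extends real coordinates as
    well. *)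
Definition ucst (t : I) : cube (R := R) unit := UCube (ucst_proof t).

Lemma cvg_ucst (t : nat -> I) (s : I) : t ~> s -> ucst \o t ~> ucst s.
Proof.
move=> /cvg_ival/cvgR ts; apply/cvg_cube => e /ts[N hN]; exists N => n /hN h x.
exact: ltW.
Qed.

Lemma cvg_coord T (u : nat -> cube (R := R) T) (f : cube T) x :
  u ~> f -> (fun n => u n x) ~> f x.
Proof.
move=> /cvg_cube uf; apply/cvgR => e e0; have [|N hN] := uf (e / 2); first by rewrite divr_gt0.
by exists N => n /hN /(_ x) h; apply: le_lt_trans h _; lra.
Qed.

Variables (X : metrizable_space R) (A : set X).

(** The coordinates of the inverse of [e] are extended separately; the constraint at time 0 is met
    by making the time positive off the image. *)
Lemma hat_AR : absolute_retract (hatN A).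
Proof.
move=> Z e he; have [ce ie cle] := he.
pose C := range e; have cC : closed C by apply: cle; exact: closedT.
have top : nset A (((uzero X, I1) : hatK X), I0) by left; right; right.
(* A default value for [s]; the top provides a point even when [X] is empty. *)
pose d : hatN A := exist _ ((((uzero X, I1) : hatK X), I0) : prod_space (hatK X) I) (mem_set top).
pose s z : hatN A := if pselect (exists n, e n = z) is left h then sval (cid h) else d.
have sE n : s (e n) = n.
  by rewrite /s; case: pselect => [h|[]]; [case: cid => m /= /ie|exists n].
have cs (w : nat -> Z) c : C c -> (forall n, C (w n)) -> w ~> c -> s \o w ~> s c.
  move=> [n _ <-] wC wc; rewrite sE; apply: (cvg_embedding he).
  by apply: cvg_eq_near wc; exists 0%N => j _ /=; have [m _ <-] := wC j; rewrite sE.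
pose f1 z : cube (R := R) X := (set_val (s z)).1.1.
pose f2 z := ucst (set_val (s z)).1.2.
pose f3 z := ucst (set_val (s z)).2.
have c1 : continuous (ext C f1).
  by apply: ext_continuous => // w c Cc wC wc; have /hatN_cvg[] := cs w c Cc wC wc.
have c2 : continuous (ext C f2).
  apply: ext_continuous => // w c Cc wC wc; have /hatN_cvg[_ h _] := cs w c Cc wC wc.
  exact: cvg_ucst h.
have c3 : continuous (ext C f3).
  apply: ext_continuous => // w c Cc wC wc; have /hatN_cvg[_ _ h] := cs w c Cc wC wc.
  exact: cvg_ucst h.
(* The distance to [C] vanishes on [C], so the extension property is kept, and is positive
   elsewhere, where any other coordinates are then allowed. *)
pose tt' z := clampI (Num.max (ext C f3 z tt) (delta C z)).
pose r0 z : prod_space (hatK X) I := ((ext C f1 z, clampI (ext C f2 z tt)), tt' z).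
have dC z : C z -> delta C z = 0.
  by move=> /(delta_le z); rewrite distxx => h; apply/eqP; rewrite eq_le h delta_ge0.
have r0E n : r0 (e n) = set_val n.
  have Cn : C (e n) by exists n.
  have f0 := ucubeP (f3 (e n)) tt; move/andP: (f0) => [f00 _].
  rewrite /r0 /tt' (dC _ Cn) !extE // (max_idPl f00) /f1 /f2 /f3 sE /= !ivalK.
  by case: (set_val n) => [[]].
have r0N z : nset A (r0 z).
  have [[n _ <-]|nC] := pselect (C z); first by rewrite r0E; exact: (set_valP n).
  have d0 : 0 < delta C z by apply: delta_gt0; rewrite -(closure_id C).1.
  right=> /= /(congr1 ival); rewrite ival0 clampIE => h.
  have : 0 < Num.min 1 (Num.max (ext C f3 z tt) (delta C z)).
    by rewrite lt_min ltr01 lt_max d0 orbT.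
  by move: h; case: lerP => // h h' h''; move: h'' h' h; lra.
exists (fun z => exist _ (r0 z) (mem_set (r0N z))); split; last first.
  by move=> n; apply: set_val_inj; exact: r0E.
apply: seq_continuous => u z uz; apply/hatN_cvg; split.
- exact: cvg_cont (@c1 z) uz.
- apply: (@cvg_clamp R (fun n => ext C f2 (u n) tt)).
  exact: cvg_coord (cvg_cont (@c2 z) uz).
- apply: (@cvg_clamp R (fun n => Num.max (ext C f3 (u n) tt) (delta C (u n)))).
  apply: cvg_maxr; first exact: cvg_coord (cvg_cont (@c3 z) uz).
  move/cvg_distP: uz => uz; apply/cvgR => eps /uz[N hN]; exists N => n /hN.
  by apply: le_lt_trans; exact: delta_lip.
Qed.

Definition hat_embedding : Z_embedding (hat A) :=
  ZEmbedding hat_AR (hat_in_embedding A) (hat_Z_set A).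

Local Notation rN := (rest hat_embedding).

Definition coords (p : rN) : prod_space (hatK X) I := set_val (set_val p).

Lemma coordsN (p : rN) : (coords p).2 <> I0.
Proof. by move=> /hat_in_range; exact: (set_valP p). Qed.

Lemma mkrest_proof1 (k : hatK X) (t : I) : t <> I0 -> nset A (k, t).
Proof. by right. Qed.

Lemma mkrest_proof2 (k : hatK X) (t : I) (t0 : t <> I0) :
  (~` range (hat_in (A := A))) (exist _ ((k, t) : prod_space (hatK X) I) (mem_set (mkrest_proof1 k t0))).
Proof. by move=> /hat_in_range. Qed.

Definition mkrest (k : hatK X) (t : I) (t0 : t <> I0) : rN :=
  exist _ (exist _ ((k, t) : prod_space (hatK X) I) (mem_set (mkrest_proof1 k t0)) : hatN A)
    (mem_set (@mkrest_proof2 k t t0)).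

Lemma coords_inj : injective coords.
Proof. by move=> p q h; apply: set_val_inj; apply: set_val_inj. Qed.

Lemma cvg_coords (u : nat -> rN) (p : rN) :
  set_val \o u ~> set_val p <->
  (fun n => (coords (u n)).1) ~> (coords p).1 /\ (fun n => (coords (u n)).2) ~> (coords p).2.
Proof.
apply: (iff_trans (@cvg_valP _ (nset A) (set_val \o u) (set_val p))).
exact: (@cvg_pairP (hatK X) I).
Qed.

End hat_retract.

Arguments coords {R X A} p.
Arguments coordsN {R X A} p _.

(** * Approaching maps between complements, in coordinates *)

Section rest_map.
Context {R : realType} (X Y : metrizable_space R) (A : set X) (B : set Y).
Local Notation I := (interval_space (R := R)).
Local Notation I0 := (I0 R).
Local Notation I1 := (I1 R).
Local Notation rX := (rest (hat_embedding A)).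
Local Notation rY := (rest (hat_embedding B)).

(** Keeping the time coordinate makes the values avoid the hat automatically, so a map of
    complements amounts to a family [G] indexed by positive times. *)
Definition restmap (G : hatK X -> I -> hatK Y) (p : rX) : rY :=
  @mkrest R Y B (G (coords p).1 (coords p).2) (coords p).2 (coordsN p).

Lemma coords_restmap G p :
  coords (restmap G p) = (G (coords p).1 (coords p).2, (coords p).2).
Proof. by []. Qed.

Lemma restmap_ext G G' : (forall k t, t <> I0 -> G k t = G' k t) -> restmap G = restmap G'.
Proof.
move=> GG; apply: functional_extensionality_dep => p; apply: coords_inj.
by rewrite !coords_restmap GG //; exact: coordsN.
Qed.

(* [G] is an approaching homotopy between maps of complements, with time [u]. *)
Definition good (G : I -> hatK X -> I -> hatK Y) : Prop :=
  (forall (k : nat -> hatK X) (t u : nat -> I) (k0 : hatK X) (t0 u0 : I),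
    k ~> k0 -> t ~> t0 -> u ~> u0 -> t0 <> I0 ->
    (fun n => G (u n) (k n) (t n)) ~> G u0 k0 t0) /\
  (forall (k : nat -> hatK X) (t u : nat -> I) (k0 : hatK X) (u0 : I),
    hset A k0 -> k ~> k0 -> t ~> I0 -> (forall n, t n <> I0) -> u ~> u0 ->
    exists (j : nat -> nat) (l : hatK Y),
      [/\ j @ \oo --> \oo, hset B l & (fun n => G (u (j n)) (k (j n)) (t (j n))) ~> l]).

Lemma good_homotopic G : good G ->
  approaching_homotopic R (restmap (G I0)) (restmap (G I1)).
Proof.
move=> [cG aG].
apply/(@seq_homotopyP R (hatN A) (hatN B) _ _ (restmap (G I0)) (restmap (G I1))).
exists (fun p u => restmap (G u) p); split=> //.
- move=> x u a s /(@cvg_coords R X A x a)[x1 x2] us.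
  have := @cvg_coords R Y B (fun n => restmap (G (u n)) (x n)) (restmap (G s) a).
  move=> h; apply h; split=> //=; apply: (cG _ _ u) => //; exact: coordsN.
- move=> x u a s /hat_in_range a0 /(@cvg_valP _ (nset A))/(@cvg_pairP (hatK X) I)[x1 x2] us.
  have Aa : hset A (set_val a).1 by case: (set_valP a).
  have x2' : (fun n => (coords (x n)).2) ~> I0 by rewrite -a0.
  have [j [l [jn Bl lG]]] := aG _ _ u _ s Aa x1 x2' (fun n => coordsN (x n)) us.
  have [b bl] := @set_val_ex _ (hset B) l Bl.
  exists j, (hat_in b); split=> //.
  apply/(@cvg_valP _ (nset B)); apply/(@cvg_pairP (hatK Y) I); split; last exact: cvg_subseq jn x2'.
  by rewrite hat_inE bl.
Qed.

Lemma restmap_approaching (G : hatK X -> I -> hatK Y) :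
  good (fun _ => G) -> approaching (restmap G).
Proof.
move=> [cG aG]; apply: (@approachingP R (hatN A) (hatN B)).
- move=> x a /(@cvg_coords R X A x a)[x1 x2].
  have := @cvg_coords R Y B (fun n => restmap G (x n)) (restmap G a).
  move=> h; apply h; split=> //=.
  by apply: (cG _ _ (fun=> I0) _ _ I0) => //; [exact: cvg_const|exact: coordsN].
- move=> x a /hat_in_range a0 /(@cvg_valP _ (nset A))/(@cvg_pairP (hatK X) I)[x1 x2].
  have Aa : hset A (set_val a).1 by case: (set_valP a).
  have x2' : (fun n => (coords (x n)).2) ~> I0 by rewrite -a0.
  have [j [l [jn Bl lG]]] :=
    aG _ _ (fun=> I0) _ I0 Aa x1 x2' (fun n => coordsN (x n)) (@cvg_const I I0).
  have [b bl] := @set_val_ex _ (hset B) l Bl.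
  exists j, (hat_in b); split=> //.
  apply/(@cvg_valP _ (nset B)); apply/(@cvg_pairP (hatK Y) I); split; last exact: cvg_subseq jn x2'.
  by rewrite hat_inE bl.
Qed.

Definition rest_am (G : hatK X -> I -> hatK Y) (gG : good (fun _ => G)) :
  approaching_map (hat_embedding A) (hat_embedding B) := ApproachingMap (restmap_approaching gG).

End rest_map.

Section pt.
Context {R : realType} (X : metrizable_space R) (A : set X).
Local Notation I := (interval_space (R := R)).
Local Notation I0 := (I0 R).
Local Notation I1 := (I1 R).
Local Notation iota := (@iota_ R X).
Local Notation E := (cube (R := R) X).

(* Up to level 1 the point of the cylinder over v; between levels 1 and 2 the
   copy of v at the top is contracted to 0, so that [pt v 2] forgets v. *)
Definition pt (v : E) (l : R) : hatK X := (uscale (clampI (2 - l)) v, clampI l).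

Lemma cvg_pt (v : nat -> E) (l : nat -> R) v0 (l0 : R) :
  v ~> v0 -> l ~> l0 -> (fun n => pt (v n) (l n)) ~> pt v0 l0.
Proof.
move=> vv ll; apply/(@cvg_pairP E I); split; last exact: cvg_clamp ll.
apply: cvg_uscale vv; apply: (@cvg_clamp R (fun n => 2 - l n)).
by apply: cvgB => //; exact: cvg_cst.
Qed.

Lemma clampI_ge1 (l : R) : 1 <= l -> clampI l = I1.
Proof.
by move=> l1; apply: ival_inj; rewrite clampIE (min_idPl l1) (max_idPr ler01).
Qed.

Lemma clampI_le0 (l : R) : l <= 0 -> clampI l = I0.
Proof.
move=> l0; apply: ival_inj; rewrite clampIE ival0; apply/max_idPl.
by rewrite ge_min l0 orbT.
Qed.

Lemma pt_ge2 (v : E) (l : R) : 2 <= l -> pt v l = (uzero X, I1).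
Proof.
move=> l2; rewrite /pt clampI_le0; last lra; rewrite clampI_ge1; last lra.
by congr pair; apply: ucube_eq => x /=; rewrite ival0 mul0r.
Qed.

Lemma pt_le1 (v : E) (l : R) : l <= 1 -> pt v l = (v, clampI l).
Proof. by move=> l1; rewrite /pt clampI_ge1 ?uscale1 //; lra. Qed.

(** No convergence of [v] is asked: at level 2 the cube coordinate has been contracted away. *)
Lemma cvg_pt_top (v : nat -> E) (l : nat -> R) v0 :
  l ~> (2 : R) -> (fun n => pt (v n) (l n)) ~> pt v0 2.
Proof.
move=> ll; rewrite (@pt_ge2 v0) //; apply/(@cvg_pairP E I); split; last first.
  by have := cvg_clamp ll; rewrite (@clampI_ge1 2) //; lra.
apply: cvg_uscale0; have := @cvg_clamp R (fun n => 2 - l n) 0; rewrite clampI0; apply.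
by rewrite -(subrr 2); apply: cvgB => //; exact: cvg_cst.
Qed.

Lemma hset_pt0 x : hset A (pt (iota x) 0).
Proof. by left; rewrite pt_le1 ?ler01 //= clampI0; split=> //; exists x. Qed.

Lemma hset_pt_ge1 (v : E) (l : R) : 1 <= l -> hset A (pt v l).
Proof. by right; right; rewrite /= clampI_ge1. Qed.

Lemma hset_ptA a (l : R) : A a -> hset A (pt (iota a) l).
Proof.
move=> Aa; have [l1|/ltW l1] := lerP l 1; last exact: hset_pt_ge1.
by rewrite pt_le1 //; right; left; exists a.
Qed.

Lemma hset_cases k : hset A k ->
  [\/ exists2 x, ~ A x & k = (iota x, I0), exists2 a, A a & k.1 = iota a | k.2 = I1].
Proof.
case: k => e s [[[x _ /= <-] /= ->]|[[a Aa /= <-]|/= ->]].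
- have [Ax|nA] := pselect (A x); first by constructor 2; exists x.
  by constructor 1; exists x.
- by constructor 2; exists a.
- by constructor 3.
Qed.

(** The clustering that an approaching map owes near the hat, for base points [v] and levels [l]. *)
Definition subl (v : nat -> E) (l : nat -> R) : Prop :=
  exists (j : nat -> nat) (p : hatK X),
    [/\ j @ \oo --> \oo, hset A p & (fun n => pt (v (j n)) (l (j n))) ~> p].

Lemma subl_lim v l v0 (l0 : R) : v ~> v0 -> l ~> l0 -> hset A (pt v0 l0) -> subl v l.
Proof. by move=> vv ll h; exists id, (pt v0 l0); split=> //; exact: cvg_pt. Qed.

Lemma subl_top v l : l ~> (2 : R) -> subl v l.
Proof.
move=> ll; exists id, (pt (v 0%N) 2); split=> //; first by apply: hset_pt_ge1; lra.
exact: cvg_pt_top.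
Qed.

Lemma subl_const2 v l : (forall n, l n = 2) -> subl v l.
Proof. by move=> h; apply: subl_top; rewrite (_ : l = fun=> 2); [exact: cvg_cst|exact/funext]. Qed.

Lemma subl_subseq v l (k : nat -> nat) :
  k @ \oo --> \oo -> subl (v \o k) (l \o k) -> subl v l.
Proof.
move=> kn [j [p [jn Ap h]]]; exists (k \o j), p; split=> //; exact: subseq_comp.
Qed.

(** Over a point of [A] every level belongs to the hat, so compactness of [0,2] supplies the limit
    level. *)
Lemma subl_A v l a : A a -> v ~> iota a -> (forall n, 0 <= l n <= 2) -> subl v l.
Proof.
move=> Aa va l02; have [k [r [kn lr _]]] := bounded_subseq l02.
apply: (subl_subseq kn); apply: subl_lim (cvg_subseq kn va) lr _; exact: hset_ptA.
Qed.

Lemma cvg_to2 (s l : nat -> R) : s ~> (1 : R) -> (forall n, 2 * Num.min 1 (s n) <= l n <= 2) ->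
  l ~> (2 : R).
Proof.
move=> /cvgR s1 h; apply/cvgR => e e0; have [|N hN] := s1 (e / 2); first by rewrite divr_gt0.
exists N => n /hN; have /andP := h n; rewrite !ltr_norml.
by case: (lerP 1 (s n)) => ? [] ? ? /andP[? ?]; apply/andP; split; lra.
Qed.

Definition rlerp (u : I) (a b : R) : R := (1 - ival u) * a + ival u * b.

Lemma cvg_rlerp (u : nat -> I) (a b : nat -> R) (u0 : I) (a0 b0 : R) :
  u ~> u0 -> a ~> a0 -> b ~> b0 -> (fun n => rlerp (u n) (a n) (b n)) ~> rlerp u0 a0 b0.
Proof.
move=> /cvg_ival uu aa bb; apply: cvgD; apply: cvgM => //.
by apply: cvgB => //; exact: cvg_cst.
Qed.

Lemma rlerp_itv u a b m M : m <= a <= M -> m <= b <= M -> m <= rlerp u a b <= M.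
Proof.
move=> /andP[a1 a2] /andP[b1 b2]; have /andP[u0 u1] := ival_itv u.
by rewrite /rlerp; apply/andP; split; nra.
Qed.

Lemma rlerp0 a b : rlerp I0 a b = a.
Proof. by rewrite /rlerp ival0; lra. Qed.

Lemma rlerp1 a b : rlerp I1 a b = b.
Proof. by rewrite /rlerp ival1; lra. Qed.

End pt.

(** * The partial inverse as a fine shape morphism *)

Section slices.
Context {R : realType} (S : metrizable_space R) (T : Type).
Local Notation I := (interval_space (R := R)).
Local Notation I0 := (I0 R).

Lemma slice_delta (C : set (prod_space S I)) z :
  (forall c, C c -> c.2 = I0) -> z.2 <> I0 -> 0 < delta C z.
Proof.
move=> C0 z0; apply: delta_gt0 => /(@closure_seq R)[w wC /(@cvg_pairP S I)[_ wz]].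
apply: z0; apply: (@cvg_inj R I (snd \o w)) => //.
apply: cvg_eq_near (@cvg_const I I0); exists 0%N => n _ /=.
by rewrite C0.
Qed.

End slices.

Section maps.
Context {R : realType} (X Y : metrizable_space R) (A : set X) (B : set Y).
Local Notation I := (interval_space (R := R)).
Local Notation I0 := (I0 R).
Local Notation I1 := (I1 R).
Local Notation EX := (cube (R := R) X).
Local Notation EY := (cube (R := R) Y).
Local Notation iX := (@iota_ R X).
Local Notation iY := (@iota_ R Y).

Context (f : X -> Y) (gi : Y -> EX).
Hypothesis cf : continuous f.
Hypothesis cB : closed B.
Hypothesis fA : forall a, A a -> B (f a).
Hypothesis g1 : forall y, ~ B y -> exists x, [/\ ~ A x, f x = y & gi y = iX x].
Hypothesis g2 : forall x, ~ A x -> ~ B (f x) /\ gi (f x) = iX x.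
Hypothesis g3 : forall (w : nat -> Y) y, (forall n, ~ B (w n)) -> ~ B y ->
  w ~> y -> gi \o w ~> gi y.
Hypothesis g4 : forall (w : nat -> Y) b, (forall n, ~ B (w n)) -> B b -> w ~> b ->
  exists (k : nat -> nat) (a : X), [/\ k @ \oo --> \oo, A a, f a = b & gi \o w \o k ~> iX a].

Definition CX : set (prod_space EX I) := [set z | exists x, z = (iX x, I0)].
Definition CY : set (prod_space EY I) := [set z | exists2 y, ~ B y & z = (iY y, I0)].

(** [CX] need not be closed, so [Fh] is controlled at positive times, which are off the closure of
    [CX], and in limits at points of [CX] along positive times or within [CX]. *)
Definition Fh : prod_space EX I -> EY := ext CX (fun z => on_iota (iY \o f) (uzero Y) z.1).
Definition Gh : prod_space EY I -> EX := ext CY (fun z => on_iota gi (uzero X) z.1).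

Lemma CX0 z : CX z -> z.2 = I0. Proof. by case=> x ->. Qed.
Lemma CY0 z : CY z -> z.2 = I0. Proof. by case=> x _ ->. Qed.

Lemma Fh_off (z : nat -> prod_space EX I) z0 : z0.2 <> I0 -> z ~> z0 -> Fh \o z ~> Fh z0.
Proof. by move=> h; apply: ext_cvg_off; apply: slice_delta h; exact: CX0. Qed.

Lemma Gh_off (z : nat -> prod_space EY I) z0 : z0.2 <> I0 -> z ~> z0 -> Gh \o z ~> Gh z0.
Proof. by move=> h; apply: ext_cvg_off; apply: slice_delta h; exact: CY0. Qed.

Lemma FhE x : Fh (iX x, I0) = iY (f x).
Proof. by rewrite /Fh extE ?on_iotaE //; exists x. Qed.

Lemma Fh_on (z : nat -> prod_space EX I) x :
  (forall n, (z n).2 <> I0 \/ CX (z n)) -> z ~> (iX x, I0) -> Fh \o z ~> iY (f x).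
Proof.
move=> hz zx; rewrite -FhE; apply: ext_cvg_on => //; first by exists x.
  move=> w wC /(@cvg_pairP EX I)[w1 _]; have /choice[x' hx] := wC.
  rewrite /comp [(_, _).1]/= on_iotaE.
  have -> : (fun n => on_iota (iY \o f) (uzero Y) (w n).1) = iY \o (f \o x').
    by apply/funext => n; rewrite hx on_iotaE.
  apply/cvg_iota; apply: (cvg_cont (@cf x)); apply/cvg_iota.
  by apply: cvg_eq_near w1; exists 0%N => n _ /=; rewrite hx.
move=> n; case: (hz n) => [h|]; last by left.
by right; apply: slice_delta h; exact: CX0.
Qed.

Lemma Gh_on (z : nat -> prod_space EY I) y : ~ B y ->
  (forall n, (z n).2 <> I0) -> z ~> (iY y, I0) -> Gh \o z ~> gi y.
Proof.
move=> nB hz zx; have Cy : CY (iY y, I0) by exists y.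
have <- : Gh (iY y, I0) = gi y by rewrite /Gh extE // on_iotaE.
apply: ext_cvg_on => //.
  move=> w wC /(@cvg_pairP EY I)[w1 _].
  have /choice[y' hy] n : exists y, ~ B y /\ w n = (iY y, I0) by have [y' ? ?] := wC n; exists y'.
  rewrite /comp [(_, _).1]/= on_iotaE.
  have -> : (fun n => on_iota gi (uzero X) (w n).1) = gi \o y'.
    by apply/funext => n; rewrite (hy n).2 on_iotaE.
  apply: g3 => // [n|]; first exact: (hy n).1.
  by apply/cvg_iota; apply: cvg_eq_near w1; exists 0%N => n _ /=; rewrite (hy n).2.
by move=> n; right; apply: slice_delta (hz n); exact: CY0.
Qed.

(* [kappa z] measures how far (z.1, Gh z) is from the graph of [gi]; [mm] vanishes
   exactly at B x 0. Their quotient [Rr] lifts the level of [q] to the top near those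
   points of B x 0 where [Gh] does not follow the inverse of f. *)
Definition kappa (z : prod_space EY I) : R :=
  tinf [set y | ~ B y] (fun y => dist z.1 (iY y) + dist (Gh z) (gi y)).
Definition beta (e : EY) : R := tinf B (fun b => dist e (iY b)).
Definition mm (z : prod_space EY I) : R := Num.max (beta z.1) (ival z.2).
Definition Rr (z : prod_space EY I) : R := Num.min 1 (kappa z / mm z).

Lemma kappa_ge0 z : 0 <= kappa z.
Proof. by apply: tinf_ge0 => c; rewrite addr_ge0 ?dist_ge0. Qed.

Lemma mm_gt0 z : z.2 <> I0 -> 0 < mm z.
Proof.
move=> z0; rewrite lt_max; apply/orP; right.
have /andP[h _] := ival_itv z.2; rewrite lt_neqAle h andbT eq_sym.
by apply/eqP => h0; apply: z0; apply: ival_inj; rewrite h0.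
Qed.

Lemma mm_le1 z : mm z <= 1.
Proof.
rewrite ge_max; have /andP[_ ->] := ival_itv z.2; rewrite andbT.
by apply: tinf_le1 => c; exact: dist_ge0.
Qed.

Lemma Rr_itv z : 0 <= Rr z <= 1.
Proof.
rewrite le_min ler01 ge_min lexx /= andbT divr_ge0 ?kappa_ge0 //.
by rewrite le_max; have /andP[-> _] := ival_itv z.2; rewrite orbT.
Qed.

Lemma cvg_beta (e : nat -> EY) e0 : e ~> e0 -> beta \o e ~> beta e0.
Proof.
move=> /cvg_distP ee; apply/cvgR => eps /ee[N hN]; exists N => n /hN.
apply: le_lt_trans; apply: tinf_diff => [c|c||c _]; rewrite ?dist_ge0 //=.
have := dist_triangle (e n) e0 (iY c); have := dist_triangle e0 (e n) (iY c).
by rewrite (dist_sym (e n) e0) ler_norml; lra.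
Qed.

Lemma cvg_mm (z : nat -> prod_space EY I) z0 : z ~> z0 -> mm \o z ~> mm z0.
Proof.
move=> /(@cvg_pairP EY I)[z1 /cvg_ival z2].
by apply: cvg_maxr; [exact: cvg_beta z1|].
Qed.

Lemma Rr_off (z : nat -> prod_space EY I) z0 : z0.2 <> I0 -> z ~> z0 -> Rr \o z ~> Rr z0.
Proof.
move=> h zz; apply: cvg_minr; first exact: cvg_cst.
have mz := cvg_mm zz.
apply: cvgM; last by apply: cvgV => //; rewrite gt_eqF // mm_gt0.
move/(@cvg_pairP EY I): (zz) => [/cvg_distP z1 _].
have /cvg_distP Gz := Gh_off h zz.
apply/cvgR => e e0; have e20 : 0 < e / 2 by rewrite divr_gt0.
have [N hN] := z1 _ e20; have [N' hN'] := Gz _ e20.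
exists (maxn N N') => n; rewrite geq_max => /andP[/hN h1 /hN' h2] /=.
apply: (@le_lt_trans _ _ (dist z0.1 (z n).1 + dist (Gh z0) (Gh (z n)))); last first.
  by rewrite (splitr e) ltrD.
apply: tinf_diff => [c|c||c _]; rewrite ?addr_ge0 ?dist_ge0 //.
have := dist_triangle (z n).1 z0.1 (iY c); have := dist_triangle z0.1 (z n).1 (iY c).
have := dist_triangle (Gh (z n)) (Gh z0) (gi c); have := dist_triangle (Gh z0) (Gh (z n)) (gi c).
rewrite (dist_sym (z n).1 z0.1) (dist_sym (Gh (z n)) (Gh z0)) ler_norml; lra.
Qed.

Lemma beta_gt0 y : ~ B y -> 0 < beta (iY y).
Proof.
move=> nB; rewrite ltNge; apply/negP => b0; apply: nB.
have /choice[w hw] n : exists b, B b /\ dist (iY y) (iY b) < n.+1%:R^-1.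
  have [|||b Bb yb] := @tinf_lt R Y B (fun b => dist (iY y) (iY b)) n.+1%:R^-1.
  - by move=> c; exact: dist_ge0.
  - by apply: le_lt_trans b0 _; rewrite invr_gt0.
  - by rewrite invf_le1 // ler1n.
  - by exists b.
apply: (closed_lim cB (fun n => (hw n).1)); apply/cvg_iota; apply/cvg_distP => e e0.
have [N hN] := ltr_invS e0; exists N => n /hN; exact: lt_trans (hw n).2.
Qed.

(** Over Y \ B the denominator [mm] stays positive since [B] is closed, and [kappa] tends to 0
    because [Gh] tends to the value of the inverse. So the level is not lifted there. *)
Lemma Rr_Y (z : nat -> prod_space EY I) y : ~ B y ->
  (forall n, (z n).2 <> I0) -> z ~> (iY y, I0) -> Rr \o z ~> (0 : R).
Proof.
move=> nB hz zy; have Gz := Gh_on nB hz zy.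
have m0 : 0 < mm (iY y, I0) by rewrite lt_max beta_gt0.
have zy1 : (fun n => (z n).1) ~> iY y by move/(@cvg_pairP EY I): zy => [].
have kz : kappa \o z ~> (0 : R).
  apply: (@cvg_squeeze0 _ _ (fun n => dist (iY y) (z n).1 + dist (gi y) (Gh (z n)))).
    move=> n; rewrite kappa_ge0 /= dist_sym (dist_sym (gi y)).
    by apply: (@tinf_le _ _ _ (fun y => dist (z n).1 (iY y) + dist (Gh (z n)) (gi y))) => // c;
      rewrite addr_ge0 ?dist_ge0.
  rewrite -(addr0 0); apply: cvgD.
    by rewrite -(distxx (iY y)); apply: dist_cvg => //; exact: cvg_const.
  by rewrite -(distxx (gi y)); apply: dist_cvg => //; exact: cvg_const.
have mn : mm (iY y, I0) != 0 by rewrite gt_eqF.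
have <- : Num.min 1 (0 / mm (iY y, I0)) = 0 by rewrite mul0r (min_idPr ler01).
apply: cvg_minr; first exact: cvg_cst.
by apply: cvgM => //; apply: cvgV => //; exact: cvg_mm.
Qed.

Lemma mm_B (z : nat -> prod_space EY I) b : B b -> z ~> (iY b, I0) -> mm \o z ~> (0 : R).
Proof.
move=> Bb /cvg_mm; suff -> : mm (iY b, I0) = 0 by [].
have b0 : beta (iY b) <= 0.
  by rewrite -(distxx (iY b)); apply: (@tinf_le _ _ _ (fun c => dist (iY b) (iY c))) => // c; exact: dist_ge0.
by rewrite /mm ival0; apply/max_idPr.
Qed.

(* Near B, either the level of [q] is 2 or, along a subsequence, [Gh] shadows
   values of the inverse of f, which cluster in A because f is closed. *)
Lemma Rr_B (z : nat -> prod_space EY I) b : B b ->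
  (forall n, (z n).2 <> I0) -> z ~> (iY b, I0) ->
  exists2 k : nat -> nat, k @ \oo --> \oo &
    (forall n, Rr (z (k n)) = 1) \/ (exists a, [/\ A a, f a = b & Gh \o z \o k ~> iX a]).
Proof.
move=> Bb hz zb; have [k kn [h|h]] := subseq_dichotomy (fun n => 1 <= kappa (z n) / mm (z n)).
  by exists k => //; left=> n; exact: min_idPl (h n).
(* Since [mm] tends to 0, points [y n] with small sum converge to [b], and [Gh] stays within [mm] of
   their inverse values. [mm] is at most 1, so the truncation in [kappa] does not interfere. *)
have km n : kappa (z (k n)) < mm (z (k n)).
  have /negP := h n; rewrite -ltNge ltr_pdivrMr ?mul1r //; exact: mm_gt0.
have /choice[y hy] n : exists y, ~ B y /\
    dist (z (k n)).1 (iY y) + dist (Gh (z (k n))) (gi y) < mm (z (k n)).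
  have [|y nB hy] := tinf_lt _ (km n) (mm_le1 _); last by exists y.
  by move=> c; rewrite addr_ge0 ?dist_ge0.
have mk := cvg_subseq kn (mm_B Bb zb).
have zb1 : (fun n => (z (k n)).1) ~> iY b.
  by move/(@cvg_pairP EY I): (cvg_subseq kn zb) => [].
have yb : y ~> b.
  apply/cvg_iota; apply: cvg_dist0 zb1 _; apply: cvg_squeeze0 mk => n /=.
  by rewrite dist_ge0 /= ltW //; apply: le_lt_trans (hy n).2; rewrite lerDl dist_ge0.
have [k' [a [kn' Aa fab ga]]] := g4 (fun n => (hy n).1) Bb yb.
exists (k \o k'); first exact: subseq_comp.
right; exists a; split=> //; apply: cvg_dist0 ga _.
apply: (@cvg_squeeze0 _ _ _ _ (cvg_subseq kn' mk)) => n /=.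
rewrite dist_ge0 /= ltW // dist_sym; apply: le_lt_trans (hy (k' n)).2.
by rewrite lerDr dist_ge0.
Qed.

Lemma max2_itv (a b : R) : 0 <= a <= 1 -> 0 <= b <= 1 -> 0 <= 2 * Num.max a b <= 2.
Proof. by move=> /andP[? ?] /andP[? ?]; case: (lerP a b) => ?; apply/andP; split; lra. Qed.

Lemma min2_itv (a : R) : 0 <= a -> 0 <= Num.min 1 a <= 1.
Proof. by move=> a0; rewrite le_min ler01 a0 ge_min lexx. Qed.

(** Doubling sends the top to level 2, where the base point is forgotten; [Fh] need not converge
    over arbitrary points of the top as time tends to 0. *)
Definition Gf (k : hatK X) (t : I) : hatK Y := pt (Fh (k.1, t)) (2 * ival k.2).
Definition Lq (k : hatK Y) (t : I) : R := 2 * Num.max (ival k.2) (Rr (k.1, t)).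
Definition Gq (k : hatK Y) (t : I) : hatK X := pt (Gh (k.1, t)) (Lq k t).

Lemma Lq_itv k t : 0 <= Lq k t <= 2.
Proof. exact: max2_itv (ival_itv _) (Rr_itv _). Qed.

Lemma Lq_ge k t : 2 * ival k.2 <= Lq k t.
Proof. by rewrite /Lq ler_pM2l // le_max lexx. Qed.

Section sequences.
Context (Z : metrizable_space R) (A0 : set Z).
Local Notation EZ := (cube (R := R) Z).
Context (k : nat -> hatK Z) (k0 : hatK Z) (t : nat -> I).
Hypothesis kk : k ~> k0.

Lemma hatK1 : (fun n => (k n).1) ~> k0.1.
Proof. by move/(@cvg_pairP EZ I): kk => []. Qed.

Lemma hatK2 : (fun n => ival (k n).2) ~> ival k0.2.
Proof. by apply/cvg_ival; move/(@cvg_pairP EZ I): kk => []. Qed.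

Lemma hatK1t (t0 : I) : t ~> t0 -> (fun n => ((k n).1, t n) : prod_space EZ I) ~> (k0.1, t0).
Proof. by move=> tt0; apply/(@cvg_pairP EZ I); split=> //; exact: hatK1. Qed.

Lemma hatK2_top : k0.2 = I1 -> (fun n => ival (k n).2) ~> (1 : R).
Proof. by move=> k1; have := hatK2; rewrite k1. Qed.

Lemma hatK2_0 : k0.2 = I0 -> (fun n => ival (k n).2) ~> (0 : R).
Proof. by move=> k1; have := hatK2; rewrite k1. Qed.

Lemma ival_le1 (s : I) : ival s <= 1. Proof. by have /andP[] := ival_itv s. Qed.

Lemma min1_ival (s : I) : Num.min 1 (ival s) = ival s.
Proof. by apply/min_idPr; exact: ival_le1. Qed.

End sequences.

(** Near a point of X \ A the level tends to 0 and the base to the image of that point; over [A] all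
    levels lie in the hat of [Y]; near the top the level tends to 2. *)
Lemma good_f : good A B (fun _ => Gf).
Proof.
split=> [k t u k0 t0 u0 kk tt0 _ t0n|k t u k0 u0 hk kk tt0 tn _].
  apply: cvg_pt.
    exact: (@Fh_off (fun n => ((k n).1, t n)) (k0.1, t0) t0n (hatK1t kk tt0)).
  by apply: cvgM; [exact: cvg_cst|exact: hatK2].
have zz := hatK1t kk tt0.
have on x : k0.1 = iX x -> (fun n => Fh ((k n).1, t n)) ~> iY (f x).
  move=> kx; rewrite kx in zz.
  by apply: (@Fh_on (fun n => ((k n).1, t n))) zz => n; left; exact: tn.
pose v := (fun n => Fh ((k n).1, t n)).
pose l := (fun n => 2 * ival (k n).2) : nat -> R.
have [[x nA k0x]|[a Aa k0a]|k01] := hset_cases hk.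
- apply: (@subl_lim R Y B v l _ 0).
  + by apply: on; rewrite k0x.
  + rewrite -(mulr0 2); apply: cvgM; first exact: cvg_cst.
    by apply: hatK2_0 kk _; rewrite k0x.
  + exact: hset_pt0.
- apply: (@subl_A R Y B v l _ (fA Aa)); first exact: on.
  by move=> n; have /andP[? ?] := ival_itv (k n).2; rewrite /l; lra.
- apply: (@subl_top R Y B v l).
  apply: cvg_to2 (hatK2_top kk k01) _ => n; rewrite min1_ival.
  by have /andP[? ?] := ival_itv (k n).2; rewrite /l; lra.
Qed.

Lemma cvg_Lq (k : nat -> hatK Y) (t : nat -> I) (k0 : hatK Y) (t0 : I) :
  k ~> k0 -> t ~> t0 -> t0 <> I0 -> (fun n => Lq (k n) (t n)) ~> Lq k0 t0.
Proof.
move=> kk tt0 t0n; apply: cvgM; first exact: cvg_cst.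
apply: cvg_maxr; first exact: hatK2 kk.
exact: (@Rr_off (fun n => ((k n).1, t n)) (k0.1, t0) t0n (hatK1t kk tt0)).
Qed.

Lemma Lq_top (k : nat -> hatK Y) (t : nat -> I) (k0 : hatK Y) :
  k ~> k0 -> k0.2 = I1 -> (fun n => Lq (k n) (t n)) ~> (2 : R).
Proof.
move=> kk k01; apply: cvg_to2 (hatK2_top kk k01) _ => n; rewrite min1_ival Lq_ge.
by have /andP[] := Lq_itv (k n) (t n).
Qed.

Lemma Lq_Y (k : nat -> hatK Y) (t : nat -> I) y : ~ B y ->
  k ~> (iY y, I0) -> t ~> I0 -> (forall n, t n <> I0) -> (fun n => Lq (k n) (t n)) ~> (0 : R).
Proof.
move=> nB kk tt0 tn; rewrite -(mulr0 2); apply: cvgM; first exact: cvg_cst.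
rewrite -(maxxx 0); apply: cvg_maxr; first exact: (hatK2_0 kk).
exact: (@Rr_Y (fun n => ((k n).1, t n)) _ nB tn (hatK1t kk tt0)).
Qed.

Lemma good_q : good B A (fun _ => Gq).
Proof.
split=> [k t u k0 t0 u0 kk tt0 _ t0n|k t u k0 u0 hk kk tt0 tn _].
  apply: cvg_pt; last exact: cvg_Lq.
  exact: (@Gh_off (fun n => ((k n).1, t n)) (k0.1, t0) t0n (hatK1t kk tt0)).
have zz := hatK1t kk tt0.
pose v := (fun n => Gh ((k n).1, t n)).
pose l := (fun n => Lq (k n) (t n)) : nat -> R.
have [[y nB k0y]|[b Bb k0b]|k01] := hset_cases hk.
- rewrite k0y in zz kk; have [x [_ _ gx]] := g1 nB.
  apply: (@subl_lim R X A v l _ 0).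
  + exact: (@Gh_on (fun n => ((k n).1, t n)) _ nB tn zz).
  + exact: Lq_Y nB kk tt0 tn.
  + by rewrite gx; exact: hset_pt0.
- rewrite k0b in zz.
  have [j jn [R1|[a [Aa _ Ga]]]] := @Rr_B (fun n => ((k n).1, t n)) _ Bb tn zz.
    apply: (@subl_subseq R X A v l _ jn); apply: subl_const2 => n; rewrite /comp /l.
    by rewrite /Lq R1 (max_idPr (ival_le1 _)) mulr1.
  apply: (@subl_subseq R X A v l _ jn).
  apply: (subl_A Aa Ga) => n; exact: Lq_itv.
- apply: (@subl_top R X A v l); exact: Lq_top k01.
Qed.

(** [F2] and [L1] below are the base point and the level of [Gf] after [Gq]: levels above 1 are
    truncated by [Gq] and then doubled by [Gf]. *)
Definition F2 (z : prod_space EY I) : EY := Fh (Gh z, z.2).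
Definition L1 (k : hatK Y) (t : I) : R := 2 * Num.min 1 (Lq k t).

Lemma F2_off (z : nat -> prod_space EY I) z0 : z0.2 <> I0 -> z ~> z0 -> F2 \o z ~> F2 z0.
Proof.
move=> h zz; apply: (@Fh_off (fun n => (Gh (z n), (z n).2)) (Gh z0, z0.2)) => //.
apply/(@cvg_pairP EX I); split; first exact: Gh_off h zz.
by move/(@cvg_pairP EY I): zz => [].
Qed.

Lemma F2_on (z : nat -> prod_space EY I) x : Gh \o z ~> iX x ->
  (forall n, (z n).2 <> I0) -> snd \o z ~> I0 -> F2 \o z ~> iY (f x).
Proof.
move=> Gx hz z2; apply: (@Fh_on (fun n => (Gh (z n), (z n).2))); first by left; exact: hz.
by apply/(@cvg_pairP EX I).
Qed.

Lemma L1_itv k t : 0 <= L1 k t <= 2.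
Proof.
have /andP[l0 _] := Lq_itv k t; have /andP[? ?] := min2_itv l0.
by apply/andP; split; rewrite /L1; lra.
Qed.

Lemma cvg_L1 (k : nat -> hatK Y) (t : nat -> I) (l : R) :
  (fun n => Lq (k n) (t n)) ~> l -> (fun n => L1 (k n) (t n)) ~> 2 * Num.min 1 l.
Proof.
by move=> h; apply: cvgM; [exact: cvg_cst|apply: cvg_minr => //; exact: cvg_cst].
Qed.

(** The base point moves along a segment from [F2] to its original place. Near B x 0 either the
    level is 2, or [Gh] tends to some a with f a = b; in the latter case [F2] tends to b and the
    segment shrinks to b. *)
Lemma good_fq1 : good B B (fun u k t => pt (ulerp u (F2 (k.1, t)) k.1) (L1 k t)).
Proof.
split=> [k t u k0 t0 u0 kk tt0 uu t0n|k t u k0 u0 hk kk tt0 tn uu].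
  apply: cvg_pt; last by apply: cvg_L1; exact: cvg_Lq.
  apply: cvg_ulerp => //; last exact: hatK1 kk.
  exact: (@F2_off (fun n => ((k n).1, t n)) (k0.1, t0) t0n (hatK1t kk tt0)).
have zz := hatK1t kk tt0.
have Fx y x (j : nat -> nat) : j @ \oo --> \oo -> k0.1 = iY y -> f x = y ->
    (fun n => Gh ((k (j n)).1, t (j n))) ~> iX x ->
    (fun n => ulerp (u (j n)) (F2 ((k (j n)).1, t (j n))) (k (j n)).1) ~> iY y.
  move=> jn k0y fx Gx; rewrite -(ulerpp u0 (iY y)); apply: cvg_ulerp.
  - exact: cvg_subseq jn uu.
  - rewrite -{1}fx; apply: (@F2_on (fun n => ((k (j n)).1, t (j n)))) => //.
      by move=> n; exact: tn.
    exact: cvg_subseq jn tt0.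
  - by have := cvg_subseq jn (hatK1 kk); rewrite k0y.
pose v := (fun n => ulerp (u n) (F2 ((k n).1, t n)) (k n).1).
pose l := (fun n => L1 (k n) (t n)) : nat -> R.
have [[y nB k0y]|[b Bb k0b]|k01] := hset_cases hk.
- rewrite k0y in zz kk; have [x [_ fx gx]] := g1 nB.
  apply: (@subl_lim R Y B v l (iY y) 0).
  + apply: (Fx y x id) => //; first by rewrite k0y.
    by rewrite -gx; exact: (@Gh_on (fun n => ((k n).1, t n)) _ nB tn zz).
  + by have := cvg_L1 (Lq_Y nB kk tt0 tn); rewrite (min_idPr ler01) mulr0.
  + exact: hset_pt0.
- rewrite k0b in zz.
  have [j jn [R1|[a [Aa fa Ga]]]] := @Rr_B (fun n => ((k n).1, t n)) _ Bb tn zz.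
    apply: (@subl_subseq R Y B v l _ jn); apply: subl_const2 => n; rewrite /comp /l.
    rewrite /L1 /Lq R1 (max_idPr (ival_le1 _)) mulr1 (min_idPl _) ?mulr1 //; lra.
  apply: (@subl_subseq R Y B v l _ jn).
  apply: (@subl_A R Y B _ _ b Bb); first exact: (Fx b a j).
  by move=> n; exact: L1_itv.
- apply: (@subl_top R Y B v l).
  have := cvg_L1 (@Lq_top k t k0 kk k01); rewrite (min_idPl _) ?mulr1 //; lra.
Qed.

(** With the original base point restored only the level is lowered. Over Y \ B both levels tend to
    0, over [B] all are allowed, and over the top the limit levels lie between 1 and 2. *)
Lemma good_fq2 : good B B (fun u k t => pt k.1 (rlerp u (L1 k t) (ival k.2))).
Proof.
split=> [k t u k0 t0 u0 kk tt0 uu t0n|k t u k0 u0 hk kk tt0 tn uu].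
  apply: cvg_pt; first exact: hatK1 kk.
  by apply: cvg_rlerp => //; [apply: cvg_L1; exact: cvg_Lq|exact: hatK2 kk].
have itv n : 0 <= rlerp (u n) (L1 (k n) (t n)) (ival (k n).2) <= 2.
  apply: rlerp_itv; first exact: L1_itv.
  by have /andP[? ?] := ival_itv (k n).2; lra.
pose v := (fun n => (k n).1).
pose l := (fun n => rlerp (u n) (L1 (k n) (t n)) (ival (k n).2)) : nat -> R.
have [[y nB k0y]|[b Bb k0b]|k01] := hset_cases hk.
- have k01 := hatK1 kk; rewrite k0y in kk k01.
  apply: (@subl_lim R Y B v l (iY y) 0) => //.
    have -> : 0 = rlerp u0 0 0 by rewrite /rlerp !mulr0 addr0.
    apply: cvg_rlerp => //; last exact: (hatK2_0 kk).
    by have := cvg_L1 (Lq_Y nB kk tt0 tn); rewrite (min_idPr ler01) mulr0.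
  exact: hset_pt0.
- by apply: (@subl_A R Y B v l b Bb _ itv); have := hatK1 kk; rewrite k0b.
- apply: (@subl_lim R Y B v l k0.1 (rlerp u0 2 1)).
  + exact: hatK1 kk.
  + apply: cvg_rlerp => //; last exact: hatK2_top kk k01.
    have := cvg_L1 (@Lq_top k t k0 kk k01); rewrite (min_idPl _) ?mulr1 //; lra.
  + apply: hset_pt_ge1; have /andP[? ?] := ival_itv u0; rewrite /rlerp; lra.
Qed.

(* Where [D3] is large, [G2] has moved far from the base point; raising the level
   to 2 there keeps the straight-line homotopy from [G2] to the identity approaching. *)
Definition G2 (z : prod_space EX I) : EX := Gh (Fh z, z.2).
Definition R2 (z : prod_space EX I) : R := Rr (Fh z, z.2).
Definition L2 (k : hatK X) (t : I) : R :=
  2 * Num.max (Num.min 1 (2 * ival k.2)) (R2 (k.1, t)).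
Definition D3 (z : prod_space EX I) : R := dist (G2 z) z.1 / mm (Fh z, z.2).
Definition L3 (k : hatK X) (t : I) : R := Num.min 2 (L2 k t + D3 (k.1, t)).

Lemma D3_ge0 z : z.2 <> I0 -> 0 <= D3 z.
Proof. by move=> h; rewrite divr_ge0 ?dist_ge0 // ltW // mm_gt0. Qed.

Lemma L2_itv k t : 0 <= L2 k t <= 2.
Proof.
apply: max2_itv (Rr_itv _); apply: min2_itv.
by have /andP[? _] := ival_itv k.2; rewrite mulr_ge0.
Qed.

Lemma L2_ge k t : 2 * Num.min 1 (ival k.2) <= L2 k t.
Proof.
have /andP[s0 s1] := ival_itv k.2.
by rewrite min1_ival /L2 ler_pM2l // le_max le_min s1 /=; apply/orP; left; lra.
Qed.

Lemma L3_ge k t : t <> I0 -> L2 k t <= L3 k t <= 2.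
Proof.
move=> tn; have /andP[_ l2] := L2_itv k t; have d0 := @D3_ge0 (k.1, t) tn.
by rewrite /L3 le_min l2 lerDl d0 ge_min lexx.
Qed.

Lemma L3_itv k t : t <> I0 -> 0 <= L3 k t <= 2.
Proof. by move=> /(L3_ge k) /andP[? ->]; have /andP[? _] := L2_itv k t; lra. Qed.

Section FhI.
Context (z : nat -> prod_space EX I).

Lemma FhI_off z0 : z0.2 <> I0 -> z ~> z0 ->
  (fun n => (Fh (z n), (z n).2) : prod_space EY I) ~> (Fh z0, z0.2).
Proof.
move=> h zz; apply/(@cvg_pairP EY I); split; first exact: Fh_off.
by move/(@cvg_pairP EX I): zz => [].
Qed.

Lemma FhI_on x : (forall n, (z n).2 <> I0) -> z ~> (iX x, I0) ->
  (fun n => (Fh (z n), (z n).2) : prod_space EY I) ~> (iY (f x), I0).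
Proof.
move=> hz zz; apply/(@cvg_pairP EY I); split; first by apply: Fh_on zz => n; left.
by move/(@cvg_pairP EX I): zz => [].
Qed.

Lemma G2_off z0 : z0.2 <> I0 -> z ~> z0 -> G2 \o z ~> G2 z0.
Proof. by move=> h zz; exact: (@Gh_off _ (Fh z0, z0.2) h (FhI_off h zz)). Qed.

Lemma D3_off z0 : z0.2 <> I0 -> z ~> z0 -> D3 \o z ~> D3 z0.
Proof.
move=> h zz; apply: cvgM.
  apply: dist_cvg; first exact: G2_off.
  by move/(@cvg_pairP EX I): zz => [].
by apply: cvgV; [rewrite gt_eqF // mm_gt0|exact: cvg_mm (FhI_off h zz)].
Qed.

Lemma G2_X x : ~ A x -> (forall n, (z n).2 <> I0) -> z ~> (iX x, I0) -> G2 \o z ~> iX x.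
Proof.
move=> /g2[nB gx] hz zz; rewrite -gx; exact: (@Gh_on (fun n => (Fh (z n), (z n).2)) _ nB hz (FhI_on hz zz)).
Qed.

Lemma R2_X x : ~ A x -> (forall n, (z n).2 <> I0) -> z ~> (iX x, I0) -> R2 \o z ~> (0 : R).
Proof.
move=> /g2[nB _] hz zz; exact: (@Rr_Y (fun n => (Fh (z n), (z n).2)) _ nB hz (FhI_on hz zz)).
Qed.

Lemma D3_X x : ~ A x -> (forall n, (z n).2 <> I0) -> z ~> (iX x, I0) -> D3 \o z ~> (0 : R).
Proof.
move=> nA hz zz; have [nB _] := g2 nA.
have mn : mm (iY (f x), I0) != 0 by rewrite gt_eqF // lt_max beta_gt0.
rewrite -(mul0r (mm (iY (f x), I0))^-1); apply: cvgM.
  rewrite -(distxx (iX x)); apply: dist_cvg; first exact: G2_X.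
  by move/(@cvg_pairP EX I): zz => [].
by apply: cvgV => //; exact: cvg_mm (FhI_on hz zz).
Qed.

End FhI.

Lemma cvg_L2 (k : nat -> hatK X) (t : nat -> I) (k0 : hatK X) (t0 : I) :
  k ~> k0 -> t ~> t0 -> t0 <> I0 -> (fun n => L2 (k n) (t n)) ~> L2 k0 t0.
Proof.
move=> kk tt0 t0n; apply: cvgM; first exact: cvg_cst.
apply: cvg_maxr.
  apply: cvg_minr; first exact: cvg_cst.
  by apply: cvgM; [exact: cvg_cst|exact: hatK2 kk].
exact: (@Rr_off _ (Fh (k0.1, t0), t0) t0n
  (@FhI_off (fun n => ((k n).1, t n)) (k0.1, t0) t0n (hatK1t kk tt0))).
Qed.

Lemma cvg_L3 (k : nat -> hatK X) (t : nat -> I) (k0 : hatK X) (t0 : I) :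
  k ~> k0 -> t ~> t0 -> t0 <> I0 -> (fun n => L3 (k n) (t n)) ~> L3 k0 t0.
Proof.
move=> kk tt0 t0n; apply: cvg_minr; first exact: cvg_cst.
apply: cvgD; first exact: cvg_L2.
exact: (@D3_off (fun n => ((k n).1, t n)) (k0.1, t0) t0n (hatK1t kk tt0)).
Qed.

Lemma L2_X (k : nat -> hatK X) (t : nat -> I) x : ~ A x ->
  k ~> (iX x, I0) -> t ~> I0 -> (forall n, t n <> I0) -> (fun n => L2 (k n) (t n)) ~> (0 : R).
Proof.
move=> nA kk tt0 tn; rewrite -(mulr0 2); apply: cvgM; first exact: cvg_cst.
have -> : 0 = Num.max (Num.min 1 (2 * 0)) 0 :> R.
  by rewrite mulr0 (min_idPr ler01) maxxx.
apply: cvg_maxr.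
  apply: cvg_minr; first exact: cvg_cst.
  by apply: cvgM; [exact: cvg_cst|exact: (hatK2_0 kk)].
exact: (@R2_X (fun n => ((k n).1, t n)) _ nA tn (hatK1t kk tt0)).
Qed.

Lemma L3_X (k : nat -> hatK X) (t : nat -> I) x : ~ A x ->
  k ~> (iX x, I0) -> t ~> I0 -> (forall n, t n <> I0) -> (fun n => L3 (k n) (t n)) ~> (0 : R).
Proof.
move=> nA kk tt0 tn.
have -> : 0 = Num.min 2 (0 + 0) :> R by rewrite addr0; apply/esym/min_idPr; lra.
apply: cvg_minr; first exact: cvg_cst.
apply: cvgD; first exact: L2_X nA kk tt0 tn.
exact: (@D3_X (fun n => ((k n).1, t n)) _ nA tn (hatK1t kk tt0)).
Qed.

Lemma L2_top (k : nat -> hatK X) (t : nat -> I) (k0 : hatK X) :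
  k ~> k0 -> k0.2 = I1 -> (fun n => L2 (k n) (t n)) ~> (2 : R).
Proof.
move=> kk k01; apply: cvg_to2 (hatK2_top kk k01) _ => n.
by rewrite L2_ge; have /andP[] := L2_itv (k n) (t n).
Qed.

Lemma L3_top (k : nat -> hatK X) (t : nat -> I) (k0 : hatK X) : (forall n, t n <> I0) ->
  k ~> k0 -> k0.2 = I1 -> (fun n => L3 (k n) (t n)) ~> (2 : R).
Proof.
move=> tn kk k01; apply: cvg_to2 (hatK2_top kk k01) _ => n.
by have /andP[l2 ->] := L3_ge (k n) (tn n); rewrite (le_trans (L2_ge _ _) l2).
Qed.

(** This composite needs a stage more than the other. [Gh] may tend to a point a' of [A] that
    differs from a although f a' = f a, and the segment between the two need not stay in the hat.
    Raising the level to [L3] beforehand takes such sequences to the top. *)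
Lemma good_qf1 : good A A (fun u k t => pt (G2 (k.1, t)) (rlerp u (L2 k t) (L3 k t))).
Proof.
split=> [k t u k0 t0 u0 kk tt0 uu t0n|k t u k0 u0 hk kk tt0 tn uu].
  apply: cvg_pt.
    exact: (@G2_off (fun n => ((k n).1, t n)) (k0.1, t0) t0n (hatK1t kk tt0)).
  by apply: cvg_rlerp => //; [exact: cvg_L2|exact: cvg_L3].
have zz := hatK1t kk tt0.
have itv n : 0 <= rlerp (u n) (L2 (k n) (t n)) (L3 (k n) (t n)) <= 2.
  by apply: rlerp_itv; [exact: L2_itv|exact: L3_itv].
pose v := (fun n => G2 ((k n).1, t n)).
pose l := (fun n => rlerp (u n) (L2 (k n) (t n)) (L3 (k n) (t n))) : nat -> R.
have [[x nA k0x]|[a Aa k0a]|k01] := hset_cases hk.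
- rewrite k0x in kk zz.
  apply: (@subl_lim R X A v l (iX x) 0).
  + exact: (@G2_X (fun n => ((k n).1, t n)) _ nA tn zz).
  + have -> : 0 = rlerp u0 0 0 by rewrite /rlerp !mulr0 addr0.
    by apply: cvg_rlerp => //; [exact: L2_X nA kk tt0 tn|exact: L3_X nA kk tt0 tn].
  + exact: hset_pt0.
- rewrite k0a in zz; have zzF := @FhI_on (fun n => ((k n).1, t n)) _ tn zz.
  have [j jn [R1|[a' [Aa' _ Ga]]]] :=
    @Rr_B (fun n => (Fh ((k n).1, t n), t n)) _ (fA Aa) tn zzF.
    apply: (@subl_subseq R X A v l _ jn); apply: subl_const2 => n; rewrite /comp /l.
    have E2 : L2 (k (j n)) (t (j n)) = 2.
      by rewrite /L2 /R2 R1 (max_idPr _) ?mulr1 // ge_min lexx.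
    have /andP[] := L3_ge (k (j n)) (tn (j n)); rewrite E2 => l2 l2'.
    have -> : L3 (k (j n)) (t (j n)) = 2 by apply/eqP; rewrite eq_le l2 l2'.
    by rewrite /rlerp; ring.
  apply: (@subl_subseq R X A v l _ jn).
  exact: (@subl_A R X A (v \o j) (l \o j) a' Aa' Ga (fun n => itv (j n))).
- apply: (@subl_top R X A v l).
  have -> : 2 = rlerp u0 2 2 by rewrite /rlerp; ring.
  by apply: cvg_rlerp => //; [exact: L2_top k01|exact: L3_top k01].
Qed.

Lemma good_qf2 : good A A (fun u k t => pt (ulerp u (G2 (k.1, t)) k.1) (L3 k t)).
Proof.
split=> [k t u k0 t0 u0 kk tt0 uu t0n|k t u k0 u0 hk kk tt0 tn uu].
  apply: cvg_pt; last exact: cvg_L3.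
  apply: cvg_ulerp => //; last exact: hatK1 kk.
  exact: (@G2_off (fun n => ((k n).1, t n)) (k0.1, t0) t0n (hatK1t kk tt0)).
have zz := hatK1t kk tt0; have k1 := hatK1 kk.
pose v := (fun n => ulerp (u n) (G2 ((k n).1, t n)) (k n).1).
pose l := (fun n => L3 (k n) (t n)) : nat -> R.
have [[x nA k0x]|[a Aa k0a]|k01] := hset_cases hk.
- rewrite k0x in kk zz k1.
  apply: (@subl_lim R X A v l (iX x) 0).
  + rewrite -(ulerpp u0 (iX x)); apply: cvg_ulerp => //.
    exact: (@G2_X (fun n => ((k n).1, t n)) _ nA tn zz).
  + exact: L3_X nA kk tt0 tn.
  + exact: hset_pt0.
- rewrite k0a in zz k1; have zzF := @FhI_on (fun n => ((k n).1, t n)) _ tn zz.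
  (* Either the level is 2 along a subsequence, or [D3] is below 2 there; then [G2] is within 2 [mm]
     of the base point, which tends to 0. *)
  have [j jn [h|h]] := subseq_dichotomy (fun n => 2 <= L2 (k n) (t n) + D3 ((k n).1, t n)).
    by apply: (@subl_subseq R X A v l _ jn); apply: subl_const2 => n; rewrite /comp /l; apply/min_idPl; exact: h.
  have k1j := cvg_subseq jn k1.
  have Ga : (fun n => G2 ((k (j n)).1, t (j n))) ~> iX a.
    apply: cvg_dist0 k1j _.
    have m2 : (fun n => 2 * mm (Fh ((k (j n)).1, t (j n)), t (j n))) ~> (0 : R).
      rewrite -(mulr0 2); apply: cvgM; first exact: cvg_cst.
      exact: cvg_subseq jn (mm_B (fA Aa) zzF).
    apply: cvg_squeeze0 m2 => n /=; rewrite dist_ge0 /= dist_sym.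
    have m0 := @mm_gt0 (Fh ((k (j n)).1, t (j n)), t (j n)) (tn (j n)).
    rewrite -ler_pdivrMr //.
    have /negP := h n; rewrite -ltNge.
    by have /andP[? _] := L2_itv (k (j n)) (t (j n)); rewrite /D3 /=; lra.
  apply: (@subl_subseq R X A v l _ jn).
  apply: (@subl_A R X A _ _ a Aa); last by move=> n; exact: L3_itv (tn (j n)).
  rewrite -(ulerpp u0 (iX a)); apply: cvg_ulerp => //.
  exact: cvg_subseq jn uu.
- apply: (@subl_top R X A v l); exact: L3_top k01.
Qed.

Lemma good_qf3 : good A A (fun u k t => pt k.1 (rlerp u (L3 k t) (ival k.2))).
Proof.
split=> [k t u k0 t0 u0 kk tt0 uu t0n|k t u k0 u0 hk kk tt0 tn uu].
  apply: cvg_pt; first exact: hatK1 kk.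
  by apply: cvg_rlerp => //; [exact: cvg_L3|exact: hatK2 kk].
have itv n : 0 <= rlerp (u n) (L3 (k n) (t n)) (ival (k n).2) <= 2.
  apply: rlerp_itv; first exact: L3_itv.
  by have /andP[? ?] := ival_itv (k n).2; lra.
have k1 := hatK1 kk.
pose v := (fun n => (k n).1).
pose l := (fun n => rlerp (u n) (L3 (k n) (t n)) (ival (k n).2)) : nat -> R.
have [[x nA k0x]|[a Aa k0a]|k01] := hset_cases hk.
- rewrite k0x in kk k1.
  apply: (@subl_lim R X A v l (iX x) 0) => //.
    have -> : 0 = rlerp u0 0 0 by rewrite /rlerp !mulr0 addr0.
    by apply: cvg_rlerp => //; [exact: L3_X nA kk tt0 tn|exact: (hatK2_0 kk)].
  exact: hset_pt0.
- by apply: (@subl_A R X A v l a Aa _ itv); rewrite -k0a.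
- apply: (@subl_lim R X A v l k0.1 (rlerp u0 2 1)) => //.
    by apply: cvg_rlerp => //; [exact: L3_top k01|exact: hatK2_top kk k01].
  by apply: hset_pt_ge1; have /andP[? ?] := ival_itv u0; rewrite /rlerp; lra.
Qed.

End maps.

Section partial_inverse.
Context {R : realType} (P Q : closed_pair R) (f : pair_map P Q).
Hypothesis cf : closed_map f.
Hypothesis hf : restricts_to_homeomorphism f.
Local Notation A := (cp_sub P).
Local Notation B := (cp_sub Q).

(* The clustering property of the inverse is exactly closedness of f. *)
Lemma partial_inverse : exists gi : Q -> cube (R := R) P,
  [/\ forall y, ~ B y -> exists x, [/\ ~ A x, f x = y & gi y = iota_ x],
      forall x, ~ A x -> ~ B (f x) /\ gi (f x) = iota_ x,
      forall (w : nat -> Q) y, (forall n, ~ B (w n)) -> ~ B y -> w ~> y -> gi \o w ~> gi y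
    & forall (w : nat -> Q) b, (forall n, ~ B (w n)) -> B b -> w ~> b ->
        exists (k : nat -> nat) (a : P),
          [/\ k @ \oo --> \oo, A a, f a = b & gi \o w \o k ~> iota_ a]].
Proof.
have [g [gE [_ [g' [cg' gK g'K]]]]] := hf.
pose gi (y : Q) : cube (R := R) P :=
  if pselect (~ B y) is left h then iota_ (set_val (g' (exist _ y (mem_set h)))) else uzero P.
have giE (y : (~` B : set Q)) : gi (set_val y) = iota_ (set_val (g' y)).
  rewrite /gi; case: pselect => [h|[]]; last exact: (set_valP y).
  by do 3 f_equal; exact: set_val_inj.
have G1 y : ~ B y -> exists x, [/\ ~ A x, f x = y & gi y = iota_ x].
  move=> /(@set_val_ex _ (~` B))[z <-]; exists (set_val (g' z)).
  by rewrite -gE g'K giE; split=> //; exact: (set_valP (g' z)).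
have G2 x : ~ A x -> ~ B (f x) /\ gi (f x) = iota_ x.
  move=> /(@set_val_ex _ (~` A))[z <-]; rewrite -gE giE gK; split=> //.
  exact: (set_valP (g z)).
exists gi; split=> //.
- move=> w y nBw /(@set_val_ex _ (~` B))[z zy] wy.
  have /choice[w' hw] n := @set_val_ex _ (~` B) (w n) (nBw n).
  have -> : gi \o w = iota_ \o (set_val \o (g' \o w')).
    by apply/funext => n; rewrite /comp -hw giE.
  rewrite -zy giE; apply/cvg_iota; apply: (cvg_cont (@set_val_continuous _ _ (g' z))).
  apply: (cvg_cont (cg' z)); apply/cvg_valP; rewrite zy.
  by apply: cvg_eq_near wy; exists 0%N => n _ /=.
- move=> w b nBw Bb wb.
  have /choice[v hv] n := G1 (w n) (nBw n).
  have vf n : f (v n) = w n by case: (hv n).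
  have gv : gi \o w = iota_ \o v by apply/funext => n; case: (hv n).
  pose C : set P := range v.
  (* If the set of all [v n] were closed, its image would be closed and would contain the limit [b];
     but the image consists of the [w n], none of which lies in [B]. *)
  have [a clC nC] : exists2 a, closure C a & ~ C a.
    apply: contrapT => h; have cC : closed C.
      by move=> a ca; apply: contrapT => na; apply: h; exists a.
    have : (f @` C) b.
      apply: (closed_lim (cf cC) (u := w)) => // n.
      by exists (v n) => //; exists n.
    by move=> [_ [n _ <-]]; rewrite vf => wnb; apply: (nBw n); rewrite wnb.
  (* [a] is none of the [v i], hence at positive distance from every initial segment; its
     neighbourhoods therefore meet the sequence at arbitrarily late indices. *)
  have ge_dist N : exists2 r, 0 < r & forall i, (i < N)%N -> r <= dist a (v i).
    elim: N => [|N [r r0 hr]]; first by exists 1.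
    exists (Num.min r (dist a (v N))).
      rewrite lt_min r0 /= lt_neqAle dist_ge0 andbT eq_sym; apply/eqP => /dist0_eq av.
      by apply: nC; exists N.
    move=> i; rewrite ltnS leq_eqVlt => /orP[/eqP ->|/hr h]; first by rewrite ge_min lexx orbT.
    by apply: le_trans h; rewrite ge_min lexx.
  have va : cluster (v @ \oo) a.
    move=> U V [N _ hN] /nbhs_dist[e e0 eV]; have [r r0 hr] := ge_dist N.
    have m0 : 0 < Num.min e r by rewrite lt_min e0.
    have [|_ [[n _ <-] /= nv]] := clC [set y | dist a y < Num.min e r].
      by apply/nbhs_dist; exists (Num.min e r).
    exists (v n); split; last by apply: eV; apply: lt_le_trans nv _; rewrite ge_min lexx.
    apply: hN => /=; rewrite leqNgt; apply/negP => /hr; rewrite leNgt => /negP; apply.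
    by apply: lt_le_trans nv _; rewrite ge_min lexx orbT.
  have [k kn vk] := cluster_subseq va.
  have fab : f a = b.
    apply: (@cvg_inj R Q (f \o v \o k)); first exact: cvg_cont (@cts_fun _ _ f a) vk.
    by rewrite (_ : f \o v = w); [exact: cvg_subseq kn wb|apply/funext => n; rewrite /comp vf].
  exists k, a; split=> //; last by rewrite gv; apply/cvg_iota.
  (* Outside [A] the values of [f] lie outside [B], whereas [b] is in [B]. *)
  by apply: contrapT => /G2[]; rewrite fab.
Qed.

End partial_inverse.

(** * The map of hats and its inverse in fine shape *)

Section hat_map.
Context {R : realType} (X Y : metrizable_space R) (A : set X) (B : set Y).
Local Notation I := (interval_space (R := R)).
Local Notation I0 := (I0 R).
Local Notation I1 := (I1 R).

Context (f : X -> Y).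
Hypothesis cf : continuous f.
Hypothesis fA : forall a, A a -> B (f a).

Lemma hset_Gf k : hset A k -> hset B (Gf f k I0).
Proof.
move=> /hset_cases[[x _ ->]|[a Aa ka]|k1].
- by rewrite /Gf FhE [ival _]/= mulr0; exact: hset_pt0.
- by rewrite /Gf ka FhE; apply: hset_ptA; exact: fA.
- by apply: hset_pt_ge1; rewrite k1 ival1; lra.
Qed.

Lemma hat_map_proof (k : hat A) : hset B (Gf f (set_val k) I0).
Proof. apply: hset_Gf; exact: (set_valP k). Qed.

Definition hat_map_fun (k : hat A) : hat B :=
  exist _ (Gf f (set_val k) I0) (mem_set (hat_map_proof k)).

Lemma hatN_map_proof (p : hatN A) : nset B (Gf f (set_val p).1 (set_val p).2, (set_val p).2).
Proof.
have [p0|p0] := pselect ((set_val p).2 = I0); last by right.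
left; rewrite /= p0; apply: hset_Gf; by case: (set_valP p).
Qed.

Definition hatN_map (p : hatN A) : hatN B :=
  exist _ ((Gf f (set_val p).1 (set_val p).2, (set_val p).2) : prod_space (hatK Y) I)
    (mem_set (hatN_map_proof p)).

(** At positive time [Fh] is continuous. At time 0 the level tends to 2 over the top, where the base
    point does not matter, and below the top [Fh_on] applies. *)
Lemma hatN_map_continuous : continuous hatN_map.
Proof.
apply: seq_continuous => u p /(@cvg_valP _ (nset A))/(@cvg_pairP (hatK X) I)[kk tt0].
apply/(@cvg_valP _ (nset B)); apply/(@cvg_pairP (hatK Y) I); split=> //.
have ll : (fun n => 2 * ival (set_val (u n)).1.2) ~> 2 * ival (set_val p).1.2.
  by apply: cvgM; [exact: cvg_cst|exact: hatK2 kk].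
have zz := hatK1t kk tt0.
have [p0|pn] := pselect ((set_val p).2 = I0); last first.
  apply: cvg_pt ll.
  exact: (@Fh_off R X Y f (fun n => ((set_val (u n)).1.1, (set_val (u n)).2))
    ((set_val p).1.1, (set_val p).2) pn zz).
have hp : hset A (set_val p).1 by case: (set_valP p).
have [k1|kn1] := pselect ((set_val p).1.2 = I1).
  have -> : (set_val (hatN_map p)).1 = pt (Fh f ((set_val p).1.1, (set_val p).2)) 2.
    by rewrite /= /Gf k1 ival1 mulr1.
  by apply: cvg_pt_top; move: ll; rewrite k1 ival1 mulr1.
have [x kx] : exists x, (set_val p).1.1 = iota_ x.
  by case: hp => [[[x _ <-]]|[[x _ <-]|]] //; exists x.
apply: cvg_pt ll; rewrite p0 kx FhE.
have s1 : ival (set_val p).1.2 < 1.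
  have /andP[_ h] := ival_itv (set_val p).1.2; rewrite lt_neqAle h andbT.
  by apply/eqP => e1; apply: kn1; apply: ival_inj; rewrite e1.
(* From here on the levels are below 1; a term at time 0 and level 1 could have any cube coordinate,
   and [Fh] is not controlled there. *)
have [|N hN] := (cvgR _ _).1 (hatK2 kk) (1 - ival (set_val p).1.2); first lra.
apply: (@cvg_tail _ _ _ N).
rewrite p0 kx in zz.
apply: (@Fh_on R X Y f cf (fun n => ((set_val (u (n + N)%N)).1.1, (set_val (u (n + N)%N)).2))).
  move=> n; have [t0|tn] := pselect ((set_val (u (n + N)%N)).2 = I0); last by left.
  right; have hu : hset A (set_val (u (n + N)%N)).1 by case: (set_valP (u (n + N)%N)).
  have := hN (n + N)%N (leq_addl _ _); rewrite ltr_norml => /andP[us _].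
  case: hu => [[[x' _ ex] _]|[[x' _ ex]|e1]].
  - by exists x'; rewrite ex t0.
  - by exists x'; rewrite ex t0.
  - by move: us; rewrite /= e1 ival1; lra.
exact: (cvg_subseq (@shift_subseq N) zz).
Qed.

Lemma hat_map_continuous : continuous hat_map_fun.
Proof.
apply: seq_continuous => u k uk; apply/(@cvg_valP _ (hset B)).
have [ci _ _] := hat_in_embedding A.
have := cvg_cont (@hatN_map_continuous (hat_in k)) (cvg_cont (@ci k) uk).
by move=> /(@cvg_valP _ (nset B))/(@cvg_pairP (hatK Y) I)[].
Qed.

Definition hat_map : continuousType (hat A) (hat B) := ctsmap hat_map_continuous.

Context (gi : Y -> cube (R := R) X).
Hypothesis cB : closed B.
Hypothesis g1 : forall y, ~ B y -> exists x, [/\ ~ A x, f x = y & gi y = iota_ x].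
Hypothesis g2 : forall x, ~ A x -> ~ B (f x) /\ gi (f x) = iota_ x.
Hypothesis g3 : forall (w : nat -> Y) y, (forall n, ~ B (w n)) -> ~ B y ->
  w ~> y -> gi \o w ~> gi y.
Hypothesis g4 : forall (w : nat -> Y) b, (forall n, ~ B (w n)) -> B b -> w ~> b ->
  exists (k : nat -> nat) (a : X), [/\ k @ \oo --> \oo, A a, f a = b & gi \o w \o k ~> iota_ a].

Let Phi := rest_am (good_f cf fA).
Let Psi := rest_am (good_q cB g1 g3 g4).

Lemma Phi_combines : combines hat_map Phi.
Proof.
exists hatN_map; split; first exact: hatN_map_continuous.
  by move=> k; apply: set_val_inj.
by move=> p; apply: set_val_inj.
Qed.

Lemma restmap_id : restmap (A := A) A (fun k _ => k) = id.
Proof.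
apply: functional_extensionality_dep => p; apply: coords_inj.
by rewrite coords_restmap; case: (coords p).
Qed.

Lemma pt_self (Z : metrizable_space R) (k : hatK Z) : pt k.1 (ival k.2) = k.
Proof. by rewrite pt_le1 ?ival_le1 // ivalK; case: k. Qed.

(** If the doubled level exceeds 1, [Gf] has reached the top and [Gq] continues to level 2, as [L2]
    does; at level 2 the base points on the two sides no longer matter. *)
Lemma Gq_Gf k t : Gq B gi (Gf f k t) t = pt (G2 B f gi (k.1, t)) (L2 B f gi k t).
Proof.
have /andP[s0 s1] := ival_itv k.2.
rewrite /Gf; have [h|h] := lerP (2 * ival k.2) 1.
  rewrite pt_le1 // /Gq /Lq /L2 [(_, _).2]/= clampIK ?h ?mulr_ge0 //.
  by rewrite (min_idPr h).
have -> : L2 B f gi k t = 2.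
  by rewrite /L2 (min_idPl (ltW h)) (max_idPl _) ?mulr1 //; have /andP[] := Rr_itv B gi (Fh f (k.1, t), t).
rewrite /Gq pt_ge2 ?[RHS]pt_ge2 // /Lq [(pt _ _).2]/= (clampI_ge1 (ltW h)) ival1.
have /andP[_ h1] := Rr_itv B gi ((pt (Fh f (k.1, t)) (2 * ival k.2)).1, t).
by rewrite (max_idPl h1) mulr1.
Qed.

Lemma Gf_Gq k t : Gf f (Gq B gi k t) t = pt (F2 B f gi (k.1, t)) (L1 B gi k t).
Proof.
have /andP[s0 s1] := Lq_itv B gi k t.
rewrite /Gq; have [h|h] := lerP (Lq B gi k t) 1.
  by rewrite pt_le1 // /Gf /L1 [(_, _).2]/= clampIK ?h ?s0 // (min_idPr h).
rewrite /Gf pt_ge2 ?[RHS]pt_ge2 //; first by rewrite /L1 (min_idPl (ltW h)) mulr1.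
by rewrite [(pt _ _).2]/= (clampI_ge1 (ltW h)) ival1 mulr1.
Qed.

(** Three homotopies are joined: the level rises to [L3], the base point moves back along a segment,
    the level sinks to the original one. [e0] to [e3] match the endpoints. *)
Lemma Psi_Phi : fs_mor_of (am_comp Psi Phi) = fs_mor_of (am_id (hat_embedding A)).
Proof.
apply: fs_mor_of_homotopic.
have h1 := good_homotopic (good_qf1 cf cB fA g2 g3 g4).
have h2 := good_homotopic (good_qf2 cf cB fA g2 g3).
have h3 := good_homotopic (good_qf3 cf cB g2 g3).
have e0 : restmap (A := A) A (fun k t => pt (G2 B f gi (k.1, t))
    (rlerp I0 (L2 B f gi k t) (L3 B f gi k t))) = (am_comp Psi Phi : rest (hat_embedding A) -> _).
  transitivity (restmap (A := A) A (fun k t => Gq B gi (Gf f k t) t)).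
    by apply: restmap_ext => k t _; rewrite rlerp0 Gq_Gf.
  by apply: functional_extensionality_dep => p; apply: coords_inj.
have e1 : restmap (A := A) A (fun k t => pt (ulerp I0 (G2 B f gi (k.1, t)) k.1) (L3 B f gi k t)) =
    restmap (A := A) A (fun k t => pt (G2 B f gi (k.1, t)) (rlerp I1 (L2 B f gi k t) (L3 B f gi k t))).
  by apply: restmap_ext => k t _; rewrite ulerp0 rlerp1.
have e2 : restmap (A := A) A (fun k t => pt k.1 (rlerp I0 (L3 B f gi k t) (ival k.2))) =
    restmap (A := A) A (fun k t => pt (ulerp I1 (G2 B f gi (k.1, t)) k.1) (L3 B f gi k t)).
  by apply: restmap_ext => k t _; rewrite ulerp1 rlerp0.
have e3 : restmap (A := A) A (fun k t => pt k.1 (rlerp I1 (L3 B f gi k t) (ival k.2))) = id.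
  by rewrite -restmap_id; apply: restmap_ext => k t _; rewrite rlerp1 pt_self.
rewrite -e0; rewrite e1 in h2; rewrite e2 e3 in h3.
apply: (@approaching_homotopic_trans R (hatN A) (hatN A) _ _ _ _ _ h1).
exact: (@approaching_homotopic_trans R (hatN A) (hatN A) _ _ _ _ _ h2).
Qed.

Lemma Phi_Psi : fs_mor_of (am_comp Phi Psi) = fs_mor_of (am_id (hat_embedding B)).
Proof.
apply: fs_mor_of_homotopic.
have h1 := good_homotopic (good_fq1 cf cB g1 g3 g4).
have h2 := good_homotopic (good_fq2 cB g3).
have e0 : restmap (A := B) B (fun k t => pt (ulerp I0 (F2 B f gi (k.1, t)) k.1) (L1 B gi k t)) =
    (am_comp Phi Psi : rest (hat_embedding B) -> _).
  transitivity (restmap (A := B) B (fun k t => Gf f (Gq B gi k t) t)).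
    by apply: restmap_ext => k t _; rewrite ulerp0 Gf_Gq.
  by apply: functional_extensionality_dep => p; apply: coords_inj.
have e1 : restmap (A := B) B (fun k t => pt k.1 (rlerp I0 (L1 B gi k t) (ival k.2))) =
    restmap (A := B) B (fun k t => pt (ulerp I1 (F2 B f gi (k.1, t)) k.1) (L1 B gi k t)).
  by apply: restmap_ext => k t _; rewrite ulerp1 rlerp0.
have e2 : restmap (A := B) B (fun k t => pt k.1 (rlerp I1 (L1 B gi k t) (ival k.2))) = id.
  apply: functional_extensionality_dep => p; apply: coords_inj.
  by rewrite coords_restmap rlerp1 pt_self; case: (coords p).
rewrite -e0; rewrite e1 e2 in h2.
exact: (@approaching_homotopic_trans R (hatN B) (hatN B) _ _ _ _ _ h1).
Qed.

Lemma hat_map_iso (C : hcat R)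
    (F : forall X Y, fs_mor X Y -> hmor C (single X) (single Y)) :
  is_fs_functor F -> is_iso (hm C (single_map hat_map)).
Proof.
move=> [F1 F2 F3].
have <- : F _ _ (fs_mor_of Phi) = hm C (single_map hat_map).
  by apply: F3; exists (hat_embedding A), (hat_embedding B), Phi; split=> //; exact: Phi_combines.
exists (F _ _ (fs_mor_of Psi)); split.
  rewrite -(F2 _ _ _ (fs_mor_of Phi) (fs_mor_of Psi) (fs_mor_of (am_comp Psi Phi))).
    by apply: F1; exists (hat_embedding A); exact: Psi_Phi.
  by exists (hat_embedding A), (hat_embedding B), (hat_embedding A), Phi, Psi.
rewrite -(F2 _ _ _ (fs_mor_of Psi) (fs_mor_of Phi) (fs_mor_of (am_comp Phi Psi))).
  by apply: F1; exists (hat_embedding B); exact: Phi_Psi.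
by exists (hat_embedding B), (hat_embedding A), (hat_embedding B), Psi, Phi.
Qed.

End hat_map.

(** * From fine shape to map excision *)

Section contractible.
Context {R : realType} (C : hcat R).

Definition contractible (S : metrizable_space R) : Prop :=
  exists (c : S) (h : S * unit_interval R -> S),
    [/\ continuous h, forall x, h (x, I0 R) = x & forall x, h (x, I1 R) = c].

Lemma const_continuous (S T : metrizable_space R) (c : T) : continuous (fun _ : S => c).
Proof. by move=> x; exact: cvg_cst. Qed.

Definition const_map (S T : metrizable_space R) (c : T) : pair_map (single S) (single T) :=
  single_map (ctsmap (@const_continuous S T c)).

(** The contraction identifies the identity with the constant at [c0], and the constant at [c0]
    after the constant at [c] is again the constant at [c0]. *)
Lemma const_map_contractible (S : metrizable_space R) (c : S) :
  contractible S -> hm C (const_map S c) = hid C (single S).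
Proof.
move=> [c0 [h [ch h0 h1]]].
have e : hid C (single S) = hm C (const_map S c0).
  by rewrite -hm_id; apply: hm_homotopy; apply: (@single_homotopic R S S _ _ h).
rewrite -[LHS](hcomp1l) e -hm_comp.
by apply: hm_ext.
Qed.

Lemma contractible_iso (S T : metrizable_space R) (f : pair_map (single S) (single T)) :
  contractible S -> contractible T -> is_iso (hm C f).
Proof.
move=> hS hT; have [c _] := hS; exists (hm C (const_map T c)); rewrite -!hm_comp; split.
  by rewrite -(const_map_contractible c hS); exact: hm_ext.
by rewrite -(const_map_contractible (f c) hT); exact: hm_ext.
Qed.

End contractible.

Section hat_pair.
Context {R : realType} (X : metrizable_space R) (A : set X) (cA : closed A).
Local Notation I := (interval_space (R := R)).
Local Notation I0 := (I0 R).
Local Notation I1 := (I1 R).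

(** The attached part: the cylinder of [A] together with the top. *)
Definition cyl : set (hat A) :=
  [set d | (set_val d).2 <> I0 \/ (iota_ @` A) (set_val d).1].

Lemma hat_bot (d : hat A) : (set_val d).2 = I0 -> exists x, (set_val d).1 = iota_ x.
Proof.
move=> d0; case: (set_valP d) => [[[x _ <-] _]|[[x _ <-]|d1]]; [by exists x|by exists x|].
by move: d1; rewrite /= d0 => /(congr1 ival); rewrite ival0 ival1 => /eqP; rewrite eq_sym oner_eq0.
Qed.

Lemma cvg_hat (u : nat -> hat A) (d : hat A) : u ~> d <->
  (fun n => (set_val (u n)).1) ~> (set_val d).1 /\ (fun n => (set_val (u n)).2) ~> (set_val d).2.
Proof.
apply: (iff_trans (@cvg_valP _ (hset A) u d)); exact: (@cvg_pairP (cube X) I).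
Qed.

Lemma cyl_top (d : hat A) : (set_val d).2 <> I0 ->
  (set_val d).2 = I1 \/ (iota_ @` A) (set_val d).1.
Proof. by move=> d0; case: (set_valP d) => [[]//|[|]]; [right|left]. Qed.

(** Only limits at level 0 are in question. There the levels are eventually below 1, so the terms
    lie over [A], which is closed. *)
Lemma cyl_closed : closed cyl.
Proof.
apply: seq_closed => u d ud /cvg_hat[u1 u2].
have [d0|] := pselect ((set_val d).2 = I0); last by left.
right; have [x xd] := hat_bot d0; rewrite xd; exists x => //.
rewrite d0 in u2; have /cvgR/(_ 1 ltr01)[N hN] := (cvg_ival _ _).1 u2.
have /choice[a ha] n : exists a, A a /\ iota_ a = (set_val (u (n + N)%N)).1.
  have : (iota_ @` A) (set_val (u (n + N)%N)).1.
    case: (ud (n + N)%N) => // /cyl_top[e1|//].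
    have := hN (n + N)%N (leq_addl _ _).
    by rewrite /= e1 ival0 ival1 sub0r normrN normr1 ltxx.
  by move=> [a Aa ea]; exists a.
apply: (closed_lim cA (fun n => (ha n).1)); apply/cvg_iota.
rewrite -xd; apply: cvg_eq_near (cvg_subseq (@shift_subseq N) u1).
by exists 0%N => n _ /=; rewrite (ha n).2.
Qed.

Definition hat_pair : closed_pair R := @ClosedPair R (hat A) cyl cyl_closed.

Definition base_pair : closed_pair R := @ClosedPair R X A cA.

Lemma cylS_hset (d : sub_space cyl) (u : I) :
  let k := set_val (set_val d) in
  hset A (pt k.1 (Num.max (ival k.2) (2 * ival u))).
Proof.
move=> k; have hk : hset A k := set_valP (set_val d).
have [k0|k0] := pselect (k.2 = I0).
  have [|[a Aa <-]] := set_valP d; first by [].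
  exact: hset_ptA.
have [k1|[a Aa <-]] := cyl_top k0; last exact: hset_ptA.
by apply: hset_pt_ge1; rewrite le_max /k k1 ival1 lexx.
Qed.

(** The contraction of [cyl]: levels are raised to 2, and beyond level 1 [pt] shrinks the top to a
    point. *)
Definition cylS (d : sub_space cyl) (u : I) : hat A :=
  let k := set_val (set_val d) in
  exist _ (pt k.1 (Num.max (ival k.2) (2 * ival u)) : hatK X) (mem_set (cylS_hset d u)).

Lemma cylS_cyl (d : sub_space cyl) (u : I) : cyl (cylS d u).
Proof.
set k := set_val (set_val d).
have cond l : 0 < l -> (pt k.1 l).2 <> I0.
  move=> l0 /(congr1 ival); rewrite ival0 clampIE => h.
  have : 0 < Num.min 1 l by rewrite lt_min ltr01.
  by move: h; case: lerP => // h1 h2; move: h1 h2; lra.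
have /andP[s0 _] := ival_itv k.2; have /andP[u0 _] := ival_itv u.
have [l0|l0] := ltP 0 (Num.max (ival k.2) (2 * ival u)).
  by left; exact: cond.
have ks : k.2 = I0.
  apply: ival_inj; apply/eqP; rewrite ival0 eq_le s0 andbT.
  by apply: le_trans l0; rewrite le_max lexx.
right; have [k0|[a Aa ea]] := set_valP d; first by [].
exists a => //; rewrite ea.
change (k.1 = (pt k.1 (Num.max (ival k.2) (2 * ival u))).1).
by rewrite pt_le1 // (le_trans l0).
Qed.

Lemma cyl_contractible : contractible (sub_space cyl).
Proof.
have t1 : hset A (uzero X, I1) by right; right.
pose c0 : hat A := exist _ ((uzero X, I1) : hatK X) (mem_set t1).
have t2 : cyl c0.
  by left => /(congr1 ival); rewrite ival0 ival1 => /eqP; rewrite oner_eq0.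
exists (exist _ c0 (mem_set t2)), (fun p => exist _ (cylS p.1 p.2) (mem_set (cylS_cyl p.1 p.2))); split.
- apply: (@seq_continuous R (prod_space (sub_space cyl) I)).
  move=> w p /(@cvg_pairP (sub_space cyl) I)[/(@cvg_valP _ cyl)/cvg_hat[w1 w2] w3].
  apply/(@cvg_valP _ cyl)/(@cvg_valP _ (hset A)).
  apply: cvg_pt; first exact: w1.
  apply: cvg_maxr; first by apply/cvg_ival.
  by apply: cvgM; [exact: cvg_cst|apply/cvg_ival].
- move=> d; apply: set_val_inj; apply: set_val_inj.
  set k := set_val (set_val d); change (pt k.1 (Num.max (ival k.2) (2 * ival I0)) = k).
  have /andP[s0 _] := ival_itv k.2.
  by rewrite ival0 mulr0 (max_idPl s0) pt_self.
- move=> d; apply: set_val_inj; apply: set_val_inj.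
  set k := set_val (set_val d).
  change (pt k.1 (Num.max (ival k.2) (2 * ival I1)) = (uzero X, I1)).
  by rewrite pt_ge2 // ival1 mulr1 le_max lexx orbT.
Qed.

(** The part to be excised. Its closure has positive level, hence lies in the interior of [cyl];
    what remains is [X] with a partial cylinder over [A], which slides down to [X]. *)
Definition upper : set (hat_pair) := [set d | 1 / 2 < ival (set_val d).2].

Lemma upper_open : open upper.
Proof.
rewrite -closedC; apply: seq_closed => u d ud /cvg_hat[_ /cvg_ival/cvgR u2] dU.
have [|N hN] := u2 (ival (set_val d).2 - 1 / 2); first by rewrite subr_gt0.
have := hN N (leqnn N); have /negP := ud N; rewrite -leNgt /= ltr_norml => ? /andP[_]; lra.
Qed.

Lemma upper_closure : closure upper `<=` interior cyl.
Proof.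
move=> d /(@closure_seq R (hat A))[u uU /cvg_hat[_ /cvg_ival/cvgR u2]].
have d2 : 1 / 2 <= ival (set_val d).2.
  rewrite leNgt; apply/negP => lt2.
  have [|N hN] := u2 (1 / 2 - ival (set_val d).2); first by rewrite subr_gt0.
  have := hN N (leqnn N); have := uU N; rewrite /upper /= ltr_norml => ? /andP[? _]; lra.
have pos : open [set e : hat A | 0 < ival (set_val e).2].
  rewrite -closedC; apply: seq_closed => w e we /cvg_hat[_ /cvg_ival/cvgR w2] e0.
  have [|N hN] := w2 (ival (set_val e).2); first by [].
  have := hN N (leqnn N); have /negP := we N; rewrite -leNgt /= ltr_norml => ? /andP[_]; lra.
have : nbhs d [set e : hat A | 0 < ival (set_val e).2].
  by apply: open_nbhs_nbhs; split=> //=; lra.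
apply: filterS => e /= e0; left => e1.
by move: e0; rewrite e1 ival0 ltxx.
Qed.

Lemma base_hset (x : X) : hset A (iota_ x, I0).
Proof. by left; split=> //; exists x. Qed.

Definition base_hat (x : X) : hat A := exist _ ((iota_ x, I0) : hatK X) (mem_set (base_hset x)).

Lemma base_lower (x : X) : (~` upper) (base_hat x).
Proof. by rewrite /upper /= ival0 => /lt_trans/(_ (_ : 0 < 1 / 2)); rewrite ltxx divr_gt0 // => /(_ isT). Qed.

Lemma base_continuous : continuous (fun x => exist _ (base_hat x) (mem_set (@base_lower x)) : sub_space (~` upper)).
Proof.
apply: seq_continuous => u x ux; apply/(@cvg_valP _ (~` upper))/cvg_hat.
by split; [apply/cvg_iota|exact: cvg_const].
Qed.

Definition base_excised : pair_map base_pair (excised upper).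
Proof.
refine (@PairMap R base_pair (excised upper) (ctsmap base_continuous) _).
by move=> x Ax; right; exists x.
Defined.

Lemma lower_iota (d : sub_space (~` upper)) : exists x, iota_ x = (set_val (set_val d)).1.
Proof.
have [e|[[x _ e]|e]] := set_valP (set_val d); [by case: e => [[x _ e] _]; exists x|by exists x|].
have /negP := set_valP d; rewrite /upper /= e ival1; lra.
Qed.

Definition lower_fun (d : sub_space (~` upper)) : X := sval (cid (lower_iota d)).

Lemma lower_funE d : iota_ (lower_fun d) = (set_val (set_val d)).1.
Proof. exact: svalP (cid (lower_iota d)). Qed.

Lemma lower_continuous : continuous lower_fun.
Proof.
apply: seq_continuous => u d /(@cvg_valP _ (~` upper))/cvg_hat[u1 _].
apply/cvg_iota; rewrite lower_funE.
by rewrite (_ : iota_ \o (lower_fun \o u) = fun n => (set_val (set_val (u n))).1) //;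
  apply/funext => n; rewrite /comp lower_funE.
Qed.

Lemma lower_cyl (d : sub_space (~` upper)) : cyl (set_val d) -> A (lower_fun d).
Proof.
have E (a : X) : A a -> iota_ a = (set_val (set_val d)).1 -> A (lower_fun d).
  by move=> Aa; rewrite -lower_funE => /iota_inj <-.
case=> [/cyl_top[e|[a Aa ea]]|[a Aa ea]]; [|exact: E ea|exact: E ea].
have /negP := set_valP d; rewrite /upper /= e ival1; lra.
Qed.

Definition excised_base : pair_map (excised upper) base_pair :=
  @PairMap R (excised upper) base_pair (ctsmap lower_continuous) lower_cyl.

Lemma slide_hset (p : sub_space (~` upper) * unit_interval R) :
  hset A ((set_val (set_val p.1)).1, mulI (set_val (set_val p.1)).2 p.2).
Proof.
have [[h e]|[h|e]] := set_valP (set_val p.1).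
- by left; rewrite /= e mul0I.
- by right; left.
- have /negP := set_valP p.1; rewrite /upper /= e ival1; lra.
Qed.

Definition slide (p : sub_space (~` upper) * unit_interval R) : hat A :=
  exist _ (((set_val (set_val p.1)).1, mulI (set_val (set_val p.1)).2 p.2) : hatK X)
    (mem_set (slide_hset p)).

Lemma slide_lower p : (~` upper) (slide p).
Proof.
move=> h; apply: (set_valP p.1); apply: lt_le_trans h _.
change (ival (mulI (set_val (set_val p.1)).2 p.2) <= ival (set_val (set_val p.1)).2).
have /andP[? ?] := ival_itv p.2; have /andP[? ?] := ival_itv (set_val (set_val p.1)).2.
by rewrite ival_mulI ler_piMr.
Qed.

Lemma base_excised_iso (C : hcat R) : is_iso (hm C base_excised).
Proof.
apply: (@iso_pair_homotopy _ _ _ _ _ excised_base).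
  apply: pair_homotopic_eq => x; apply: (@iota_inj R X).
  exact: (lower_funE (base_excised x)).
have ch : continuous (fun p => exist _ (slide p) (mem_set (@slide_lower p)) : sub_space (~` upper)).
  apply: (@seq_continuous R (prod_space (sub_space (~` upper)) I)).
  move=> w p /(@cvg_pairP (sub_space (~` upper)) I)[/(@cvg_valP _ (~` upper))/cvg_hat[w1 w2] w3].
  by apply/(@cvg_valP _ (~` upper))/cvg_hat; split; [exact: w1|exact: cvg_mulI].
exists (ctsmap ch); split.
- move=> d; apply: set_val_inj; apply: set_val_inj.
  change (((set_val (set_val d)).1, mulI (set_val (set_val d)).2 I0) = (iota_ (lower_fun d), I0)).
  by rewrite mulI0 lower_funE.
- move=> d; apply: set_val_inj; apply: set_val_inj.
  change (((set_val (set_val d)).1, mulI (set_val (set_val d)).2 I1) = set_val (set_val d)).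
  by rewrite mulI1; case: (set_val (set_val d)).
- move=> d t cd; right; exists (lower_fun d); first exact: lower_cyl.
  exact: lower_funE.
Qed.

Lemma base_pair_iso (C : hcat R) : hcat_axioms C ->
  is_iso (hm C (pair_comp (excision_map upper) base_excised)).
Proof.
move=> aC; rewrite hm_comp; apply: iso_comp; last exact: base_excised_iso.
by apply: (hcat_excision aC); [exact: upper_open|exact: upper_closure].
Qed.

End hat_pair.

Section map_excision_of_functor.
Context {R : realType} (C : hcat R) (aC : hcat_axioms C).
Context (F : forall X Y : metrizable_space R, fs_mor X Y -> hmor C (single X) (single Y)).
Hypothesis hF : is_fs_functor F.

Lemma map_excision_of_fs_functor : hcat_map_excision C.
Proof.
move=> [P A cA] [Q B cB] f cf hf; have [gi [g1 g2 g3 g4]] := partial_inverse cf hf.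
have fA : forall a, A a -> B (f a) by move=> a; exact: (@pair_funP _ _ _ f).
have cnt : continuous f by exact: cts_fun.
pose phi := hat_map cnt fA.
have phic d : cyl d -> cyl (phi d).
  set k := set_val d; move=> hd.
  have E : set_val (phi d) = pt (Fh f (k.1, I0 R)) (2 * ival k.2) by [].
  have [k0|k0] := pselect (k.2 = I0 R).
    right; case: hd => [//|[a Aa ka]].
    by rewrite E k0 ival0 mulr0 pt_le1 ?ler01 // -ka FhE; exists (f a) => //; exact: (fA a Aa).
  left; rewrite E => /(congr1 ival); rewrite ival0 clampIE => h.
  have /andP[s0 _] := ival_itv k.2.
  have s1 : 0 < ival k.2.
    by rewrite lt_neqAle s0 andbT eq_sym; apply/eqP => e; apply: k0; apply: ival_inj.
  have : 0 < Num.min 1 (2 * ival k.2) by rewrite lt_min ltr01 mulr_gt0.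
  by move: h; case: lerP => // h1 h2; move: h1 h2; lra.
pose phip : pair_map (hat_pair cA) (hat_pair cB) :=
  @PairMap R (hat_pair cA) (hat_pair cB) phi phic.
have iphi : is_iso (hm C phip).
  apply: (hcat_five aC).
    by apply: contractible_iso; exact: cyl_contractible.
  exact: (hat_map_iso cnt fA cB g1 g2 g3 g4 hF).
pose jP : pair_map (base_pair cA) (hat_pair cA) := pair_comp (excision_map (@upper R P A cA)) (@base_excised R P A cA).
pose jQ : pair_map (base_pair cB) (hat_pair cB) := pair_comp (excision_map (@upper R Q B cB)) (@base_excised R Q B cB).
have sq : hm C jQ \; hm C f = hm C phip \; hm C jP.
  rewrite -!hm_comp; apply: hm_ext => x; apply: set_val_inj.
  change ((iota_ (f x), I0 R) = pt (Fh f (iota_ x, I0 R)) (2 * ival (I0 R))).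
  by rewrite FhE ival0 mulr0 pt_le1 ?ler01 // clampI0.
apply: (iso_comp_l (g := hm C jQ)).
  by rewrite sq; apply: iso_comp iphi _; exact: base_pair_iso.
exact: base_pair_iso.
Qed.

End map_excision_of_functor.

Lemma fs_functor_of_map_excision (R : realType) (C : hcat R) :
  hcat_axioms C -> hcat_map_excision C ->
  exists F : forall X Y, fs_mor X Y -> hmor C (single X) (single Y), is_fs_functor F.
Proof.
move=> aC mC; apply: fs_functor_ex => D P f cf hf.
exact: (hcat_sub aC (mC _ _ _ cf hf)).
Qed.

Theorem theorem3 (R : realType) :
  (forall H : homology_theory R,
     map_excision H <-> fine_shape_invariant H) /\
  (forall H : cohomology_theory R,
     comap_excision H <-> fine_shape_coinvariant H).
Proof.
split=> H.
  split=> [/homology_map_excisionP h|/homology_fine_shapeP[F hF]].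
    apply/homology_fine_shapeP; exact: fs_functor_of_map_excision (hcat_homology_axioms H) h.
  by apply/homology_map_excisionP; exact: (@map_excision_of_fs_functor _ _ (hcat_homology_axioms H) _ hF).
split=> [/cohomology_map_excisionP h|/cohomology_fine_shapeP[F hF]].
  apply/cohomology_fine_shapeP; exact: fs_functor_of_map_excision (hcat_cohomology_axioms H) h.
by apply/cohomology_map_excisionP; exact: (@map_excision_of_fs_functor _ _ (hcat_cohomology_axioms H) _ hF).
Qed.
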